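(* Let $u\in C(\mathbb R;H^1(\mathbb T;\mathbb R))$ be a solution of $$(1-\partial_x^2)u_t+\partial_x\Big(u+\frac{u^2}{2}\Big)=0\qquad\text{on }\mathbb T\times\mathbb R,$$ and let $\psi(\cdot,t)=(1-\partial_x^2)^{-1}\big(u(\cdot,t)+\tfrac12u(\cdot,t)^2\big)$. If, for some $x_0\in\mathbb T$, $C\in\mathbb R$ and $T>0$, $$u(x_0,t)=C\quad\text{and}\quad \psi(x_0,t)=C+\frac{C^2}{2}\qquad\text{for all }t\in(0,T),$$ then $u\equiv C$ on $\mathbb T\times\mathbb R$.
   Context: $\mathbb T=\mathbb R/(2\pi\mathbb Z)$. A solution $u\in C(\mathbb R;H^1(\mathbb T;\mathbb R))$ is understood in the sense of distributions; equivalently, $u\in C^1(\mathbb R;H^1(\mathbb T))$ and $u_t=-\psi_x$ for all $t$. Here $(1-\partial_x^2)^{-1}$ is the Fourier multiplier $(1+k^2)^{-1}$, $k\in\mathbb Z$, on $\mathbb T$ (equivalently, convolution with $G(x)=\frac{\cosh(\pi-|x|)}{2\sinh\pi}$, $|x|\le\pi$). Point values $u(x_0,t)$ and $\psi(x_0,t)$ refer to the continuous representatives of $u(\cdot,t)$ and $\psi(\cdot,t)$. *)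

(* Defs.v *)
From HB Require Import structures.
From mathcomp Require Import all_boot all_order all_algebra.
From mathcomp Require Import all_classical all_reals all_analysis.
From mathcomp.real_closed Require Import complex.
Set Implicit Arguments.
Unset Strict Implicit.
Unset Printing Implicit Defensive.
Import Order.TTheory GRing.Theory Num.Theory.
Import numFieldNormedType.Exports.
Local Open Scope classical_set_scope.
Local Open Scope ring_scope.

(* Functions on the circle are 2pi-periodic functions on R; a function of time
   and space is written u t x. An element of H^1 is represented by its
   continuous representative. *)

Section Circle.
Variable R : realType.

Definition on_circle (f : R -> R) : Prop := periodic f (pi *+ 2).

Definition circle_int (f : R -> R) : R :=
  \int[@lebesgue_measure R]_(x in `[- pi, pi]) f x.

Definition circle_L2 (v : R -> R) : Prop :=
  [/\ on_circle v, measurable_fun setT v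
    & (@lebesgue_measure R).-integrable `[- pi, pi] (fun x => (v x ^+ 2)%:E)].

Definition circle_test (phi : R -> R) : Prop :=
  on_circle phi /\ forall n x, derivable (derive1n n phi) x 1.

Definition weak_derivative (f v : R -> R) : Prop :=
  forall phi, circle_test phi ->
    circle_int (fun x => f x * derive1 phi x) = - circle_int (fun x => v x * phi x).

Definition circle_H1 (f : R -> R) : Prop :=
  [/\ on_circle f, continuous f
    & exists v, circle_L2 v /\ weak_derivative f v].

(* Determined up to a null set when f is in H^1; zero by convention otherwise. *)
Definition H1_derivative (f : R -> R) : R -> R :=
  xget (fun=> 0) [set v | circle_L2 v /\ weak_derivative f v].

Definition H1_norm (f : R -> R) : R :=
  Num.sqrt (circle_int (fun x => f x ^+ 2)
            + circle_int (fun x => H1_derivative f x ^+ 2)).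

Definition continuous_in_H1 (u : R -> R -> R) : Prop :=
  (forall t, circle_H1 (u t)) /\
  (forall s, (fun t => H1_norm (fun x => u t x - u s x)) @ s --> 0).

Definition fourier_coef (f : R -> R) (k : int) : R[i] :=
  ((circle_int (fun x => f x * cos (k%:~R * x)) / (pi *+ 2))
   -i* (circle_int (fun x => f x * sin (k%:~R * x)) / (pi *+ 2)))%C.

(* g is the continuous representative of (1 - d_x^2)^(-1) f. *)
Definition inv_helmholtz (f g : R -> R) : Prop :=
  [/\ on_circle g, continuous g
    & forall k : int, fourier_coef g k =
        ((1 + k%:~R ^+ 2)^-1)%:C%C * fourier_coef f k].

Definition dt (phi : R -> R -> R) : R -> R -> R :=
  fun t x => derive1 (phi ^~ x) t.

Definition dx (phi : R -> R -> R) : R -> R -> R :=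
  fun t x => derive1 (phi t) x.

Definition iter_partial (s : seq bool) (phi : R -> R -> R) : R -> R -> R :=
  foldr (fun b : bool => if b then dt else dx) phi s.

Definition smooth2 (phi : R -> R -> R) : Prop :=
  forall s, let g := iter_partial s phi in
    [/\ continuous (fun p : R * R => g p.1 p.2),
        forall t x, derivable (g ^~ x) t 1
      & forall t x, derivable (g t) x 1].

(* C_c^infty test functions on the cylinder: compact support in time only. *)
Definition cylinder_test (phi : R -> R -> R) : Prop :=
  [/\ smooth2 phi, forall t, on_circle (phi t)
    & exists M : R, forall t x, M < `|t| -> phi t x = 0].

(* (1 - d_x^2) u_t + d_x (u + u^2/2) = 0 in the sense of distributions, with
   every derivative transferred to the test function and an overall sign
   removed. *)
Definition distributional_solution (u : R -> R -> R) : Prop :=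
  forall phi, cylinder_test phi ->
    \int[@lebesgue_measure R]_t circle_int (fun x =>
        u t x * (dt phi t x - dt (dx (dx phi)) t x)
        + (u t x + u t x ^+ 2 / 2) * dx phi t x) = 0.

End Circle.

(* Main.v *)
(* Fourier series in x turn the distributional equation into ODEs for the
   coefficients, which sum up to u_t = - psi_x in the sup norm, psi being
   the periodic solution of psi - psi'' = u + u^2/2. The H^1 energy is conserved:
   its Fourier truncations have rates of change tending to zero. Hence u is
   bounded, and equicontinuous in x, uniformly in time.

   Put w = u - C and F = (1 + C) w + w^2/2, so that w_t = - phi_x with
   phi - phi'' = F. The power series in t of this quadratic ODE has
   geometrically bounded coefficients at every time, with a uniform radius; so w
   and phi, which vanish at x0 for t in (0,T), vanish there for all t, and so
   does phi_x = - w_t. Over one period starting at x0,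

      D(t) = \int e^(2x) ((1 + C) w^2/2 + w^3/6) dx

   satisfies D' = - \int e^(2x) (phi + phi_x)^2 dx. As D is bounded, this
   dissipation Q becomes small at times tending to both infinities. Small Q forces
   phi + phi_x, then F, then w to be small (w is zero at x0 and cannot leave
   a neighbourhood of zero while F is small), so D is small there too. D being
   monotone, D = 0 and Q = 0 at all times, whence w = 0. *)

Require Import Defs.
From HB Require Import structures.
From mathcomp Require Import all_boot all_order all_algebra.
From mathcomp Require Import all_classical all_reals all_analysis.
From mathcomp Require Import measurable_realfun.
From mathcomp Require Import ring lra.
Import Order.TTheory GRing.Theory Num.Theory.
Import numFieldNormedType.Exports.
Local Open Scope classical_set_scope.
Local Open Scope ring_scope.

(** * One-variable calculus: derivatives, primitives and oriented integrals *)

Section Integral.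
Set Implicit Arguments.
Unset Strict Implicit.
Unset Printing Implicit Defensive.
Variable R : realType.
Implicit Types (f g F G : R -> R) (a b x : R).
Notation mu := (@lebesgue_measure R).

(** The weight e^(2x) is dictated by the algebra. If phi'' = phi - F, then for any weight g the
    derivative of g (phi^2 + phi'^2)/2 is g' (phi^2 + phi'^2)/2 + 2 g phi phi' - g F phi', and for
    g' = 2 g the first two terms become the perfect square g (phi + phi')^2. Such a weight is not
    periodic, so an integral over one period leaves boundary terms; they disappear because phi and
    phi' both vanish at x0. As D is compared at times tending to both infinities, this vanishing
    must first be extended from (0,T) to all times.

    The extension works because d_x (1 - d_x^2)^(-1) has norm at most 1 for the sup norm: the
    equation is an ordinary differential equation with quadratic right-hand side in the continuous
    functions, hence analytic in time.

    A further obstacle is that (1 + C) w + w^2/2 has the second zero w = -2 (1 + C), so that a small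
    F alone does not make w small. The zero of w at x0 selects the right branch, by continuity in
    x. *)

Definition antideriv F f := forall x, is_derive x 1 F (f x).

Lemma is_derive_add F G x (u v : R) : is_derive x 1 F u -> is_derive x 1 G v ->
  is_derive x 1 (fun y => F y + G y) (u + v).
Proof. by move=> ? ?; exact: is_deriveD. Qed.

Lemma is_derive_sub F G x (u v : R) : is_derive x 1 F u -> is_derive x 1 G v ->
  is_derive x 1 (fun y => F y - G y) (u - v).
Proof. by move=> ? ?; exact: is_deriveB. Qed.

Lemma is_derive_opp F x (u : R) : is_derive x 1 F u ->
  is_derive x 1 (fun y => - F y) (- u).
Proof. by move=> ?; exact: is_deriveN. Qed.

Lemma is_derive_mul F G x (u v : R) : is_derive x 1 F u -> is_derive x 1 G v ->
  is_derive x 1 (fun y => F y * G y) (u * G x + F x * v).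
Proof.
move=> hF hG; apply: is_derive_eq (is_deriveM hF hG) _.
by rewrite /GRing.scale /=; ring.
Qed.

Lemma is_derive_const (c x : R) : is_derive x 1 (fun=> c) (0 : R).
Proof. exact: is_derive_cst. Qed.

Lemma is_derive_scale (c : R) F x (u : R) : is_derive x 1 F u ->
  is_derive x 1 (fun y => c * F y) (c * u).
Proof. by move=> ?; exact: is_deriveZ. Qed.

Lemma is_derive_comp F G x (u v : R) : is_derive (G x) 1 F u -> is_derive x 1 G v ->
  is_derive x 1 (fun y => F (G y)) (u * v).
Proof. by move=> ? ?; exact: is_derive1_comp. Qed.

Lemma is_derive_exp F x (u : R) n : is_derive x 1 F u ->
  is_derive x 1 (fun y => F y ^+ n) (n%:R * F x ^+ n.-1 * u).
Proof.
move=> dF; case: n => [|n].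
  rewrite !mul0r (_ : (fun y => _) = fun=> 1); first exact: is_derive_const.
  by apply/funext => y; rewrite expr0.
elim: n => [|n ih].
  rewrite (_ : (fun y => _) = F); last by apply/funext => y; rewrite expr1.
  by rewrite expr0 !mul1r.
rewrite (_ : (fun y => _) = fun y => F y * F y ^+ n.+1); last by apply/funext => y; rewrite exprS.
by apply: is_derive_eq (is_derive_mul dF ih) _; rewrite /= !exprS -!natr1; ring.
Qed.

Lemma is_derive_bigsum (I : Type) (r : seq I) (P : pred I) (F : I -> R -> R) (u : I -> R) x :
  (forall i, P i -> is_derive x 1 (F i) (u i)) ->
  is_derive x 1 (fun y => \sum_(i <- r | P i) F i y) (\sum_(i <- r | P i) u i).
Proof.
move=> h; elim: r => [|i r ih].
  rewrite big_nil (_ : (fun _ => _) = fun=> 0); first exact: is_derive_const.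
  by apply/funext => y; rewrite big_nil.
rewrite big_cons (_ : (fun y => _) = (fun y => if P i then F i y + \sum_(i <- r | P i) F i y
  else \sum_(i <- r | P i) F i y)); last by apply/funext => y; rewrite big_cons.
by case: ifP => Pi //; apply: is_derive_add => //; exact: h.
Qed.

Lemma is_derive_continuous F f : antideriv F f -> continuous F.
Proof.
move=> h x; apply: differentiable_continuous; apply/derivable1_diffP.
exact: (@ex_derive _ _ _ _ _ _ _ (h x)).
Qed.

(** The division-free form of the derivative is the one that can be required uniformly in a
    parameter, as [time_derivative] does later. *)
Lemma is_derive_epsP F x (d : R) : (forall e, 0 < e -> exists2 r : R, 0 < r &
    forall h, `|h| < r -> `|F (x + h) - F x - h * d| <= e * `|h|) ->
  is_derive x 1 F d.
Proof.
move=> H.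
suff Hf : h^-1 *: ((F \o shift x) (h *: (1:R)) - F x) @[h --> 0^'] --> d.
  have F1 : 'D_1 F x = d by apply: cvg_lim.
  by rewrite -F1 in Hf *; constructor.
apply/cvgrPdist_le => e e0; have [r r0 Hr] := H e e0.
near=> h.
have h0 : h != 0 by near: h; exact: nbhs_dnbhs_neq.
have hr : `|h| < r.
  by near: h; apply: dnbhs0_lt.
have H1 := Hr h hr; rewrite /= /GRing.scale /= mulr1 (addrC h x).
have nh : 0 < `|h| by rewrite normr_gt0.
rewrite -(ler_pM2r nh) -normrM; apply: le_trans H1.
rewrite -normrN le_eqVlt; apply/orP; left; apply/eqP; congr (`|_|).
by field.
Unshelve. all: by end_near. Qed.

Lemma is_derive_eps F x (d : R) : is_derive x 1 F d ->
  forall e, 0 < e -> exists2 r : R, 0 < r &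
    forall h, `|h| < r -> `|F (x + h) - F x - h * d| <= e * `|h|.
Proof.
move=> /is_derive1_caratheodory[g [fE gc gx]] e e0.
have /cvgrPdist_lt /(_ e e0) /nbhs_ballP[r r0 Hr] := gc.
exists r => // h hr; rewrite (_ : _ - _ = (g (x + h) - g x) * h); last by rewrite fE gx; ring.
rewrite normrM ler_wpM2r //; apply: ltW; rewrite distrC; apply: Hr.
by rewrite /ball /= (_ : x - (x + h) = - h) ?normrN //; ring.
Qed.

Lemma derive0_const F : antideriv F (fun=> 0) -> forall x y, F x = F y.
Proof. by move=> h x y; exact: is_derive_0_is_cst. Qed.

Lemma mean_value F f a b : a <= b -> (forall x, a <= x <= b -> is_derive x 1 F (f x)) ->
  exists2 c, a <= c <= b & F b - F a = f c * (b - a).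
Proof.
move=> ab h.
have h1 x : x \in `]a, b[ -> is_derive x 1 F (f x).
  by rewrite in_itv /= => /andP[/ltW ax /ltW xb]; apply: h; rewrite ax xb.
have h2 : {within `[a, b], continuous F}.
  apply: derivable_within_continuous => x; rewrite in_itv /= => xab.
  exact: (@ex_derive _ _ _ _ _ _ _ (h x xab)).
by have [c] := MVT_segment ab h1 h2; rewrite in_itv /= => cab ->; exists c.
Qed.

Lemma mean_value_bound F f a b (M : R) :
  (forall x, Num.min a b <= x <= Num.max a b -> is_derive x 1 F (f x) /\ `|f x| <= M) ->
  `|F b - F a| <= M * `|b - a|.
Proof.
wlog ab : a b / a <= b => [hw h|h].
  case: (leP a b) => [|/ltW] ab; first exact: hw.
  by rewrite distrC (distrC b); apply: hw => //; rewrite minC maxC.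
rewrite min_l // max_r // in h.
have [x hx|c cab ->] := @mean_value F f a b ab; first by case: (h x hx).
by rewrite normrM ler_wpM2r //; case: (h c cab).
Qed.

Lemma mean_value_le F f a b : a <= b ->
  (forall x, a <= x <= b -> is_derive x 1 F (f x) /\ f x <= 0) -> F b <= F a.
Proof.
move=> ab h; have [x hx|c cab E] := @mean_value F f a b ab; first by case: (h x hx).
rewrite -subr_le0 E mulr_le0_ge0 ?subr_ge0 //; by case: (h c cab).
Qed.

Lemma continuous_add f g : continuous f -> continuous g -> continuous (fun x => f x + g x).
Proof. by move=> hf hg x; apply: cvgD; [exact: hf|exact: hg]. Qed.

Lemma continuous_sub f g : continuous f -> continuous g -> continuous (fun x => f x - g x).
Proof. by move=> hf hg x; apply: cvgB; [exact: hf|exact: hg]. Qed.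

Lemma continuous_mul f g : continuous f -> continuous g -> continuous (fun x => f x * g x).
Proof. by move=> hf hg x; apply: cvgM; [exact: hf|exact: hg]. Qed.

Lemma continuous_const (c : R) : continuous (fun _ : R => c).
Proof. by move=> x; exact: cvg_cst. Qed.

Lemma continuous_scale (c : R) f : continuous f -> continuous (fun x => c * f x).
Proof. by move=> hf; apply: continuous_mul => //; exact: continuous_const. Qed.

Lemma continuous_sqr f : continuous f -> continuous (fun x => f x ^+ 2).
Proof.
move=> hf; under eq_fun do rewrite expr2; exact: continuous_mul.
Qed.

Lemma continuous_bigsum (I : Type) (r : seq I) (P : pred I) (f : I -> R -> R) :
  (forall i, continuous (f i)) -> continuous (fun y => \sum_(i <- r | P i) f i y).
Proof.
move=> h; elim: r => [|i r ih].
  under eq_fun do rewrite big_nil; exact: continuous_const.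
under eq_fun do rewrite big_cons.
by case: (P i) => //; apply: continuous_add.
Qed.

Lemma continuous_integrable f a b : continuous f ->
  mu.-integrable `[a, b] (EFin \o f).
Proof.
move=> cf; apply: continuous_compact_integrable; first exact: segment_compact.
exact: continuous_subspaceT.
Qed.

(** The sign for negative x makes this one primitive on the whole line, so that [oint] below is an
    oriented integral. *)
Definition prim f x : R := if 0 <= x then \int[mu]_(y in `[0, x]) f y
  else - \int[mu]_(y in `[x, 0]) f y.

Lemma primE f (c x : R) : continuous f -> c <= 0 -> c <= x ->
  prim f x = \int[mu]_(y in `[c, x]) f y - \int[mu]_(y in `[c, 0]) f y.
Proof.
move=> cf c0 cx; rewrite /prim; case: leP => [x0|/ltW x0].
  rewrite (@Rintegral_itvB _ f (BLeft c) (BRight x) 0) ?bnd_simp //; last exact: continuous_integrable.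
  rewrite Rintegral_itv_obnd_cbnd //.
  apply: integrableS (continuous_integrable 0 x cf) => //.
  by apply: subset_itvr; rewrite bnd_simp.
rewrite -opprB; congr (- _).
rewrite (@Rintegral_itvB _ f (BLeft c) (BRight 0) x) ?bnd_simp //; last exact: continuous_integrable.
rewrite Rintegral_itv_obnd_cbnd //.
apply: integrableS (continuous_integrable x 0 cf) => //.
by apply: subset_itvr; rewrite bnd_simp.
Qed.

Lemma is_derive_prim f x : continuous f -> is_derive x 1 (prim f) (f x).
Proof.
move=> cf; pose c := Num.min 0 x - 1.
have c0 : c < 0 by rewrite /c; case: (leP 0 x) => h; lra.
have cx : c < x by rewrite /c; case: (leP 0 x) => h; lra.
have [d1 d2] := @continuous_FTC1_closed R f c x (x + 1) ltac:(lra)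
  (continuous_integrable _ _ cf) cx (cf x).
have D : is_derive x 1 (fun y => \int[mu]_(t in `[c, y]) f t - \int[mu]_(t in `[c, 0]) f t) (f x).
  have Dx : is_derive x 1 (fun y => \int[mu]_(t in `[c, y]) f t) (f x).
    by split; [exact: d1|rewrite -derive1E d2].
  by apply: is_derive_eq (is_derive_sub Dx (is_derive_const _ _)) _; rewrite subr0.
apply: (@near_eq_is_derive _ _ _ _ _ _ _ _ _ D) => //.
near=> y; symmetry; apply: primE => //; first exact: ltW.
by apply: ltW; near: y; apply: lt_nbhsr.
Unshelve. all: by end_near. Qed.

(** As a difference of values of a primitive, this integral inherits linearity, integration by parts
    and bounds from the uniqueness of antiderivatives and the mean value theorem. *)
Definition oint f a b := prim f b - prim f a.

Lemma oint_FTC F f a b : continuous f -> antideriv F f ->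
  oint f a b = F b - F a.
Proof.
move=> cf hF; rewrite /oint.
have D0 h := @derive0_const (fun x => prim f x - F x) h b a.
suff h : antideriv (fun x => prim f x - F x) (fun=> 0) by have := D0 h; lra.
move=> x; rewrite -(subrr (f x)); apply: is_derive_sub => //; exact: is_derive_prim.
Qed.

Lemma Rintegral_oint f a b : continuous f -> a <= b ->
  \int[mu]_(x in `[a, b]) f x = oint f a b.
Proof.
move=> cf ab; pose c := Num.min 0 a.
have c0 : c <= 0 by rewrite /c ge_min lexx.
have ca : c <= a by rewrite /c ge_min lexx orbT.
rewrite /oint (@primE f c b) ?(@primE f c a) //; last exact: le_trans ab.
rewrite opprB addrA subrK.
rewrite (@Rintegral_itvB _ f (BLeft c) (BRight b) a) ?bnd_simp //; last exact: continuous_integrable.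
rewrite Rintegral_itv_obnd_cbnd //.
apply: integrableS (continuous_integrable a b cf) => //.
by apply: subset_itvr; rewrite bnd_simp.
Qed.

Lemma circle_int_oint f : continuous f -> circle_int f = oint f (- pi) pi.
Proof. by move=> cf; rewrite /circle_int Rintegral_oint // ; have := pi_ge0 R; lra. Qed.

Lemma ointD f g a b : continuous f -> continuous g ->
  oint (fun x => f x + g x) a b = oint f a b + oint g a b.
Proof.
move=> cf cg; rewrite (@oint_FTC (fun x => prim f x + prim g x)).
- by rewrite /oint; ring.
- exact: continuous_add.
by move=> x; apply: is_derive_add; exact: is_derive_prim.
Qed.

Lemma ointZ (c : R) f a b : continuous f -> oint (fun x => c * f x) a b = c * oint f a b.
Proof.
move=> cf; rewrite (@oint_FTC (fun x => c * prim f x)).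
- by rewrite /oint; ring.
- exact: continuous_scale.
by move=> x; apply: is_derive_scale; exact: is_derive_prim.
Qed.

Lemma ointB f g a b : continuous f -> continuous g ->
  oint (fun x => f x - g x) a b = oint f a b - oint g a b.
Proof.
move=> cf cg; rewrite (@oint_FTC (fun x => prim f x - prim g x)).
- by rewrite /oint; ring.
- exact: continuous_sub.
by move=> x; apply: is_derive_sub; exact: is_derive_prim.
Qed.

Lemma oint_cat f a b c : oint f a b + oint f b c = oint f a c.
Proof. by rewrite /oint; ring. Qed.

Lemma oint_sum (I : Type) (r : seq I) (P : pred I) (f : I -> R -> R) a b :
  (forall i, continuous (f i)) ->
  oint (fun x => \sum_(i <- r | P i) f i x) a b = \sum_(i <- r | P i) oint (f i) a b.
Proof.
move=> h; rewrite (@oint_FTC (fun x => \sum_(i <- r | P i) prim (f i) x)).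
- by rewrite -sumrB.
- exact: continuous_bigsum.
by move=> x; apply: is_derive_bigsum => i _; exact: is_derive_prim.
Qed.

Lemma oint_bound f a b (M : R) : continuous f -> a <= b ->
  (forall x, a <= x <= b -> `|f x| <= M) -> `|oint f a b| <= M * (b - a).
Proof.
move=> cf ab h; rewrite -[b - a]ger0_norm ?subr_ge0 //.
apply: (@mean_value_bound _ f) => x; rewrite min_l // max_r // => hx.
by split; [exact: is_derive_prim|exact: h].
Qed.

Lemma oint_ge0 f a b : continuous f -> a <= b ->
  (forall x, a <= x <= b -> 0 <= f x) -> 0 <= oint f a b.
Proof.
move=> cf ab h; have [x hx|c cab E] := @mean_value (prim f) f a b ab.
  exact: is_derive_prim.
by rewrite /oint E mulr_ge0 ?subr_ge0 ?h.
Qed.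

Lemma oint_le f g a b : continuous f -> continuous g -> a <= b ->
  (forall x, a <= x <= b -> f x <= g x) -> oint f a b <= oint g a b.
Proof.
move=> cf cg ab h; rewrite -subr_ge0 -ointB //; apply: oint_ge0 => //.
  exact: continuous_sub.
by move=> x hx; rewrite subr_ge0 h.
Qed.

Lemma oint_cst (c : R) a b : oint (fun=> c) a b = c * (b - a).
Proof.
rewrite (@oint_FTC (fun x => c * x)); first by ring.
- exact: continuous_const.
move=> x; rewrite -[X in is_derive _ _ _ X](mulr1 c); exact: is_derive_scale.
Qed.

Lemma oint_parts F G f g a b : continuous f -> continuous g ->
  antideriv F f -> antideriv G g ->
  oint (fun x => F x * g x) a b = F b * G b - F a * G a - oint (fun x => f x * G x) a b.
Proof.
move=> cf cg dF dG.
have cF : continuous F by apply: is_derive_continuous dF.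
have cG : continuous G by apply: is_derive_continuous dG.
have cfG := continuous_mul cf cG; have cFg := continuous_mul cF cg.
have := @oint_FTC (fun x => F x * G x) _ a b (continuous_add cfG cFg) (fun x => is_derive_mul (dF x) (dG x)).
by rewrite ointD // => <-; ring.
Qed.

Lemma continuous_at_eps f x : {for x, continuous f} ->
  forall e, 0 < e -> exists2 r : R, 0 < r & forall y, `|y - x| < r -> `|f y - f x| < e.
Proof.
move=> /cvgrPdist_lt fc e e0; have /nbhs_ballP[r r0 Hr] := fc e e0.
exists r => // y xy; rewrite distrC; apply: Hr; rewrite /ball /= distrC //.
Qed.

Lemma continuous_epsP f :
  (forall x e, 0 < e -> exists2 r : R, 0 < r & forall y, `|y - x| < r -> `|f y - f x| <= e) ->
  continuous f.
Proof.
move=> H x; apply/cvgrPdist_le => e e0; have [r r0 Hr] := H x e e0.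
apply/nbhs_ballP; exists r => //= y; rewrite /ball /= distrC => /Hr.
by rewrite distrC.
Qed.

(** A zero integral would make the nondecreasing primitive constant on the segment, against its
    derivative [f c > 0] at c. *)
Lemma oint_gt0 f a b c : continuous f -> a < b ->
  (forall x, a <= x <= b -> 0 <= f x) -> a <= c <= b -> 0 < f c -> 0 < oint f a b.
Proof.
move=> cf ab h /andP[ac cb] fc.
rewrite lt_neqAle oint_ge0 // ?ltW // andbT; apply/eqP => J0.
have mono x y : a <= x -> x <= y -> y <= b -> prim f x <= prim f y.
  move=> ax xy yb; have := @oint_ge0 f x y cf xy; rewrite /oint subr_ge0; apply.
  move=> z /andP[xz zy]; apply: h; rewrite (le_trans ax) // (le_trans zy) //.
have cst x : a <= x -> x <= b -> prim f x = prim f a.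
  move=> ax xb; apply/eqP; rewrite eq_le; apply/andP; split; last exact: mono.
  by rewrite (_ : prim f a = prim f b) ?mono //; move: J0; rewrite /oint; lra.
have [r r0 Hr] := is_derive_eps (is_derive_prim c cf) (e := f c / 2) ltac:(lra).
have key k : `|k| < r -> k != 0 -> a <= c + k <= b -> False.
  move=> hr h0 /andP[h1 h2]; have := Hr k hr; rewrite !cst // subrr sub0r normrN normrM.
  rewrite (gtr0_norm fc) mulrC ler_pM2r ?normr_gt0 //; lra.
(* The point c may be an end of the segment, so the increment goes to the right if c < b and to the
   left otherwise. *)
case: (ltP c b) => cb'.
  have m0 : 0 < Num.min (r / 2) (b - c) by rewrite lt_min; apply/andP; split; lra.
  have m1 : Num.min (r / 2) (b - c) <= r / 2 by rewrite ge_min lexx.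
  have m2 : Num.min (r / 2) (b - c) <= b - c by rewrite ge_min lexx orbT.
  apply: (key (Num.min (r / 2) (b - c))); rewrite ?gt_eqF ?gtr0_norm //; lra.
have m0 : 0 < Num.min (r / 2) (c - a) by rewrite lt_min; apply/andP; split; lra.
have m1 : Num.min (r / 2) (c - a) <= r / 2 by rewrite ge_min lexx.
have m2 : Num.min (r / 2) (c - a) <= c - a by rewrite ge_min lexx orbT.
apply: (key (- Num.min (r / 2) (c - a))); rewrite ?normrN ?oppr_eq0 ?gt_eqF ?gtr0_norm //; lra.
Qed.

End Integral.

(** * Periodic functions, trigonometric coefficients and their uniqueness *)

Section Trigonometric.
Set Implicit Arguments.
Unset Strict Implicit.
Unset Printing Implicit Defensive.
Variable R : realType.
Implicit Types (f g F G : R -> R) (a b x w : R).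

Lemma is_derive_cosM w x : is_derive x 1 (fun y => cos (w * y)) (- (w * sin (w * x))).
Proof.
have d := is_derive_scale w (is_derive_id x (1 : R)).
by apply: is_derive_eq (is_derive_comp (is_derive_cos (w * x)) d) _; ring.
Qed.

Lemma is_derive_sinM w x : is_derive x 1 (fun y => sin (w * y)) (w * cos (w * x)).
Proof.
have d := is_derive_scale w (is_derive_id x (1 : R)).
by apply: is_derive_eq (is_derive_comp (is_derive_sin (w * x)) d) _; ring.
Qed.

Lemma continuous_cosM w : continuous (fun x : R => cos (w * x)).
Proof. by apply: is_derive_continuous => x; exact: is_derive_cosM. Qed.

Lemma continuous_sinM w : continuous (fun x : R => sin (w * x)).
Proof. by apply: is_derive_continuous => x; exact: is_derive_sinM. Qed.

Lemma periodic_int f (T : R) (k : int) x : periodic f T -> f (x + T * k%:~R) = f x.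
Proof.
move=> pf; case: k => n.
  by rewrite -pmulrn mulr_natr periodicn.
rewrite NegzE mulrNz mulrN -pmulrn mulr_natr.
by rewrite -[in RHS](subrK (T *+ n.+1) x) periodicn.
Qed.

Lemma circle_representative x : exists2 y, - pi <= y <= pi &
  forall f, on_circle f -> f x = f y.
Proof.
pose k := Num.floor ((x + pi) / (pi *+ 2)); have p0 := pi_gt0 R.
have p2 : 0 < (pi : R) *+ 2 by rewrite mulrn_wgt0.
exists (x + (pi *+ 2) * (- k)%:~R); last by move=> f pf; rewrite periodic_int.
have h1 := floor_le ((x + pi) / (pi *+ 2)).
have h2 := floorD1_gt ((x + pi) / (pi *+ 2)).
rewrite -/k ler_pdivlMr // in h1; rewrite -/k ltr_pdivrMr // in h2.
rewrite mulrNz mulrN; move: h1 h2; rewrite intrD mulrDl -mulr_natl; move=> h1 h2.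
apply/andP; split; lra.
Qed.

Lemma continuous_bounded f a b : continuous f ->
  exists2 M : R, 0 <= M & forall x, a <= x <= b -> `|f x| <= M.
Proof.
move=> cf; case: (leP a b) => ab; last first.
  by exists 0 => // x /andP[ax xb]; have := le_trans ax xb; rewrite leNgt ab.
have cn : {within `[a, b], continuous (fun x => `|f x|)}.
  by apply: continuous_subspaceT => x; apply: cvg_norm; exact: cf.
have [c _ hc] := EVT_max ab cn.
by exists `|f c| => // x xab; apply: hc; rewrite in_itv.
Qed.

Lemma circle_bounded f : on_circle f -> continuous f -> exists2 M : R, 0 <= M & forall x, `|f x| <= M.
Proof.
move=> pf cf; have [M M0 hM] := continuous_bounded (- pi) pi cf.
exists M => // x; have [y hy e] := circle_representative x.
by rewrite (e f pf); exact: hM.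
Qed.

Lemma circle_cosM (k : int) : on_circle (fun x : R => cos (k%:~R * x)).
Proof.
move=> x; rewrite mulrDr -[_ *+ 2]mulr1 mulrCA (mulrC _ 1) mul1r.
by rewrite (@periodic_int _ _ k) //; exact: cosD2pi.
Qed.

Lemma circle_sinM (k : int) : on_circle (fun x : R => sin (k%:~R * x)).
Proof.
move=> x; rewrite mulrDr -[_ *+ 2]mulr1 mulrCA (mulrC _ 1) mul1r.
by rewrite (@periodic_int _ _ k) //; exact: sinD2pi.
Qed.

Lemma circle_end f : on_circle f -> f (- pi) = f pi.
Proof. by move=> pf; rewrite -(pf (- pi)) mulr2n; congr f; ring. Qed.

(** The derivative of the left side in y is f(y + pi) - f(y - pi), which is zero by periodicity. *)
Lemma oint_shift f (y : R) : on_circle f -> continuous f -> oint f (y - pi) (y + pi) = oint f (- pi) pi.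
Proof.
move=> pf cf; have D : antideriv (fun y => oint f (y - pi) (y + pi)) (fun=> 0).
  move=> z; have dp c := is_derive_add (is_derive_id z (1 : R)) (is_derive_const c z).
  have d1 := is_derive_comp (F := prim f) (G := fun y => y + pi) (is_derive_prim (z + pi) cf) (dp pi).
  have d2 := is_derive_comp (F := prim f) (G := fun y => y - pi) (is_derive_prim (z - pi) cf) (dp (- pi)).
  apply: is_derive_eq (is_derive_sub d1 d2) _.
  by rewrite -(pf (z - pi)) (_ : z - pi + pi *+ 2 = z + pi); [ring|rewrite mulr2n; ring].
by have -> := derive0_const D y 0; rewrite /= sub0r add0r.
Qed.

(** Coefficients without the factor 1/pi. The frequency is real, so that natural and integer
    frequencies share one definition. *)
Definition cos_coef f w := oint (fun x => f x * cos (w * x)) (- pi) pi.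
Definition sin_coef f w := oint (fun x => f x * sin (w * x)) (- pi) pi.

Lemma continuous_mulcos f w : continuous f -> continuous (fun x => f x * cos (w * x)).
Proof. by move=> cf; apply: continuous_mul => //; exact: continuous_cosM. Qed.

Lemma continuous_mulsin f w : continuous f -> continuous (fun x => f x * sin (w * x)).
Proof. by move=> cf; apply: continuous_mul => //; exact: continuous_sinM. Qed.

Lemma cos_coefN f w : cos_coef f (- w) = cos_coef f w.
Proof. by rewrite /cos_coef; congr oint; apply/funext => x; rewrite mulNr cosN. Qed.

Lemma sin_coefN f w : continuous f -> sin_coef f (- w) = - sin_coef f w.
Proof.
move=> cf; rewrite /sin_coef -[RHS]mulN1r -ointZ; last exact: continuous_mulsin.
by congr oint; apply/funext => x; rewrite mulNr sinN; ring.
Qed.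

Lemma nat_int_coef0 f : continuous f ->
  (forall k : nat, cos_coef f k%:R = 0 /\ sin_coef f k%:R = 0) ->
  forall k : int, cos_coef f k%:~R = 0 /\ sin_coef f k%:~R = 0.
Proof.
move=> cf h [n|n]; first by rewrite -pmulrn; exact: h.
rewrite NegzE mulrNz -pmulrn cos_coefN sin_coefN //.
by case: (h n.+1) => -> ->; rewrite oppr0.
Qed.

(** By the addition formulas, a factor of degree one only mixes the frequencies k - 1, k and k + 1.
    Integer frequencies keep k - 1 available at k = 0. *)
Lemma trig_mul_coef0 f (c0 c1 c2 : R) : continuous f ->
  (forall k : int, cos_coef f k%:~R = 0 /\ sin_coef f k%:~R = 0) ->
  let g := fun x => f x * (c0 + c1 * cos x + c2 * sin x) in
  forall k : int, cos_coef g k%:~R = 0 /\ sin_coef g k%:~R = 0.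
Proof.
move=> cf h g k; have [h1 h2] := h k; have [h3 h4] := h (k + 1); have [h5 h6] := h (k - 1).
have cc w := continuous_mulcos (w := w) cf; have cs w := continuous_mulsin (w := w) cf.
have E1 x : cos ((k + 1)%:~R * x) = cos (k%:~R * x) * cos x - sin (k%:~R * x) * sin x.
  by rewrite intrD mulrDl mul1r cosD.
have E2 x : cos ((k - 1)%:~R * x) = cos (k%:~R * x) * cos x + sin (k%:~R * x) * sin x.
  by rewrite intrB mulrBl mul1r cosB.
have E3 x : sin ((k + 1)%:~R * x) = sin (k%:~R * x) * cos x + cos (k%:~R * x) * sin x.
  by rewrite intrD mulrDl mul1r sinD.
have E4 x : sin ((k - 1)%:~R * x) = sin (k%:~R * x) * cos x - cos (k%:~R * x) * sin x.
  by rewrite intrB mulrBl mul1r sinB.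
have dc w x := is_derive_prim x (cc w); have ds w x := is_derive_prim x (cs w).
have cg : continuous g.
  apply: (continuous_mul cf); apply: continuous_add; last by apply: continuous_scale; exact: continuous_sin.
  by apply: continuous_add; [exact: continuous_const|apply: continuous_scale; exact: continuous_cos].
split.
  have -> : cos_coef g k%:~R = c0 * cos_coef f k%:~R
     + (c1 / 2 * cos_coef f (k + 1)%:~R + c1 / 2 * cos_coef f (k - 1)%:~R)
     + (c2 / 2 * sin_coef f (k + 1)%:~R - c2 / 2 * sin_coef f (k - 1)%:~R).
    have D x := is_derive_add (is_derive_add (is_derive_scale c0 (dc k%:~R x))
      (is_derive_add (is_derive_scale (c1 / 2) (dc (k + 1)%:~R x))
         (is_derive_scale (c1 / 2) (dc (k - 1)%:~R x))))
      (is_derive_sub (is_derive_scale (c2 / 2) (ds (k + 1)%:~R x))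
         (is_derive_scale (c2 / 2) (ds (k - 1)%:~R x))).
    rewrite /cos_coef (oint_FTC _ _ (continuous_mulcos cg)
      (fun x => is_derive_eq (D x) _)); first by rewrite /sin_coef /oint; ring.
    by move=> x; rewrite E1 E2 E3 E4 /g; field.
  by rewrite h1 h3 h4 h5 h6; ring.
have -> : sin_coef g k%:~R = c0 * sin_coef f k%:~R
   + (c1 / 2 * sin_coef f (k + 1)%:~R + c1 / 2 * sin_coef f (k - 1)%:~R)
   + (c2 / 2 * cos_coef f (k - 1)%:~R - c2 / 2 * cos_coef f (k + 1)%:~R).
  have D x := is_derive_add (is_derive_add (is_derive_scale c0 (ds k%:~R x))
    (is_derive_add (is_derive_scale (c1 / 2) (ds (k + 1)%:~R x))
       (is_derive_scale (c1 / 2) (ds (k - 1)%:~R x))))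
    (is_derive_sub (is_derive_scale (c2 / 2) (dc (k - 1)%:~R x))
       (is_derive_scale (c2 / 2) (dc (k + 1)%:~R x))).
  rewrite /sin_coef (oint_FTC _ _ (continuous_mulsin cg)
    (fun x => is_derive_eq (D x) _)); first by rewrite /cos_coef /oint; ring.
  by move=> x; rewrite E1 E2 E3 E4 /g; field.
by rewrite h2 h3 h4 h5 h6; ring.
Qed.

Lemma trig_pow_coef0 f (c0 c1 c2 : R) : continuous f ->
  (forall k : int, cos_coef f k%:~R = 0 /\ sin_coef f k%:~R = 0) ->
  forall n, oint (fun x => f x * (c0 + c1 * cos x + c2 * sin x) ^+ n) (- pi) pi = 0.
Proof.
move=> cf h n; have cq : continuous (fun x : R => c0 + c1 * cos x + c2 * sin x).
  apply: continuous_add; first apply: continuous_add; first exact: continuous_const.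
    by apply: continuous_scale; exact: continuous_cos.
  by apply: continuous_scale; exact: continuous_sin.
have cg m : continuous (fun x => f x * (c0 + c1 * cos x + c2 * sin x) ^+ m).
  elim: m => [|m ih]; first by under eq_fun do rewrite expr0 mulr1.
  by under eq_fun do rewrite exprSr mulrA; exact: continuous_mul.
suff [+ _] : cos_coef (fun x => f x * (c0 + c1 * cos x + c2 * sin x) ^+ n) 0%:~R = 0 /\
   sin_coef (fun x => f x * (c0 + c1 * cos x + c2 * sin x) ^+ n) 0%:~R = 0.
  by rewrite /cos_coef; under eq_fun do rewrite mul0r cos0 mulr1.
(* The induction needs the vanishing at every frequency, though only frequency 0 is wanted in the
   end. *)
move: 0 => k; elim: n k => [|n ih] k.
  by under eq_fun do rewrite expr0 mulr1; exact: h.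
have := trig_mul_coef0 c0 c1 c2 (cg n) ih k.
by under [in X in X -> _]eq_fun do rewrite -mulrA -exprSr.
Qed.

Lemma bernoulli (r : R) n : 0 <= r -> 1 + n%:R * r <= (1 + r) ^+ n.
Proof.
move=> r0; elim: n => [|n ih]; first by rewrite expr0; lra.
rewrite exprS; have h : 0 <= n%:R * r ^+ 2 by rewrite mulr_ge0 ?sqr_ge0.
apply: le_trans (_ : (1 + r) * (1 + n%:R * r) <= _); last by rewrite ler_pM2l //; lra.
by rewrite -natr1; nra.
Qed.

(** If f y > 0, test f against the powers of the trigonometric polynomial q(x) = 1 - cos d + cos(x -
    y). On the period around y, |q| <= 1 at distance at least d from y, q >= 1 within distance d,
    and q >= 1 + rho within distance d/2. The integral of f q^m is zero, yet its central part grows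
    at least linearly in m while the rest stays bounded below. *)
Lemma coef0_le0 f : on_circle f -> continuous f ->
  (forall k : nat, cos_coef f k%:R = 0 /\ sin_coef f k%:R = 0) -> forall y, f y <= 0.
Proof.
move=> pf cf /(nat_int_coef0 cf) h y; rewrite leNgt; apply/negP => fy.
have [M M0 hM] := circle_bounded pf cf.
have [r r0 hr] := continuous_at_eps (cf y) (e := f y / 2) ltac:(lra).
have p1 := pihalf_ge1 R.
(* Within distance d of y the values of f exceed f y / 2; the bound 1 keeps d below pi, where the
   cosine is decreasing. *)
pose d : R := Num.min (r / 2) 1.
have d0 : 0 < d by rewrite lt_min; apply/andP; split; lra.
have dr : d <= r / 2 by rewrite ge_min lexx.
have d1 : d <= 1 by rewrite ge_min lexx orbT.
pose q (x : R) : R := 1 - cos d + cos (x - y).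
have qE x : q x = (1 - cos d) + cos y * cos x + sin y * sin x.
  by rewrite /q cosB; ring.
have cosm (s t : R) : 0 <= s -> s <= t -> t <= pi -> cos t <= cos s.
  move=> s0 st tp; case: (eqVneq s t) => [->//|ne]; apply: ltW.
  by rewrite ltr_cos ?in_itv /= ?lt_neqAle ?ne //; apply/andP; split; lra.
pose rho : R := cos (d / 2) - cos d.
have rho0 : 0 < rho.
  by rewrite /rho subr_gt0 ltr_cos ?in_itv /=; [lra|apply/andP; split; lra..].
have cosd : cos d <= 1 by exact: cos_le1.
have cosd0 : 0 <= cos d by apply: cos_ge0_pihalf; apply/andP; split; lra.
have cq : continuous q.
  rewrite (_ : q = fun x => (1 - cos d) + cos y * cos x + sin y * sin x); last exact/funext.
  apply: continuous_add; first apply: continuous_add; first exact: continuous_const.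
    by apply: continuous_scale; exact: continuous_cos.
  by apply: continuous_scale; exact: continuous_sin.
have cg m : continuous (fun x => f x * q x ^+ m).
  elim: m => [|m ih]; first by under eq_fun do rewrite expr0 mulr1.
  by under eq_fun do rewrite exprSr mulrA; exact: continuous_mul.
have g0 m : oint (fun x => f x * q x ^+ m) (y - pi) (y + pi) = 0.
  rewrite oint_shift //.
    under eq_fun do rewrite qE; exact: trig_pow_coef0.
  move=> x; rewrite pf; congr (_ * _ ^+ _).
  by rewrite /q (_ : x + pi *+ 2 - y = x - y + pi *+ 2) ?cosD2pi //; ring.
have qin x : `|x - y| <= d -> 1 <= q x.
  move=> hx; rewrite /q -(cos_norm (x - y)).
  have := cosm `|x - y| d (normr_ge0 _) hx ltac:(lra); lra.
have qout x : d <= `|x - y| -> `|x - y| <= pi -> `|q x| <= 1.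
  move=> hx hp; rewrite ler_norml /q -(cos_norm (x - y)).
  have := cosm d `|x - y| ltac:(lra) hx hp; have := cos_geN1 `|x - y|; lra.
have glow m x : y - pi <= x <= y + pi -> - M <= f x * q x ^+ m.
  move=> /andP[x1 x2]; have xp : `|x - y| <= pi by rewrite ler_norml; lra.
  case: (leP `|x - y| d) => hx.
    have fx : 0 < f x by have := hr x ltac:(lra); rewrite ltr_norml; lra.
    have q1 := qin x hx; have : 0 <= f x * q x ^+ m by rewrite mulr_ge0 ?exprn_ge0; lra.
    lra.
  have q1 : `|q x ^+ m| <= 1.
    by rewrite normrX exprn_ile1 //; apply: qout => //; exact: ltW.
  have : `|f x * q x ^+ m| <= M by rewrite normrM -[M]mulr1 ler_pM.
  by rewrite ler_norml => /andP[].
have gmid m x : y - d / 2 <= x <= y + d / 2 -> f y / 2 * (1 + m%:R * rho) <= f x * q x ^+ m.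
  move=> /andP[x1 x2]; have xd : `|x - y| <= d / 2 by rewrite ler_norml; lra.
  have fx : f y / 2 <= f x by have := hr x ltac:(lra); rewrite ltr_norml; lra.
  have qx : 1 + rho <= q x.
    by rewrite /q /rho -(cos_norm (x - y)); have := cosm `|x - y| (d / 2) (normr_ge0 _) xd ltac:(lra); lra.
  apply: ler_pM => //; first lra.
    by rewrite addr_ge0 // mulr_ge0 // ltW.
  apply: le_trans (bernoulli m (ltW rho0)) _.
  by apply: lerXn2r => //; rewrite nnegrE; lra.
(* On the two outer intervals, of length pi - d/2 each, the integrand is at least -M; the central
   interval has length d. *)
have main m : f y / 2 * (1 + m%:R * rho) * d <= 2 * (M * pi).
  have e0 := g0 m; rewrite -(oint_cat _ _ (y - d / 2)) -(oint_cat _ (y - d / 2) (y + d / 2)) in e0.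
  have j1 : - M * (pi - d / 2) <= oint (fun x => f x * q x ^+ m) (y - pi) (y - d / 2).
    rewrite (_ : - M * _ = oint (fun=> - M) (y - pi) (y - d / 2)); last by rewrite oint_cst; ring.
    apply: oint_le; [exact: continuous_const|exact: cg|lra|].
    by move=> x /andP[xa xb]; apply: glow; apply/andP; split; lra.
  have j3 : - M * (pi - d / 2) <= oint (fun x => f x * q x ^+ m) (y + d / 2) (y + pi).
    rewrite (_ : - M * _ = oint (fun=> - M) (y + d / 2) (y + pi)); last by rewrite oint_cst; ring.
    apply: oint_le; [exact: continuous_const|exact: cg|lra|].
    by move=> x /andP[xa xb]; apply: glow; apply/andP; split; lra.
  have j2 : f y / 2 * (1 + m%:R * rho) * d <= oint (fun x => f x * q x ^+ m) (y - d / 2) (y + d / 2).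
    rewrite (_ : _ * d = oint (fun=> f y / 2 * (1 + m%:R * rho)) (y - d / 2) (y + d / 2)); last by rewrite oint_cst; field.
    by apply: oint_le; [exact: continuous_const|exact: cg|lra|exact: gmid].
  have : 0 <= M * d by rewrite mulr_ge0 // ltW.
  lra.
have c0 : 0 < f y / 2 * rho * d by rewrite !mulr_gt0 //; lra.
have [n hn] : exists n : nat, 2 * (M * pi) / (f y / 2 * rho * d) < n%:R.
  exists (Num.truncn (2 * (M * pi) / (f y / 2 * rho * d))).+1.
  exact: truncnS_gt.
rewrite ltr_pdivrMr // in hn.
have := main n; have : 0 < f y / 2 * d by rewrite mulr_gt0 //; lra.
lra.
Qed.

Lemma fourier_unique f : on_circle f -> continuous f ->
  (forall k : nat, cos_coef f k%:R = 0 /\ sin_coef f k%:R = 0) -> forall y, f y = 0.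
Proof.
move=> pf cf h y; apply/eqP; rewrite eq_le coef0_le0 //=.
rewrite -oppr_le0; apply: (@coef0_le0 (fun x => - f x)).
- by move=> x; rewrite pf.
- by move=> x; apply: cvgN; exact: cf.
move=> k; case: (h k); rewrite /cos_coef /sin_coef => h1 h2.
have cc := continuous_mulcos (w := k%:R) cf; have cs := continuous_mulsin (w := k%:R) cf.
by split; under eq_fun do rewrite mulNr -mulN1r; rewrite ointZ // ?h1 ?h2 mulr0.
Qed.

End Trigonometric.

(** * Orthogonality, trigonometric sums and the Bessel inequality *)

Section FourierSeries.
Set Implicit Arguments.
Unset Strict Implicit.
Unset Printing Implicit Defensive.
Variable R : realType.
Implicit Types (f g h v : R -> R) (a b : nat -> R) (x w : R).
Notation mu := (@lebesgue_measure R).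

Lemma sin_int (k : int) : sin (k%:~R * pi) = 0 :> R.
Proof.
have hn n : sin (n%:R * pi) = 0 :> R.
  elim: n => [|n ih]; first by rewrite mul0r sin0.
  by rewrite -natr1 mulrDl mul1r sinDpi ih oppr0.
by case: k => n; rewrite ?NegzE ?mulrNz -pmulrn ?mulNr ?sinN hn ?oppr0.
Qed.

Lemma oint_cos (k : int) : oint (fun x : R => cos (k%:~R * x)) (- pi) pi = if k == 0 then pi *+ 2 else 0.
Proof.
case: eqP => [->|/eqP k0].
  by under eq_fun do rewrite mul0r cos0; rewrite oint_cst mulr2n; ring.
have k1 : (k%:~R : R) != 0 by rewrite intr_eq0.
have D x : is_derive x 1 (fun y : R => (k%:~R)^-1 * sin (k%:~R * y)) (cos (k%:~R * x)).
  by apply: is_derive_eq (is_derive_scale _ (is_derive_sinM _ _)) _; field.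
by rewrite (oint_FTC _ _ (continuous_cosM (w := k%:~R)) D) mulrN sinN sin_int; ring.
Qed.

(** The derivative of the integral over [-y, y] is f(y) + f(-y) = 0. *)
Lemma oint_odd f : continuous f -> (forall x, f (- x) = - f x) -> oint f (- pi) pi = 0.
Proof.
move=> cf of_.
have D : antideriv (fun y => oint f (- y) y) (fun=> 0).
  move=> y; have d1 := is_derive_prim y cf.
  have d2 := is_derive_comp (is_derive_prim (- y) cf) (is_derive_opp (is_derive_id y (1 : R))).
  by apply: is_derive_eq (is_derive_sub d1 d2) _; rewrite of_; ring.
by have -> := derive0_const D pi 0; rewrite /oint oppr0 subrr.
Qed.

Lemma oint_sin w : oint (fun x : R => sin (w * x)) (- pi) pi = 0.
Proof. by apply: oint_odd => [|x]; [exact: continuous_sinM | rewrite mulrN sinN]. Qed.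

Lemma oint_cossin (j k : R) : oint (fun x => cos (j * x) * sin (k * x)) (- pi) pi = 0.
Proof.
apply: oint_odd => [|x]; last by rewrite !mulrN cosN sinN mulrN.
exact: continuous_mul (continuous_cosM (w := _)) (continuous_sinM (w := _)).
Qed.

Lemma oint_coscos (j k : nat) : (0 < k)%N ->
  oint (fun x : R => cos (j%:R * x) * cos (k%:R * x)) (- pi) pi = if j == k then pi else 0.
Proof.
move=> k0; pose A : R -> R := fun x => cos ((j%:Z + k%:Z)%:~R * x).
pose B : R -> R := fun x => cos ((j%:Z - k%:Z)%:~R * x).
have cA : continuous A by exact: continuous_cosM.
have cB : continuous B by exact: continuous_cosM.
rewrite (_ : (fun x => _) = (fun x => 2^-1 * A x + 2^-1 * B x)); last first.
  by apply/funext => x; rewrite /A /B (intrD _ j%:Z k%:Z) (intrB _ j%:Z k%:Z) -!pmulrn mulrDl mulrBl cosD cosB; field.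
rewrite ointD ?ointZ //; [|by apply: continuous_scale..].
(* As k > 0, the sum frequency is never zero, so only the difference frequency can contribute. *)
have jk : (j%:Z + k%:Z == 0) = false.
  by case: k k0 {A B cA cB} => // k _; rewrite -PoszD addnS.
rewrite /A /B !oint_cos jk subr_eq0 eqz_nat.
by case: ifP => _; rewrite ?mulr2n; [field|ring].
Qed.

Lemma oint_sinsin (j k : nat) : (0 < k)%N ->
  oint (fun x : R => sin (j%:R * x) * sin (k%:R * x)) (- pi) pi = if j == k then pi else 0.
Proof.
move=> k0; pose A : R -> R := fun x => cos ((j%:Z + k%:Z)%:~R * x).
pose B : R -> R := fun x => cos ((j%:Z - k%:Z)%:~R * x).
have cA : continuous A by exact: continuous_cosM.
have cB : continuous B by exact: continuous_cosM.
rewrite (_ : (fun x => _) = (fun x => 2^-1 * B x - 2^-1 * A x)); last first.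
  by apply/funext => x; rewrite /A /B (intrD _ j%:Z k%:Z) (intrB _ j%:Z k%:Z) -!pmulrn mulrBl mulrDl cosB cosD; field.
rewrite ointB ?ointZ //; [|by apply: continuous_scale..].
have jk : (j%:Z + k%:Z == 0) = false.
  by case: k k0 {A B cA cB} => // k _; rewrite -PoszD addnS.
rewrite /A /B !oint_cos jk subr_eq0 eqz_nat.
by case: ifP => _; rewrite ?mulr2n; [field|ring].
Qed.

(** The constant term is kept apart because it is normalised by 2 pi and all other terms by pi. *)
Definition trig_sum (c : R) a b N x :=
  c + \sum_(1 <= k < N.+1) (a k * cos (k%:R * x) + b k * sin (k%:R * x)).

Definition dtrig_sum a b N x :=
  \sum_(1 <= k < N.+1) (k%:R * (b k * cos (k%:R * x) - a k * sin (k%:R * x))).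

Lemma continuous_trig_term (p q : R) (k : nat) :
  continuous (fun x : R => p * cos (k%:R * x) + q * sin (k%:R * x)).
Proof.
apply: continuous_add; apply: continuous_scale;
  [exact: continuous_cosM|exact: continuous_sinM].
Qed.

Lemma continuous_trig_sum c a b N : continuous (trig_sum c a b N).
Proof.
apply: continuous_add; first exact: continuous_const.
by apply: continuous_bigsum => k; exact: continuous_trig_term.
Qed.

Lemma is_derive_trig_sum c a b N : antideriv (trig_sum c a b N) (dtrig_sum a b N).
Proof.
move=> x.
have D (k : nat) : is_derive x 1 (fun y : R => a k * cos (k%:R * y) + b k * sin (k%:R * y))
   (k%:R * (b k * cos (k%:R * x) - a k * sin (k%:R * x))).
  apply: is_derive_eq (is_derive_add (is_derive_scale (a k) (is_derive_cosM k%:R x))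
   (is_derive_scale (b k) (is_derive_sinM k%:R x))) _; ring.
have D2 := is_derive_add (is_derive_const c x) (is_derive_bigsum (index_iota 1 N.+1) (P := xpredT) (fun k _ => D k)).
by apply: is_derive_eq D2 _; rewrite add0r.
Qed.

Lemma continuous_dtrig_sum a b N : continuous (dtrig_sum a b N).
Proof.
apply: continuous_bigsum => k; apply: continuous_scale; apply: continuous_sub;
  apply: continuous_scale; [exact: continuous_cosM|exact: continuous_sinM].
Qed.

Lemma circle_trig_sum c a b N : on_circle (trig_sum c a b N).
Proof.
move=> x; rewrite /trig_sum; congr (_ + _); apply: eq_bigr => k _.
by rewrite !pmulrn circle_cosM circle_sinM.
Qed.

Lemma oint_mul_trig_sum h c a b N : continuous h ->
  oint (fun x => h x * trig_sum c a b N x) (- pi) pi =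
  c * oint h (- pi) pi + \sum_(1 <= k < N.+1) (a k * cos_coef h k%:R + b k * sin_coef h k%:R).
Proof.
move=> ch.
have ct (k : nat) : continuous (fun x => a k * (h x * cos (k%:R * x)) + b k * (h x * sin (k%:R * x))).
  by apply: continuous_add; apply: continuous_scale;
   [exact: continuous_mulcos|exact: continuous_mulsin].
rewrite (_ : (fun x => _) = (fun x => c * h x +
   \sum_(1 <= k < N.+1) (a k * (h x * cos (k%:R * x)) + b k * (h x * sin (k%:R * x))))); last first.
  apply/funext => x; rewrite /trig_sum mulrDr mulr_sumr mulrC; congr (_ + _).
  by apply: eq_bigr => k _; ring.
rewrite ointD; [|exact: continuous_scale|exact: continuous_bigsum].
rewrite ointZ // oint_sum //; congr (_ + _); apply: eq_bigr => k _.
rewrite ointD ?ointZ //; [exact: continuous_mulsin|exact: continuous_mulcos| |];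
  apply: continuous_scale; [exact: continuous_mulcos|exact: continuous_mulsin].
Qed.

Lemma oint_mul_dtrig_sum h a b N : continuous h ->
  oint (fun x => h x * dtrig_sum a b N x) (- pi) pi =
  \sum_(1 <= k < N.+1) (k%:R * (b k * cos_coef h k%:R - a k * sin_coef h k%:R)).
Proof.
move=> ch.
have E : dtrig_sum a b N = trig_sum 0 (fun k => k%:R * b k) (fun k => - (k%:R * a k)) N.
  by apply/funext => x; rewrite /trig_sum add0r; apply: eq_bigr => k _; ring.
rewrite E oint_mul_trig_sum // mul0r add0r; apply: eq_bigr => k _; ring.
Qed.

Lemma cos_coef_trig_sum c a b N (j : nat) : (0 < j)%N ->
  cos_coef (trig_sum c a b N) j%:R = if (j <= N)%N then pi * a j else 0.
Proof.
move=> j0; rewrite /cos_coef; under eq_fun do rewrite mulrC.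
rewrite oint_mul_trig_sum; last exact: continuous_cosM.
rewrite (pmulrn 1 j) oint_cos eqz_nat -pmulrn (gtn_eqF j0) mulr0 add0r.
have E k : a k * cos_coef (fun x : R => cos (j%:R * x)) k%:R
   + b k * sin_coef (fun x : R => cos (j%:R * x)) k%:R = if k == j then pi * a j else 0.
  rewrite /cos_coef /sin_coef oint_cossin mulr0 addr0.
  case: (posnP k) => [->|k0].
    rewrite eq_sym (gtn_eqF j0); under eq_fun do rewrite mul0r cos0 mulr1.
    by rewrite pmulrn oint_cos eqz_nat (gtn_eqF j0) mulr0.
  rewrite oint_coscos // eq_sym; case: eqP => [->|_]; ring.
under eq_bigr do rewrite E.
rewrite -big_mkcond /= big_nat_cond; case: ifP => jN.
  rewrite (big_rem j) ?mem_index_iota /=; last by rewrite j0 ltnS.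
  rewrite j0 ltnS jN eqxx /= big1_seq ?addr0 // => i /andP[/andP[_ /eqP ->]].
  by rewrite mem_rem_uniq ?iota_uniq // inE eqxx.
rewrite big1 // => i /andP[/andP[i0 iN] /eqP ij].
by rewrite -ij -ltnS iN in jN.
Qed.

Lemma sin_coef_trig_sum c a b N (j : nat) : (0 < j)%N ->
  sin_coef (trig_sum c a b N) j%:R = if (j <= N)%N then pi * b j else 0.
Proof.
move=> j0; rewrite /sin_coef; under eq_fun do rewrite mulrC.
rewrite oint_mul_trig_sum; last exact: continuous_sinM.
rewrite oint_sin mulr0 add0r.
have E k : a k * cos_coef (fun x : R => sin (j%:R * x)) k%:R
   + b k * sin_coef (fun x : R => sin (j%:R * x)) k%:R = if k == j then pi * b j else 0.
  rewrite /cos_coef /sin_coef; under eq_fun do rewrite mulrC.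
  rewrite oint_cossin mulr0 add0r.
  case: (posnP k) => [->|k0].
    rewrite eq_sym (gtn_eqF j0); under eq_fun do rewrite mul0r sin0 mulr0.
    by rewrite oint_cst mul0r mulr0.
  rewrite oint_sinsin // eq_sym; case: eqP => [->|_]; ring.
under eq_bigr do rewrite E.
rewrite -big_mkcond /= big_nat_cond; case: ifP => jN.
  rewrite (big_rem j) ?mem_index_iota /=; last by rewrite j0 ltnS.
  rewrite j0 ltnS jN eqxx /= big1_seq ?addr0 // => i /andP[/andP[_ /eqP ->]].
  by rewrite mem_rem_uniq ?iota_uniq // inE eqxx.
rewrite big1 // => i /andP[/andP[i0 iN] /eqP ij].
by rewrite -ij -ltnS iN in jN.
Qed.

Lemma cos_coef0_trig_sum c a b N : cos_coef (trig_sum c a b N) 0 = c * (pi *+ 2).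
Proof.
rewrite /cos_coef; under eq_fun do rewrite mul0r cos0 mulrC.
rewrite oint_mul_trig_sum; last exact: continuous_const.
rewrite oint_cst big_nat_cond big1 ?addr0; first by rewrite mulr2n; ring.
move=> k /andP[/andP[k0 _] _]; rewrite /cos_coef /sin_coef.
under [in X in X + _ = _]eq_fun do rewrite mul1r.
under [in X in _ + X = _]eq_fun do rewrite mul1r.
by rewrite oint_sin pmulrn oint_cos eqz_nat (gtn_eqF k0) !mulr0 addr0.
Qed.

Lemma integrable_add f g : mu.-integrable `[- pi, pi] (EFin \o f) ->
  mu.-integrable `[- pi, pi] (EFin \o g) ->
  mu.-integrable `[- pi, pi] (EFin \o (fun x => f x + g x)).
Proof. by move=> h1 h2; rewrite (_ : _ \o _ = (EFin \o f) \+ (EFin \o g))%E //; exact: integrableD. Qed.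

Lemma integrable_scale (c : R) f : mu.-integrable `[- pi, pi] (EFin \o f) ->
  mu.-integrable `[- pi, pi] (EFin \o (fun x => c * f x)).
Proof.
move=> h1; rewrite (_ : _ \o _ = (fun x => c%:E * (EFin \o f) x)%E) //.
exact: integrableZl.
Qed.

(** The product is dominated by v^2 + h^2. *)
Lemma circle_L2_mul_integrable v h : circle_L2 v -> continuous h ->
  mu.-integrable `[- pi, pi] (EFin \o (fun x => v x * h x)).
Proof.
move=> [_ mv iv] ch.
have mh : measurable_fun setT h by exact: continuous_measurable_fun.
have i2 : mu.-integrable `[- pi, pi] (EFin \o (fun x => h x ^+ 2)).
  by apply: continuous_integrable; exact: continuous_sqr.
have := integrable_add iv i2; apply: le_integrable => //.
  by apply/measurable_EFinP; apply: measurable_funTS; exact: measurable_funM.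
move=> x _ /=; rewrite lee_fin [leRHS]ger0_norm ?addr_ge0 ?sqr_ge0 // ler_norml.
have h1 := sqr_ge0 (v x + h x); have h2 := sqr_ge0 (v x - h x).
by apply/andP; split; nra.
Qed.

Lemma circle_L2_sub v (w : R -> R) : circle_L2 v -> circle_L2 w -> circle_L2 (fun x => v x - w x).
Proof.
move=> [pv mv iv] [pw mw iw]; split.
- by move=> x; rewrite pv pw.
- exact: measurable_funB.
have i2 := integrable_add (integrable_scale 2 iv) (integrable_scale 2 iw).
apply: le_integrable i2 => //.
  apply/measurable_EFinP; apply: measurable_funTS.
  by apply: measurable_funX; exact: measurable_funB.
move=> x _ /=; have a := sqr_ge0 (v x); have b := sqr_ge0 (w x).
rewrite lee_fin [leLHS]ger0_norm ?sqr_ge0 // [leRHS]ger0_norm; last lra.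
by have := sqr_ge0 (v x + w x); nra.
Qed.

Lemma circle_L2_continuous h : on_circle h -> continuous h -> circle_L2 h.
Proof.
move=> ph ch; split => //; first exact: continuous_measurable_fun.
by apply: (@continuous_integrable _ (fun x => h x ^+ 2)); exact: continuous_sqr.
Qed.

Lemma circle_int_L2_trig_sum v a b N : circle_L2 v ->
  circle_int (fun x => v x * trig_sum 0 a b N x) =
  \sum_(1 <= k < N.+1) (a k * circle_int (fun x => v x * cos (k%:R * x)) +
                        b k * circle_int (fun x => v x * sin (k%:R * x))).
Proof.
move=> Lv; have ic h := @circle_L2_mul_integrable v h Lv.
have add h1 h2 : continuous h1 -> continuous h2 ->
   circle_int (fun x => v x * (h1 x + h2 x)) =
   circle_int (fun x => v x * h1 x) + circle_int (fun x => v x * h2 x).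
  move=> c1 c2; rewrite /circle_int -RintegralD //; [|exact: ic..].
  by apply: eq_Rintegral => x _; rewrite mulrDr.
have scal (c : R) h : continuous h ->
   circle_int (fun x => v x * (c * h x)) = c * circle_int (fun x => v x * h x).
  move=> ch; rewrite /circle_int -RintegralZl //; last exact: ic.
  by apply: eq_Rintegral => x _; rewrite mulrCA.
rewrite /trig_sum; under eq_fun do rewrite add0r.
elim: N => [|N ih].
  rewrite big_geq //; under eq_fun do rewrite big_geq // mulr0.
  by rewrite /circle_int Rintegral_cst // mul0r.
rewrite big_nat_recr //=; under eq_fun do rewrite big_nat_recr //=.
rewrite add; [|by apply: continuous_bigsum => k; exact: continuous_trig_term|exact: continuous_trig_term].
rewrite ih; congr (_ + _).
have cc := continuous_cosM (w := N.+1%:R : R); have cs := continuous_sinM (w := N.+1%:R : R).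
rewrite (add (fun x => a N.+1 * cos (N.+1%:R * x)) (fun x => b N.+1 * sin (N.+1%:R * x)));
  [|exact: continuous_scale..].
by rewrite !scal.
Qed.

(** Expand the nonnegative integral of (v - s)^2, with s the Fourier sum of v without its constant
    term: the cross integral of v s and the integral of s^2 are equal. A general v in L^2 is allowed
    because the lemma will be applied to weak derivatives. *)
Lemma bessel v N : circle_L2 v ->
  \sum_(1 <= k < N.+1) (circle_int (fun x => v x * cos (k%:R * x)) ^+ 2 +
                        circle_int (fun x => v x * sin (k%:R * x)) ^+ 2)
  <= pi * circle_int (fun x => v x ^+ 2).
Proof.
move=> Lv; have p0 := pi_gt0 R.
have pK (y : R) : pi * (pi^-1 * y) = y by rewrite mulrA divff ?mul1r // gt_eqF.
pose A k := pi^-1 * circle_int (fun x => v x * cos (k%:R * x)).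
pose B k := pi^-1 * circle_int (fun x => v x * sin (k%:R * x)).
pose s := trig_sum 0 A B N; have cs : continuous s by exact: continuous_trig_sum.
set S := (X in X <= _).
have h1 : circle_int (fun x => v x * s x) = pi^-1 * S.
  rewrite circle_int_L2_trig_sum // mulr_sumr; apply: eq_bigr => k _; rewrite /A /B; ring.
have h2 : circle_int (fun x => s x * s x) = pi^-1 * S.
  rewrite circle_int_oint; last exact: continuous_mul.
  rewrite oint_mul_trig_sum // mul0r add0r mulr_sumr big_nat_cond [RHS]big_nat_cond.
  apply: eq_bigr => k /andP[/andP[k0 kN] _].
  rewrite cos_coef_trig_sum // sin_coef_trig_sum // -ltnS kN /A /B.
  by rewrite !pK; ring.
have iv : mu.-integrable `[- pi, pi] (EFin \o (fun x => v x ^+ 2)) by case: Lv.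
have ivs := circle_L2_mul_integrable Lv cs.
have iss := continuous_integrable (- pi) pi (continuous_mul cs cs).
have i1 : mu.-integrable `[- pi, pi] (EFin \o (fun x => - 2 * (v x * s x))).
  exact: integrable_scale.
have i2 : mu.-integrable `[- pi, pi] (EFin \o (fun x => - 2 * (v x * s x) + s x * s x)).
  exact: integrable_add.
have : 0 <= circle_int (fun x => (v x - s x) ^+ 2).
  by apply: Rintegral_ge0 => x _; exact: sqr_ge0.
have -> : circle_int (fun x => (v x - s x) ^+ 2) =
   circle_int (fun x => v x ^+ 2 + (- 2 * (v x * s x) + s x * s x)).
  by congr circle_int; apply/funext => x; ring.
have -> : circle_int (fun x => v x ^+ 2 + (- 2 * (v x * s x) + s x * s x)) =
  circle_int (fun x => v x ^+ 2) +
    (- 2 * circle_int (fun x => v x * s x) + circle_int (fun x => s x * s x)).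
  by rewrite /circle_int RintegralD // RintegralD // RintegralZl.
rewrite h1 h2 => h3.
have : 0 <= pi * (circle_int (fun x => v x ^+ 2) + (- 2 * (pi^-1 * S) + pi^-1 * S)).
  by rewrite mulr_ge0 // ltW.
have -> : pi * (circle_int (fun x => v x ^+ 2) + (- 2 * (pi^-1 * S) + pi^-1 * S)) =
  pi * circle_int (fun x => v x ^+ 2) - S by rewrite mulrDr (mulrDr pi) (mulrCA pi (- 2)) pK; ring.
by rewrite subr_ge0.
Qed.

End FourierSeries.

(** * Uniform convergence of Fourier sums with a rate given by the energy *)

Section Sobolev.
Set Implicit Arguments.
Unset Strict Implicit.
Unset Printing Implicit Defensive.
Variable R : realType.
Implicit Types (f g h v : R -> R) (a b : nat -> R) (x w : R).

(** This is pi times the squared H^1 norm of the N-th Fourier sum with its mean removed; the mean is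
    treated separately. *)
Definition energy g N : R := \sum_(1 <= k < N.+1)
  (1 + k%:R ^+ 2) * (cos_coef g k%:R ^+ 2 + sin_coef g k%:R ^+ 2).

Definition fourier_sum g N : R -> R := trig_sum (cos_coef g 0 / (pi *+ 2))
  (fun k => cos_coef g k%:R / pi) (fun k => sin_coef g k%:R / pi) N.

Lemma sin_coef0 g : sin_coef g 0 = 0.
Proof.
by rewrite /sin_coef; under eq_fun do rewrite mul0r sin0 mulr0; rewrite oint_cst mul0r.
Qed.

Lemma circle_fourier_sum g N : on_circle (fourier_sum g N).
Proof. exact: circle_trig_sum. Qed.

Lemma energy_mono g m n : (m <= n)%N -> energy g m <= energy g n.
Proof.
move=> mn; rewrite /energy [leRHS](big_cat_nat _ (n := m.+1)) //= lerDl.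
by apply: sumr_ge0 => k _; rewrite mulr_ge0 ?addr_ge0 ?sqr_ge0.
Qed.

Lemma energy_ge0 g n : 0 <= energy g n.
Proof. by apply: sumr_ge0 => k _; rewrite mulr_ge0 ?addr_ge0 ?sqr_ge0. Qed.

(** Since 1/(1 + m^2) <= 2/(m (m + 1)) = 2/m - 2/(m + 1), the sum is dominated by a telescoping
    one. *)
Lemma inv_sqr_tail N M : (N <= M)%N ->
  \sum_(N.+1 <= k < M.+1) (1 + k%:R ^+ 2)^-1 <= 2 / N.+1%:R - 2 / M.+1%:R :> R.
Proof.
have aux (y : R) : 0 < y -> 2 / (y * (y + 1)) = 2 / y - 2 / (y + 1).
  by move=> y0; have y1 : 0 < y + 1 by [lra]; field; rewrite !gt_eqF.
elim: M => [|M ih]; first by rewrite leqn0 => /eqP ->; rewrite big_geq // subrr.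
rewrite leq_eqVlt => /orP[/eqP ->|]; first by rewrite big_geq // subrr.
rewrite ltnS => NM; rewrite big_nat_recr /=; last by rewrite ltnS (leq_trans NM).
apply: le_trans (lerD (ih NM) (lexx _)) _.
have m0 : 0 < M.+1%:R :> R by rewrite ltr0n.
have m2 : M.+2%:R = M.+1%:R + 1 :> R by rewrite -natr1.
have h2 : (1 + M.+1%:R ^+ 2)^-1 <= 2 / (M.+1%:R * (M.+1%:R + 1)) :> R.
  rewrite -[leLHS]mul1r ler_pdivrMr ?addr_gt0 ?exprn_gt0 //.
  rewrite mulrAC ler_pdivlMr ?mulr_gt0 ?addr_gt0 //.
  by have := sqr_ge0 (M.+1%:R - 1 : R); nra.
move: h2; rewrite m2 aux // => h2; apply: le_trans (lerD (lexx _) h2) _.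
by rewrite addrA subrK.
Qed.

(** Young's inequality with weight q = 1 + k^2 splits each coefficient y into a multiple of q y^2,
    summed by the energy, and a multiple of 1/q, summed by [inv_sqr_tail]. Leaving eta free avoids
    square roots. *)
Lemma fourier_tail g E (eta : R) N M x : 0 < eta -> (N <= M)%N -> (forall n, energy g n <= E) ->
  `|fourier_sum g M x - fourier_sum g N x| <= (eta * E / 2 + 2 / (eta * N.+1%:R)) / pi.
Proof.
move=> e0 NM hE; have p0 := pi_gt0 R.
have aux1 (P q y : R) : 0 < P -> 0 < q -> (eta / 2 / P * (q * y ^+ 2) + (eta * P)^-1 / 2 * q^-1) * P =
       (eta * q * y ^+ 2 + (eta * q)^-1) / 2.
  by move=> P0 q0; field; rewrite !gt_eqF.
have aux2 (P a b c : R) : eta / 2 / P * (c * a ^+ 2) + (eta * P)^-1 / 2 * c^-1 +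
    (eta / 2 / P * (c * b ^+ 2) + (eta * P)^-1 / 2 * c^-1) =
   eta / 2 / P * (c * (a ^+ 2 + b ^+ 2)) + (eta * P)^-1 / c.
  rewrite (_ : (eta * P)^-1 / c = (eta * P)^-1 / 2 * c^-1 + (eta * P)^-1 / 2 * c^-1); first by ring.
  by rewrite -mulrDl -splitr.
rewrite /fourier_sum /trig_sum (big_cat_nat _ (n := N.+1)) //=.
set s1 := bigop _ _ _; set s2 := bigop _ _ _; set c := cos_coef g 0 / _.
rewrite (_ : c + (s1 + s2) - (c + s1) = s2); last by ring.
apply: le_trans (ler_norm_sum _ _ _) _.
apply: le_trans (_ : \sum_(N.+1 <= k < M.+1) (eta / 2 / pi * ((1 + k%:R ^+ 2) *
    (cos_coef g k%:R ^+ 2 + sin_coef g k%:R ^+ 2)) + (eta * pi)^-1 * (1 + k%:R ^+ 2)^-1) <= _).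
  apply: ler_sum => k _; set q : R := 1 + k%:R ^+ 2.
  have q0 : 0 < q by rewrite /q ltr_wpDr // sqr_ge0.
  set p := cos_coef _ _; set r := sin_coef _ _.
  have am (y z : R) : `|z| <= 1 -> `|y / pi * z| <= eta / 2 / pi * (q * y ^+ 2) + (eta * pi)^-1 / 2 * q^-1.
    move=> z1; rewrite normrM; apply: le_trans (_ : `|y / pi| <= _).
      by rewrite ler_piMr.
    have eq0 : 0 < eta * q by rewrite mulr_gt0.
    rewrite normrM (gtr0_norm (x := pi^-1)) ?invr_gt0 // ler_pdivrMr //.
    rewrite aux1 //.
    rewrite -(@ler_pM2r _ (eta * q)) // -real_normK ?num_real //.
    have -> : (eta * q * `|y| ^+ 2 + (eta * q)^-1) / 2 * (eta * q) =
      ((eta * q * `|y|) ^+ 2 + 1) / 2 by field; rewrite !gt_eqF.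
    have := sqr_ge0 (eta * q * `|y| - 1); nra.
  apply: le_trans (ler_normD _ _) _.
  have a1 := am p _ (cos_max (k%:R * x)); have a2 := am r _ (sin_max (k%:R * x)).
  apply: le_trans (lerD a1 a2) _.
  by rewrite aux2.
rewrite big_split /= -!mulr_sumr mulrDl.
have h1 : \sum_(N.+1 <= k < M.+1) (1 + k%:R ^+ 2) * (cos_coef g k%:R ^+ 2 + sin_coef g k%:R ^+ 2) <= E.
  apply: le_trans (hE M); rewrite /energy [leRHS](big_cat_nat _ (n := N.+1)) //= lerDr.
  exact: energy_ge0.
have h2 : \sum_(N.+1 <= k < M.+1) (1 + k%:R ^+ 2)^-1 <= 2 / N.+1%:R :> R.
  by apply: le_trans (inv_sqr_tail NM) _; rewrite gerBl divr_ge0.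
apply: lerD.
  rewrite (_ : eta * E / 2 / pi = eta / 2 / pi * E); last by ring.
  by rewrite ler_wpM2l // !divr_ge0 ?ltW.
rewrite (_ : 2 / (eta * N.+1%:R) / pi = (eta * pi)^-1 * (2 / N.+1%:R)); last by rewrite !invfM; ring.
by rewrite ler_wpM2l // invr_ge0 mulr_ge0 ?ltW.
Qed.

Lemma tail_small (E e : R) : 0 <= E -> 0 < e -> exists2 eta : R, 0 < eta & exists N0 : nat, forall N, (N0 <= N)%N ->
  (eta * E / 2 + 2 / (eta * N.+1%:R)) / pi <= e.
Proof.
move=> E0 e0; have p2 := pi_ge2 R.
(* With this eta and N + 1 > 4 (E + 1)/e^2 each summand is at most e, and pi >= 2 absorbs the sum.
   The 1 added to E covers E = 0. *)
exists (e / (E + 1)); first by rewrite divr_gt0 //; lra.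
exists (Num.truncn (4 * (E + 1) / e ^+ 2)) => N hN.
have hn : 4 * (E + 1) / e ^+ 2 < N.+1%:R.
  by apply: lt_le_trans (truncnS_gt _) _; rewrite ler_nat ltnS.
rewrite ltr_pdivrMr ?exprn_gt0 // in hn.
have n0 : 0 < N.+1%:R :> R by rewrite ltr0n.
rewrite ler_pdivrMr; last lra.
have h1 : e / (E + 1) * E / 2 <= e.
  rewrite (_ : e / (E + 1) * E / 2 = e * E / (2 * (E + 1))); last by field; rewrite gt_eqF //; lra.
  by rewrite ler_pdivrMr; nra.
have h2 : 2 / (e / (E + 1) * N.+1%:R) <= e.
  rewrite (_ : 2 / _ = 2 * (E + 1) / (e * N.+1%:R)); last first.
    by field; rewrite !gt_eqF //; lra.
  rewrite ler_pdivrMr ?mulr_gt0 //; nra.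
have : e * 2 <= e * pi by rewrite ler_pM2l.
move: (lerD h1 h2); set z := _ + _; lra.
Qed.

Lemma pointwise_limit (s : nat -> R) (T : nat -> R) :
  (forall e : R, 0 < e -> exists N0 : nat, forall N, (N0 <= N)%N -> T N <= e) ->
  (forall N M, (N <= M)%N -> `|s M - s N| <= T N) ->
  exists l, forall N, `|l - s N| <= T N.
Proof.
move=> hT hs.
have cs : cvgn s.
  apply/cauchy_cvgP/cauchy_exP => e e0.
  have [N0 hN] := hT (e / 2) ltac:(lra).
  exists (s N0); exists N0 => // n /= hn; rewrite /ball /= distrC.
  by apply: le_lt_trans (hs _ _ hn) _; have := hN N0 (leqnn _); lra.
exists (limn s) => N.
have h1 : (fun n => `|s n - s N|) @ \oo --> `|limn s - s N|.
  by apply: cvg_norm; apply: cvgB => //; exact: cvg_cst.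
have := limr_le (cvgP _ h1) (x := T N).
rewrite (cvg_lim _ h1) //; apply.
by near=> n; apply: hs; near: n; exists N.
Unshelve. all: by end_near. Qed.

(** The Fourier sums converge uniformly to a continuous periodic l with the coefficients of g, so l
    = g by [fourier_unique], and the rate of [fourier_tail] passes to the limit. *)
Lemma fourier_approx g E (eta : R) N x : on_circle g -> continuous g ->
  (forall n, energy g n <= E) -> 0 < eta ->
  `|g x - fourier_sum g N x| <= (eta * E / 2 + 2 / (eta * N.+1%:R)) / pi.
Proof.
move=> pg cg hE eta0; have p0 := pi_gt0 R.
have E0 : 0 <= E by apply: le_trans (hE 0%N); exact: energy_ge0.
pose T (e : R) (N : nat) : R := (e * E / 2 + 2 / (e * N.+1%:R)) / pi.
have [eta1 e1 [N1 hN1]] := tail_small E0 ltr01.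
have [l hl] : exists l : R -> R, forall y (e : R) N, 0 < e -> `|l y - fourier_sum g N y| <= T e N.
  suff H y : exists l, forall (e : R) N, 0 < e -> `|l - fourier_sum g N y| <= T e N.
    by have [l hl] := choice H; exists l => y e n; exact: hl.
  (* One limit has to serve every eta, while [pointwise_limit] accepts a single rate; the infimum
     over eta is such a rate. *)
  pose T0 n : R := inf [set T e n | e in [set e : R | 0 < e]].
  have T0e e n : 0 < e -> T0 n <= T e n.
    move=> ee0; apply: ge_inf; last by exists e.
    exists 0 => _ [e' /= e'0 <-]; apply: divr_ge0; last exact: ltW.
    apply: addr_ge0; apply: divr_ge0 => //; first by apply: mulr_ge0 => //; exact: ltW.
    by apply: mulr_ge0 => //; exact: ltW.
  have [||l hl] := @pointwise_limit (fun n => fourier_sum g n y) T0.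
  - move=> e ee0; have [e' e'0 [N0 h]] := tail_small E0 ee0.
    by exists N0 => n /h; apply: le_trans; exact: T0e.
  - move=> n m nm; apply: lb_le_inf; first by exists (T 1 n); exists (1 : R) => //=; exact: ltr01.
    by move=> _ [e /= ee0 <-]; exact: fourier_tail.
  by exists l => e n ee0; apply: le_trans (hl n) (T0e _ _ ee0).
have unif e : 0 < e -> exists N0 : nat, forall n, (N0 <= n)%N -> forall y, `|l y - fourier_sum g n y| <= e.
  move=> ee0; have [e' e'0 [N0 h]] := tail_small E0 ee0.
  by exists N0 => n /h hn y; apply: le_trans (hl y e' n e'0) hn.
have cl : continuous l.
  apply: continuous_epsP => y e ee0.
  have [N0 hN0] := unif (e / 3) ltac:(lra).
  have cS : continuous (fourier_sum g N0) by exact: continuous_trig_sum.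
  have [r r0 hr] := continuous_at_eps (cS y) (e := e / 3) ltac:(lra).
  exists r => // z hz; have h1 := hN0 N0 (leqnn _) z; have h2 := hN0 N0 (leqnn _) y.
  have h3 := hr z hz.
  rewrite (_ : l z - l y = (l z - fourier_sum g N0 z) + (fourier_sum g N0 z - fourier_sum g N0 y)
    - (l y - fourier_sum g N0 y)); last by ring.
  apply: le_trans (ler_normB _ _) _.
  by have := ler_normD (l z - fourier_sum g N0 z) (fourier_sum g N0 z - fourier_sum g N0 y); lra.
have pl : on_circle l.
  move=> y; apply/eqP; rewrite -subr_eq0 -normr_le0; apply/ler_addgt0Pr => e ee0.
  have [N0 hN0] := unif (e / 2) ltac:(lra).
  have h1 := hN0 N0 (leqnn _) (y + pi *+ 2); have h2 := hN0 N0 (leqnn _) y.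
  rewrite circle_fourier_sum in h1.
  have := ler_normB (l (y + pi *+ 2) - fourier_sum g N0 y) (l y - fourier_sum g N0 y).
  by rewrite opprB addrA subrK; lra.
(* Each coefficient of the Fourier sums is stationary from some index on, and uniform convergence
   transmits its value to l. *)
have coefs (ph : R -> R) (c : R) n1 : continuous ph -> (forall y, `|ph y| <= 1) ->
   (forall n, (n1 <= n)%N -> oint (fun y => fourier_sum g n y * ph y) (- pi) pi = c) ->
   oint (fun y => l y * ph y) (- pi) pi = c.
  move=> cph hph hc; apply/eqP; rewrite -subr_eq0 -normr_le0; apply/ler_addgt0Pr => e ee0.
  have [N0 hN0] := unif (e / (pi *+ 2)) ltac:(by rewrite divr_gt0 // mulrn_wgt0).
  have cS : continuous (fourier_sum g (maxn n1 N0)) by exact: continuous_trig_sum.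
  rewrite -(hc (maxn n1 N0)) ?leq_maxl // -ointB; [|exact: continuous_mul..].
  rewrite add0r; apply: le_trans (_ : e / (pi *+ 2) * (pi - - pi) <= _).
    apply: oint_bound; [by apply: continuous_sub; exact: continuous_mul|lra|].
    move=> y _; rewrite -mulrBl normrM -[leRHS]mulr1; apply: ler_pM => //.
    by apply: hN0; exact: leq_maxr.
  by rewrite opprK -mulr2n divfK // gt_eqF // mulrn_wgt0.
have gl y : g y - l y = 0.
  apply: (@fourier_unique _ (fun y => g y - l y)).
  - by move=> z; rewrite pg pl.
  - exact: continuous_sub.
  move=> k; rewrite /cos_coef /sin_coef.
  have cc := continuous_cosM (w := k%:R : R); have cs := continuous_sinM (w := k%:R : R).
  split; under eq_fun do rewrite mulrBl.
    rewrite ointB; [|exact: continuous_mul..]; apply/eqP; rewrite subr_eq0; apply/eqP/esym.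
    apply: (coefs _ _ k) => //; first by move=> z; exact: cos_max.
    move=> n kn; case: (posnP k) => [->|k0].
      rewrite -!/(cos_coef _ _) cos_coef0_trig_sum divfK // gt_eqF // mulrn_wgt0 //.
    by rewrite -!/(cos_coef _ _) cos_coef_trig_sum // kn mulrCA divff ?mulr1 // gt_eqF.
  rewrite ointB; [|exact: continuous_mul..]; apply/eqP; rewrite subr_eq0; apply/eqP/esym.
  apply: (coefs _ _ k) => //; first by move=> z; exact: sin_max.
  move=> n kn; case: (posnP k) => [->|k0].
    by rewrite -!/(sin_coef _ _) !sin_coef0.
  by rewrite -!/(sin_coef _ _) sin_coef_trig_sum // kn mulrCA divff ?mulr1 // gt_eqF.
by rewrite (_ : g x = l x) ?hl //; apply/eqP; rewrite -subr_eq0 gl.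
Qed.

End Sobolev.

(** * The H^1 norm controls the energy and the supremum *)

Section H1.
Set Implicit Arguments.
Unset Strict Implicit.
Unset Printing Implicit Defensive.
Variable R : realType.
Implicit Types (f g h v : R -> R) (x : R).

Lemma is_derive_derive1 f x (d : R) : is_derive x 1 f d -> derive1 f x = d.
Proof. by move=> h; rewrite derive1E derive_val. Qed.

Lemma derive1n_trig (k n : nat) (p q : R) : exists p' q' : R,
  derive1n n (fun x : R => p * cos (k%:R * x) + q * sin (k%:R * x)) =
  (fun x => p' * cos (k%:R * x) + q' * sin (k%:R * x)).
Proof.
elim: n p q => [|n ih] p q; first by exists p, q.
have [p' [q' e]] := ih p q; exists (k%:R * q'), (- (k%:R * p')).
rewrite derive1nS e; apply/funext => x; apply: is_derive_derive1.
apply: is_derive_eq (is_derive_add (is_derive_scale p' (is_derive_cosM k%:R x))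
   (is_derive_scale q' (is_derive_sinM k%:R x))) _; ring.
Qed.

Lemma circle_test_trig (k : nat) (p q : R) :
  circle_test (fun x : R => p * cos (k%:R * x) + q * sin (k%:R * x)).
Proof.
split; first by move=> x; rewrite pmulrn circle_cosM circle_sinM.
move=> n x; have [p' [q' ->]] := derive1n_trig k n p q.
apply: ex_derive; exact: (is_derive_add (is_derive_scale p' (is_derive_cosM k%:R x))
   (is_derive_scale q' (is_derive_sinM k%:R x))).
Qed.

(** The k-th cosine and sine are admissible test functions, and on them differentiation is
    multiplication by k. *)
Lemma weak_derivative_coef g v (k : nat) : continuous g -> weak_derivative g v ->
  circle_int (fun x => v x * cos (k%:R * x)) = k%:R * sin_coef g k%:R /\
  circle_int (fun x => v x * sin (k%:R * x)) = - (k%:R * cos_coef g k%:R).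
Proof.
move=> cg wd.
have E p q := wd _ (circle_test_trig k p q).
have D (p q : R) : derive1 (fun x : R => p * cos (k%:R * x) + q * sin (k%:R * x)) =
   (fun x => k%:R * (q * cos (k%:R * x) - p * sin (k%:R * x))).
  apply/funext => x; apply: is_derive_derive1.
  apply: is_derive_eq (is_derive_add (is_derive_scale p (is_derive_cosM k%:R x))
   (is_derive_scale q (is_derive_sinM k%:R x))) _; ring.
split.
  have := E 1 0; rewrite D => /eqP; rewrite -eqr_oppLR => /eqP.
  rewrite (_ : (fun x => v x * _) = (fun x => v x * cos (k%:R * x))); last first.
    by apply/funext => x; rewrite mul1r mul0r addr0.
  move=> <-; rewrite (_ : (fun x => _) = (fun x => - k%:R * (g x * sin (k%:R * x)))); last first.
    by apply/funext => x; ring.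
  rewrite circle_int_oint; last by apply: continuous_scale; exact: continuous_mulsin.
  by rewrite ointZ; [rewrite mulNr opprK|exact: continuous_mulsin].
have := E 0 1; rewrite D => /eqP; rewrite -eqr_oppLR => /eqP.
rewrite (_ : (fun x => v x * _) = (fun x => v x * sin (k%:R * x))); last first.
  by apply/funext => x; rewrite mul1r mul0r add0r.
move=> <-; rewrite (_ : (fun x => _) = (fun x => k%:R * (g x * cos (k%:R * x)))); last first.
  by apply/funext => x; ring.
rewrite circle_int_oint; last by apply: continuous_scale; exact: continuous_mulcos.
by rewrite ointZ; [|exact: continuous_mulcos].
Qed.

Lemma circle_int_sqr_ge0 v : 0 <= circle_int (fun x => v x ^+ 2).
Proof. by apply: Rintegral_ge0 => x _; exact: sqr_ge0. Qed.

Lemma H1_derivativeP g : circle_H1 g ->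
  circle_L2 (H1_derivative g) /\ weak_derivative g (H1_derivative g).
Proof.
move=> [pg cg [v hv]].
by have := @xgetPex _ (fun=> 0) [set v | circle_L2 v /\ weak_derivative g v] (ex_intro _ v hv).
Qed.

Lemma H1_norm_ge0 g : 0 <= H1_norm g.
Proof. exact: sqrtr_ge0. Qed.

Lemma H1_norm_sqr g : H1_norm g ^+ 2 =
  circle_int (fun x => g x ^+ 2) + circle_int (fun x => H1_derivative g x ^+ 2).
Proof. by rewrite sqr_sqrtr // addr_ge0 // circle_int_sqr_ge0. Qed.

Lemma bessel_continuous g N : on_circle g -> continuous g ->
  \sum_(1 <= k < N.+1) (cos_coef g k%:R ^+ 2 + sin_coef g k%:R ^+ 2) <=
  pi * circle_int (fun x => g x ^+ 2).
Proof.
move=> pg cg; apply: le_trans (bessel N (circle_L2_continuous pg cg)).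
rewrite le_eqVlt; apply/orP; left; apply/eqP; apply: eq_bigr => k _.
by rewrite !circle_int_oint; [|exact: continuous_mulsin|exact: continuous_mulcos].
Qed.

(** In the factor 1 + k^2, the 1 comes from the Bessel inequality for g and the k^2 from the one for
    its weak derivative. *)
Lemma energy_le_H1_norm g N : circle_H1 g -> energy g N <= pi * H1_norm g ^+ 2.
Proof.
move=> hg; have [pg cg _] := hg; have [Lv wd] := H1_derivativeP hg.
rewrite H1_norm_sqr mulrDr.
apply: le_trans (lerD (bessel_continuous N pg cg) (bessel N Lv)).
rewrite -big_split /=; apply: ler_sum => k _.
by have [-> ->] := weak_derivative_coef k cg wd; rewrite le_eqVlt; apply/orP; left; apply/eqP; ring.
Qed.

(** Cauchy-Schwarz against the constant 1, obtained from the integral of (g - c)^2 with c the mean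
    of g. *)
Lemma sqr_coef0_le g : continuous g -> cos_coef g 0 ^+ 2 <= pi *+ 2 * circle_int (fun x => g x ^+ 2).
Proof.
move=> cg; have p0 := pi_gt0 R; have p2 : 0 < (pi : R) *+ 2 by rewrite mulrn_wgt0.
have -> : cos_coef g 0 = oint g (- pi) pi.
  by rewrite /cos_coef; under eq_fun do rewrite mul0r cos0 mulr1.
rewrite circle_int_oint; last exact: continuous_sqr.
set m := oint g _ _; set S := oint _ _ _; pose c := m / (pi *+ 2).
have cc : continuous (fun x => (-2 * c) * g x) by exact: continuous_scale.
have cs := continuous_sqr cg; have cd := continuous_const (c := c ^+ 2).
have : 0 <= oint (fun x => g x ^+ 2 + ((-2 * c) * g x + c ^+ 2)) (- pi) pi.
  apply: oint_ge0; [by repeat apply: continuous_add|lra|move=> x _].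
  by rewrite (_ : _ + _ = (g x - c) ^+ 2) ?sqr_ge0 //; ring.
rewrite ointD //; last exact: continuous_add.
rewrite ointD // ointZ // oint_cst opprK -mulr2n -/S -/m => h.
have mE : m = c * (pi *+ 2) by rewrite divfK // gt_eqF.
rewrite mE in h *; move: h p2; set P := pi *+ 2; nra.
Qed.

(** Take N = 0 in [fourier_approx]: g is its mean plus a tail. With eta = 1/n the tail is at most
    (n/2 + 2 n/pi) <= 3 n/2, and the mean is at most n. A strictly positive upper bound n of the
    norm makes this eta available even when the norm is zero. *)
Lemma sobolev g (n : R) x : circle_H1 g -> 0 < n -> H1_norm g <= n -> `|g x| <= 3 * n.
Proof.
move=> hg n0 hn; have [pg cg _] := hg; have p2 := pi_ge2 R; have p0 := pi_gt0 R.
have hE N : energy g N <= pi * n ^+ 2.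
  apply: le_trans (energy_le_H1_norm N hg) _.
  by rewrite ler_pM2l // lerXn2r // nnegrE ?H1_norm_ge0 // ltW.
have h1 := @fourier_approx _ g _ n^-1 0 x pg cg hE ltac:(by rewrite invr_gt0).
rewrite /fourier_sum /trig_sum big_geq // addr0 in h1.
have h2 : (n^-1 * (pi * n ^+ 2) / 2 + 2 / (n^-1 * 1)) / pi <= 3 / 2 * n.
  have -> : n^-1 * (pi * n ^+ 2) = pi * n by rewrite expr2 mulrCA (mulrA n^-1) mulVf ?mul1r ?gt_eqF.
  rewrite mulr1 invrK.
  by rewrite ler_pdivrMr //; nra.
have h3 : `|cos_coef g 0 / (pi *+ 2)| <= n.
  have q0 : 0 < (pi : R) *+ 2 by rewrite mulrn_wgt0.
  rewrite normrM (gtr0_norm (x := (pi *+ 2)^-1)) ?invr_gt0 // ler_pdivrMr //.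
  rewrite -(@ler_pXn2r _ 2) ?nnegrE ?normr_ge0 ?mulr_ge0 ?(ltW n0) ?(ltW q0) //.
  rewrite real_normK ?num_real //; apply: le_trans (sqr_coef0_le cg) _.
  have h4 : circle_int (fun x => g x ^+ 2) <= n ^+ 2.
    apply: le_trans (_ : H1_norm g ^+ 2 <= _); last by rewrite lerXn2r // nnegrE ?H1_norm_ge0 // ltW.
    by rewrite H1_norm_sqr lerDl circle_int_sqr_ge0.
  have h5 : 1 <= (pi : R) *+ 2 by rewrite mulr2n; lra.
  rewrite exprMn mulrC; apply: ler_pM => //; rewrite ?circle_int_sqr_ge0 ?(ltW q0) //.
  by rewrite expr2 ler_peMr // ltW.
have := ler_normD (g x - cos_coef g 0 / (pi *+ 2)) (cos_coef g 0 / (pi *+ 2)).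
rewrite subrK => h4; apply: le_trans h4 _; apply: le_trans (lerD h1 h3) _.
apply: le_trans (lerD h2 (lexx _)) _; lra.
Qed.

(** This guarantees that [H1_derivative] of a difference is a genuine weak derivative and not the
    default value, so that the norm in [continuous_in_H1] really controls derivatives. *)
Lemma circle_H1_sub f g : circle_H1 f -> circle_H1 g -> circle_H1 (fun x => f x - g x).
Proof.
move=> [pf cf [v [Lv wv]]] [pg cg [w [Lw ww]]]; split.
- by move=> x; rewrite pf pg.
- exact: continuous_sub.
exists (fun x => v x - w x); split; first exact: circle_L2_sub.
move=> ph hph; have [_ sm] := hph.
have cph : continuous ph.
  by move=> x; apply: differentiable_continuous; apply/derivable1_diffP; exact: (sm 0%N).
have cdph : continuous (derive1 ph).
  by move=> x; apply: differentiable_continuous; apply/derivable1_diffP; exact: (sm 1%N).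
rewrite (_ : (fun x => _) = (fun x => f x * derive1 ph x - g x * derive1 ph x)); last first.
  by apply/funext => x; rewrite mulrBl.
rewrite (_ : (fun x => (v x - w x) * _) = (fun x => v x * ph x - w x * ph x)); last first.
  by apply/funext => x; rewrite mulrBl.
rewrite /circle_int !RintegralB //.
- by have := wv _ hph; have := ww _ hph; rewrite /circle_int => -> ->; ring.
- exact: circle_L2_mul_integrable.
- exact: circle_L2_mul_integrable.
- by apply: continuous_integrable; exact: continuous_mul.
- by apply: continuous_integrable; exact: continuous_mul.
Qed.

End H1.

(** * The inverse of 1 - d_x^2 through two first-order equations *)

Section Helmholtz.
Set Implicit Arguments.
Unset Strict Implicit.
Unset Printing Implicit Defensive.
Variable R : realType.
Implicit Types (f g h : R -> R) (x c M : R).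

Lemma is_derive_expRN x : is_derive x 1 (fun y : R => expR (- y)) (- expR (- x)).
Proof.
have d := is_derive_comp (is_derive_expR (- x)) (is_derive_opp (is_derive_id x (1 : R))).
by apply: is_derive_eq d _; ring.
Qed.

Lemma continuous_expRN : continuous (fun x : R => expR (- x)).
Proof. by apply: (@is_derive_continuous _ _ (fun x => - expR (- x))) => x; exact: is_derive_expRN. Qed.

Lemma prim0 f : prim f 0 = 0.
Proof. by rewrite /prim lexx set_itv1 Rintegral_set1. Qed.

(* The constant of integration is the one making this solution of [g' = g - f]
   periodic. *)
Definition growing_sol f x : R :=
  let G := prim (fun y => expR (- y) * f y) in
  expR x * (expR (pi *+ 2) * G (pi *+ 2) / (expR (pi *+ 2) - 1) - G x).

(** By reflection, this is the periodic solution of g' = f - g. *)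
Definition decaying_sol f x : R := growing_sol (fun y => f (- y)) (- x).

(** Partial fractions: (1 - d_x^2)^(-1) is half the sum of (1 - d_x)^(-1) and (1 + d_x)^(-1). The
    half difference is its derivative, so [growing_sol f] is psi + psi_x; this sum is what the
    dissipation will measure. *)
Definition helmholtz f x : R := (growing_sol f x + decaying_sol f x) / 2.
Definition dhelmholtz f x : R := (growing_sol f x - decaying_sol f x) / 2.

Lemma is_derive_growing f : continuous f ->
  antideriv (growing_sol f) (fun x => growing_sol f x - f x).
Proof.
move=> cf x; have cG := continuous_mul continuous_expRN cf.
have D := is_derive_mul (is_derive_expR x)
  (is_derive_sub (is_derive_const (expR (pi *+ 2) * prim (fun y => expR (- y) * f y) (pi *+ 2) / (expR (pi *+ 2) - 1)) x) (is_derive_prim x cG)).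
apply: is_derive_eq D _; rewrite /growing_sol sub0r mulrN mulrA -expRD subrr expR0 mul1r.
by [].
Qed.

Lemma circle_growing f : on_circle f -> continuous f -> on_circle (growing_sol f).
Proof.
move=> pf cf x; have cG := continuous_mul continuous_expRN cf.
set G := prim (fun y => expR (- y) * f y).
(* A period multiplies the factor exp(-y) by exp(-2 pi); this relation determines the periodic
   constant of integration. *)
have shift : G (x + pi *+ 2) = G (pi *+ 2) + expR (- (pi *+ 2)) * G x.
  have D : antideriv (fun y => G (y + pi *+ 2) - expR (- (pi *+ 2)) * G y) (fun=> 0).
    move=> y; have dp := is_derive_add (is_derive_id y (1 : R)) (is_derive_const (pi *+ 2) y).
    have d1 := is_derive_comp (F := G) (G := fun z => z + pi *+ 2) (is_derive_prim (y + pi *+ 2) cG) dp.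
    apply: is_derive_eq (is_derive_sub d1 (is_derive_scale (expR (- (pi *+ 2))) (is_derive_prim y cG))) _.
    by rewrite pf (opprD y) (addrC (- y)) expRD; ring.
  have G0 : G 0 = 0 by exact: prim0.
  have := derive0_const D x 0; rewrite /= add0r G0 mulr0 subr0 => <-; ring.
have e1 : expR (pi *+ 2) - 1 != 0 :> R.
  by rewrite gt_eqF // subr_gt0 expR_gt1 mulrn_wgt0 // pi_gt0.
rewrite /growing_sol -/G shift expRD expRN.
have : expR (pi *+ 2) != 0 :> R by rewrite gt_eqF // expR_gt0.
move: (expR (pi *+ 2)) (G (pi *+ 2)) e1 => E g2 e1 e0; by field; rewrite e1 e0.
Qed.

Lemma continuous_reflect f : continuous f -> continuous (fun y => f (- y)).
Proof. by move=> cf y; apply: (@continuous_comp _ _ _ -%R f); [exact: opp_continuous|exact: cf]. Qed.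

Lemma circle_reflect f : on_circle f -> on_circle (fun y => f (- y)).
Proof. by move=> pf y; have := pf (- (y + pi *+ 2)); rewrite opprD subrK => ->. Qed.

Lemma is_derive_decaying f : continuous f ->
  antideriv (decaying_sol f) (fun x => f x - decaying_sol f x).
Proof.
move=> cf x.
have d := is_derive_comp (is_derive_growing (continuous_reflect cf) (- x)) (is_derive_opp (is_derive_id x (1 : R))).
by apply: is_derive_eq d _; rewrite /decaying_sol opprK; ring.
Qed.

Lemma circle_decaying f : on_circle f -> continuous f -> on_circle (decaying_sol f).
Proof.
by move=> pf cf; apply: circle_reflect; apply: circle_growing; [exact: circle_reflect|exact: continuous_reflect].
Qed.

Lemma circle_max f : on_circle f -> continuous f -> exists c, forall x, f x <= f c.
Proof.
move=> pf cf; have p0 := pi_gt0 R.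
have [c _ hc] := @EVT_max R f (- pi) pi ltac:(lra) (continuous_subspaceT cf).
exists c => x; have [y hy ->] := circle_representative x => //; apply: hc.
by rewrite in_itv.
Qed.

Lemma is_derive_max f (d : R) c : is_derive c 1 f d -> (forall x, f x <= f c) -> d = 0.
Proof.
move=> df hc; apply/eqP/negPn/negP => d0.
have [r r0 hr] := is_derive_eps df (e := `|d| / 2) ltac:(by rewrite divr_gt0 // normr_gt0).
have nd : 0 < `|d| by rewrite normr_gt0.
have r2 : `|r / 2 * Num.sg d| = r / 2 by rewrite normrM normr_sg d0 mulr1 gtr0_norm //; lra.
have := hr (r / 2 * Num.sg d); rewrite r2 => /(_ ltac:(lra)).
have h2 : r / 2 * Num.sg d * d = r / 2 * `|d| by rewrite -mulrA normrEsg.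
rewrite h2; have := hc (c + r / 2 * Num.sg d).
have : 0 < r * `|d| by rewrite mulr_gt0.
rewrite ler_norml; move: (f _) (f c) => a b; lra.
Qed.

(** Maximum principle: where g is largest, g' = 0, hence g = f there. This yields the sup norm bound
    with constant 1 and, applied to differences, uniqueness. *)
Lemma growing_le f g M : on_circle g -> antideriv g (fun x => g x - f x) ->
  (forall x, f x <= M) -> forall x, g x <= M.
Proof.
move=> pg dg hf x; have [c hc] := circle_max pg (is_derive_continuous dg).
have := is_derive_max (dg c) hc; have := hf c; have := hc x; lra.
Qed.

Lemma growing_bound f g M : on_circle g -> antideriv g (fun x => g x - f x) ->
  (forall x, `|f x| <= M) -> forall x, `|g x| <= M.
Proof.
move=> pg dg hf x; rewrite ler_norml; apply/andP; split; last first.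
  by apply: growing_le pg dg _ x => y; have := hf y; rewrite ler_norml => /andP[].
rewrite lerNl; apply: (@growing_le (fun y => - f y) (fun y => - g y)).
- by move=> y; rewrite pg.
- by move=> y; apply: is_derive_eq (is_derive_opp (dg y)) _; ring.
by move=> y; rewrite lerNl; have := hf y; rewrite ler_norml => /andP[].
Qed.

Lemma growing_solE f g : on_circle f -> continuous f -> on_circle g ->
  antideriv g (fun x => g x - f x) -> growing_sol f = g.
Proof.
move=> pf cf pg dg; apply/funext => x; apply/eqP; rewrite -subr_eq0 -normr_le0.
apply: (@growing_bound (fun=> 0) (fun x => growing_sol f x - g x)).
- by move=> y; rewrite circle_growing // pg.
- by move=> y; apply: is_derive_eq (is_derive_sub (is_derive_growing cf y) (dg y)) _; ring.
by move=> y; rewrite normr0.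
Qed.

Lemma growing_lin (a b : R) f g : on_circle f -> continuous f -> on_circle g -> continuous g ->
  growing_sol (fun x => a * f x + b * g x) = (fun x => a * growing_sol f x + b * growing_sol g x).
Proof.
move=> pf cf pg cg; apply: growing_solE.
- by move=> x; rewrite pf pg.
- by apply: continuous_add; exact: continuous_scale.
- by move=> x; rewrite !circle_growing.
move=> x; apply: is_derive_eq (is_derive_add (is_derive_scale a (is_derive_growing cf x))
  (is_derive_scale b (is_derive_growing cg x))) _; ring.
Qed.

Lemma decaying_lin (a b : R) f g : on_circle f -> continuous f -> on_circle g -> continuous g ->
  decaying_sol (fun x => a * f x + b * g x) = (fun x => a * decaying_sol f x + b * decaying_sol g x).
Proof.
move=> pf cf pg cg; apply/funext => x; rewrite /decaying_sol growing_lin //;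
  by [exact: circle_reflect|exact: continuous_reflect].
Qed.

Section solution.
Variables (f : R -> R) (pf : on_circle f) (cf : continuous f).

Lemma is_derive_helmholtz : antideriv (helmholtz f) (dhelmholtz f).
Proof.
move=> x; have d := is_derive_mul (is_derive_add (is_derive_growing cf x) (is_derive_decaying cf x)) (is_derive_const 2^-1 x).
by apply: is_derive_eq d _; rewrite /dhelmholtz; ring.
Qed.

Lemma is_derive_dhelmholtz : antideriv (dhelmholtz f) (fun x => helmholtz f x - f x).
Proof.
move=> x; have d := is_derive_mul (is_derive_sub (is_derive_growing cf x) (is_derive_decaying cf x)) (is_derive_const 2^-1 x).
by apply: is_derive_eq d _; rewrite /helmholtz; field.
Qed.

Lemma circle_helmholtz : on_circle (helmholtz f).
Proof. by move=> x; rewrite /helmholtz (circle_growing pf cf) (circle_decaying pf cf). Qed.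

Lemma circle_dhelmholtz : on_circle (dhelmholtz f).
Proof. by move=> x; rewrite /dhelmholtz (circle_growing pf cf) (circle_decaying pf cf). Qed.

Lemma continuous_helmholtz : continuous (helmholtz f).
Proof. exact: is_derive_continuous is_derive_helmholtz. Qed.

Lemma continuous_dhelmholtz : continuous (dhelmholtz f).
Proof. exact: is_derive_continuous is_derive_dhelmholtz. Qed.

Variables (M : R) (hM : forall x, `|f x| <= M).

Lemma growing_sol_bound x : `|growing_sol f x| <= M.
Proof. exact: growing_bound (circle_growing pf cf) (is_derive_growing cf) hM x. Qed.

Lemma decaying_sol_bound x : `|decaying_sol f x| <= M.
Proof.
apply: (growing_bound (circle_growing (circle_reflect pf) (continuous_reflect cf))
  (is_derive_growing (continuous_reflect cf))) => y; exact: hM.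
Qed.

Lemma helmholtz_bound x : `|helmholtz f x| <= M.
Proof.
rewrite /helmholtz normrM (gtr0_norm (x := 2^-1)) ?invr_gt0 // ler_pdivrMr //.
have := growing_sol_bound x; have := decaying_sol_bound x.
have := ler_normD (growing_sol f x) (decaying_sol f x); lra.
Qed.

Lemma dhelmholtz_bound x : `|dhelmholtz f x| <= M.
Proof.
rewrite /dhelmholtz normrM (gtr0_norm (x := 2^-1)) ?invr_gt0 // ler_pdivrMr //.
have := growing_sol_bound x; have := decaying_sol_bound x.
have := ler_normB (growing_sol f x) (decaying_sol f x); lra.
Qed.

End solution.

Lemma helmholtz_lin (a b : R) f g : on_circle f -> continuous f -> on_circle g -> continuous g ->
  helmholtz (fun x => a * f x + b * g x) = (fun x => a * helmholtz f x + b * helmholtz g x).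
Proof.
by move=> pf cf pg cg; apply/funext => x; rewrite /helmholtz growing_lin // decaying_lin //; ring.
Qed.

Lemma dhelmholtz_lin (a b : R) f g : on_circle f -> continuous f -> on_circle g -> continuous g ->
  dhelmholtz (fun x => a * f x + b * g x) = (fun x => a * dhelmholtz f x + b * dhelmholtz g x).
Proof.
by move=> pf cf pg cg; apply/funext => x; rewrite /dhelmholtz growing_lin // decaying_lin //; ring.
Qed.

Lemma helmholtz_coef f (k : nat) : on_circle f -> continuous f ->
  (1 + k%:R ^+ 2) * cos_coef (helmholtz f) k%:R = cos_coef f k%:R /\
  (1 + k%:R ^+ 2) * sin_coef (helmholtz f) k%:R = sin_coef f k%:R.
Proof.
move=> pf cf; have cH := continuous_helmholtz cf.
have dH := is_derive_helmholtz cf; have dA := is_derive_dhelmholtz cf.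
have pH := circle_helmholtz pf cf; have pA := circle_dhelmholtz pf cf.
have pc : on_circle (fun x : R => cos (k%:R * x)) by move=> x; rewrite pmulrn circle_cosM.
have ps : on_circle (fun x : R => sin (k%:R * x)) by move=> x; rewrite pmulrn circle_sinM.
have cc g : continuous g -> continuous (fun x => g x * cos (k%:R * x)) := @continuous_mulcos R g k%:R.
have cs g : continuous g -> continuous (fun x => g x * sin (k%:R * x)) := @continuous_mulsin R g k%:R.
split; apply/eqP; rewrite -subr_eq0 /cos_coef /sin_coef; apply/eqP.
  rewrite -ointZ -?ointB; [|exact: continuous_scale (cc _ _)|exact: cc|exact: cc].
  (* This combination has as derivative the difference of the two integrands, and being periodic it
     contributes nothing over a period. *)
  have D x : is_derive x 1 (fun y => dhelmholtz f y * cos (k%:R * y) + k%:R * (helmholtz f y * sin (k%:R * y)))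
     ((1 + k%:R ^+ 2) * (helmholtz f x * cos (k%:R * x)) - f x * cos (k%:R * x)).
    apply: is_derive_eq (is_derive_add (is_derive_mul (dA x) (is_derive_cosM k%:R x))
      (is_derive_scale k%:R (is_derive_mul (dH x) (is_derive_sinM k%:R x)))) _; ring.
  rewrite (oint_FTC _ _ _ D); last by apply: continuous_sub; [exact: continuous_scale (cc _ _)|exact: cc].
  by rewrite (circle_end pA) (circle_end pH) (circle_end pc) (circle_end ps) subrr.
rewrite -ointZ -?ointB; [|exact: continuous_scale (cs _ _)|exact: cs|exact: cs].
have D x : is_derive x 1 (fun y => dhelmholtz f y * sin (k%:R * y) - k%:R * (helmholtz f y * cos (k%:R * y)))
   ((1 + k%:R ^+ 2) * (helmholtz f x * sin (k%:R * x)) - f x * sin (k%:R * x)).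
  apply: is_derive_eq (is_derive_sub (is_derive_mul (dA x) (is_derive_sinM k%:R x))
    (is_derive_scale k%:R (is_derive_mul (dH x) (is_derive_cosM k%:R x)))) _; ring.
rewrite (oint_FTC _ _ _ D); last by apply: continuous_sub; [exact: continuous_scale (cs _ _)|exact: cs].
by rewrite (circle_end pA) (circle_end pH) (circle_end pc) (circle_end ps) subrr.
Qed.

Lemma dhelmholtz_coef f (k : nat) : on_circle f -> continuous f ->
  cos_coef (dhelmholtz f) k%:R = k%:R * sin_coef (helmholtz f) k%:R /\
  sin_coef (dhelmholtz f) k%:R = - (k%:R * cos_coef (helmholtz f) k%:R).
Proof.
move=> pf cf; have cH := continuous_helmholtz cf; have cA := continuous_dhelmholtz cf.
have dH := is_derive_helmholtz cf.
have pH := circle_helmholtz pf cf.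
have pc : on_circle (fun x : R => cos (k%:R * x)) by move=> x; rewrite pmulrn circle_cosM.
have ps : on_circle (fun x : R => sin (k%:R * x)) by move=> x; rewrite pmulrn circle_sinM.
have cc g : continuous g -> continuous (fun x => g x * cos (k%:R * x)) := @continuous_mulcos R g k%:R.
have cs g : continuous g -> continuous (fun x => g x * sin (k%:R * x)) := @continuous_mulsin R g k%:R.
split; apply/eqP; rewrite -subr_eq0 /cos_coef /sin_coef; apply/eqP.
  rewrite -ointZ -?ointB; [|exact: cc|exact: continuous_scale (cs _ _)|exact: cs].
  have D x : is_derive x 1 (fun y => helmholtz f y * cos (k%:R * y))
     (dhelmholtz f x * cos (k%:R * x) - k%:R * (helmholtz f x * sin (k%:R * x))).
    apply: is_derive_eq (is_derive_mul (dH x) (is_derive_cosM k%:R x)) _; ring.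
  rewrite (oint_FTC _ _ _ D); last by apply: continuous_sub; [exact: cc|exact: continuous_scale (cs _ _)].
  by rewrite (circle_end pH) (circle_end pc) subrr.
rewrite opprK -ointZ -?ointD; [|exact: cs|exact: continuous_scale (cc _ _)|exact: cc].
have D x : is_derive x 1 (fun y => helmholtz f y * sin (k%:R * y))
   (dhelmholtz f x * sin (k%:R * x) + k%:R * (helmholtz f x * cos (k%:R * x))).
  apply: is_derive_eq (is_derive_mul (dH x) (is_derive_sinM k%:R x)) _; ring.
rewrite (oint_FTC _ _ _ D); last by apply: continuous_add; [exact: cs|exact: continuous_scale (cc _ _)].
by rewrite (circle_end pH) (circle_end ps) subrr.
Qed.

(** This links the psi of the theorem, given by complex Fourier coefficients, to the explicit
    solution. Real and imaginary parts are compared at nonnegative frequencies, which determine a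
    real function. *)
Lemma inv_helmholtzE f g : on_circle f -> continuous f -> inv_helmholtz f g -> g = helmholtz f.
Proof.
move=> pf cf [pg cg hg]; apply/funext => x; apply/eqP; rewrite -subr_eq0; apply/eqP; move: x.
have cH := continuous_helmholtz cf; have pH := circle_helmholtz pf cf.
apply: (@fourier_unique _ (fun x => g x - helmholtz f x)).
- by move=> x; rewrite pg pH.
- exact: continuous_sub.
move=> k; have [h1 h2] := helmholtz_coef k pf cf.
have p2 : (pi : R) *+ 2 != 0 by rewrite gt_eqF // mulrn_wgt0 // pi_gt0.
have q0 : (1 + k%:R ^+ 2 : R) != 0 by rewrite gt_eqF // ltr_wpDr // sqr_ge0.
have := hg k; rewrite /fourier_coef -pmulrn => e.
have e1 := congr1 (@complex.Re R) e; have e2 := congr1 (@complex.Im R) e.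
rewrite /= mul0r subr0 in e1; rewrite /= mul0r addr0 mulrN in e2.
move/oppr_inj: e2 => e2.
have cc f1 : continuous f1 -> continuous (fun x => f1 x * cos (k%:R * x)) := @continuous_mulcos R f1 k%:R.
have cs f1 : continuous f1 -> continuous (fun x => f1 x * sin (k%:R * x)) := @continuous_mulsin R f1 k%:R.
rewrite !circle_int_oint -?/(cos_coef _ _) in e1; [|exact: cc..].
rewrite !circle_int_oint -?/(sin_coef _ _) in e2; [|exact: cs..].
rewrite -h1 in e1; rewrite -h2 in e2.
have inj (X Y : R) : X / (pi *+ 2) = (1 + k%:R ^+ 2)^-1 * ((1 + k%:R ^+ 2) * Y / (pi *+ 2)) -> X - Y = 0.
  rewrite -(mulrA (1 + _)) mulKf // => /(mulIf _) ->; first by rewrite subrr.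
  by rewrite invr_eq0.
split; rewrite /cos_coef /sin_coef; under eq_fun do rewrite mulrBl.
  by rewrite ointB; [exact: inj|exact: cc..].
by rewrite ointB; [exact: inj|exact: cs..].
Qed.

End Helmholtz.

(** * Smooth bumps, and derivatives in time from distributional identities *)

Section SmoothBump.
Set Implicit Arguments.
Unset Strict Implicit.
Unset Printing Implicit Defensive.
Variable R : realType.
Implicit Types (f g h : R -> R) (x c a b t : R).

(** The powers of 1/x make the family of functions x^(-m) e^(-1/x) closed under differentiation, up
    to linear combinations. *)
Definition flat (m : nat) (x : R) : R := if 0 < x then x^-1 ^+ m * expR (- x^-1) else 0.

Lemma flat_ge0 m x : 0 <= flat m x.
Proof. by rewrite /flat; case: ifP => // x0; rewrite mulr_ge0 ?exprn_ge0 ?invr_ge0 ?expR_ge0 // ltW. Qed.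

(** From e^y >= (y/(m + 1))^(m + 1) at y = 1/x. The linear bound gives differentiability at the
    origin. *)
Lemma flat_le m x : flat m x <= (m.+1%:R) ^+ m.+1 * `|x|.
Proof.
rewrite /flat; case: ltP => x0; last by rewrite mulr_ge0 ?exprn_ge0.
rewrite (gtr0_norm x0) expRN.
have e1 : (x^-1 / m.+1%:R) ^+ m.+1 <= expR x^-1.
  have E : x^-1 = m.+1%:R * (x^-1 / m.+1%:R) by rewrite mulrC divfK // pnatr_eq0.
  rewrite [in leRHS]E expRM_natl.
  rewrite lerXn2r ?nnegrE ?expR_ge0 //; first by rewrite divr_ge0 // invr_ge0 ltW.
  by apply: le_trans (expR_ge1Dx _); rewrite lerDr.
have e0 := expR_gt0 x^-1.
rewrite ler_pdivrMr // -(@ler_pM2r _ x^-1) ?invr_gt0 // -exprSr.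
have -> : m.+1%:R ^+ m.+1 * x * expR x^-1 / x = m.+1%:R ^+ m.+1 * expR x^-1.
  by field; rewrite gt_eqF.
by move: e1; rewrite expr_div_n ler_pdivrMr ?exprn_gt0 // mulrC.
Qed.

Lemma is_derive_flat m x : is_derive x 1 (flat m) (flat m.+2 x - m%:R * flat m.+1 x).
Proof.
case: (ltgtP 0 x) => [x0|x0|<-].
- have xn : x != 0 by rewrite gt_eqF.
  have dV : is_derive x 1 (fun y : R => y^-1) (- x^-1 ^+ 2).
    apply: is_derive_eq (is_deriveV xn (is_derive_id x (1 : R))) _.
    by rewrite /GRing.scale /= mulr1 exprVn.
  have dX : is_derive x 1 (fun y : R => y^-1 ^+ m) (- (m%:R * x^-1 ^+ m.+1)).
    apply: is_derive_eq (is_derive_exp m dV) _.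
    case: (m) => [|k]; first by rewrite !mul0r oppr0.
    by rewrite mulrN -mulrA -exprD addn2.
  have dE : is_derive x 1 (fun y : R => expR (- y^-1)) (expR (- x^-1) * x^-1 ^+ 2).
    have D := is_derive_comp (G := fun y : R => - y^-1) (is_derive_expR (- x^-1)) (is_derive_opp dV).
    by apply: is_derive_eq D _; rewrite opprK.
  have D : is_derive x 1 (fun y => y^-1 ^+ m * expR (- y^-1)) (flat m.+2 x - m%:R * flat m.+1 x).
    by apply: is_derive_eq (is_derive_mul dX dE) _; rewrite /flat x0 !exprS; ring.
  apply: (@near_eq_is_derive _ _ _ _ _ _ _ _ _ D).
  near=> y; have y0 : 0 < y by near: y; exact: lt_nbhsr.
  by rewrite /flat y0.
- have D : is_derive x 1 (fun=> 0 : R) (flat m.+2 x - m%:R * flat m.+1 x).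
    by apply: is_derive_eq (is_derive_const 0 x) _; rewrite /flat ltNge (ltW x0) mulr0 subrr.
  apply: (@near_eq_is_derive _ _ _ _ _ _ _ _ _ D).
  near=> y; have y0 : y < 0 by near: y; exact: lt_nbhsl.
  by rewrite /flat ltNge (ltW y0).
rewrite {2 3}/flat ltxx mulr0 subrr; apply: is_derive_epsP => e e0.
set K : R := m.+2%:R ^+ m.+2; have K0 : 0 < K by rewrite exprn_gt0.
exists (e / K); first by rewrite divr_gt0.
move=> h hr; rewrite add0r mulr0 subr0 {2}/flat ltxx subr0 ger0_norm ?flat_ge0 //.
case: (ltP 0 h) => h0; last by rewrite /flat ltNge h0 mulr_ge0 // ltW.
(* One power of h is traded for the next member of the family, which itself tends to zero with h. *)
have -> : flat m h = flat m.+1 h * h.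
  by rewrite /flat h0 exprS; field; rewrite gt_eqF.
rewrite (gtr0_norm h0) in hr *; rewrite ler_pM2r //.
apply: le_trans (flat_le _ _) _; rewrite (gtr0_norm h0) mulrC -/K.
by rewrite -ler_pdivlMr // ltW.
Unshelve. all: by end_near. Qed.

Definition smooth f := forall n x, derivable (derive1n n f) x 1.

Lemma smooth_continuous f n : smooth f -> continuous (derive1n n f).
Proof.
by move=> sf x; apply: differentiable_continuous; apply/derivable1_diffP; exact: sf.
Qed.

Lemma smooth_derive f n : smooth f -> antideriv (derive1n n f) (derive1n n.+1 f).
Proof.
by move=> sf x; rewrite derive1nS derive1E; apply: DeriveDef => //; exact: sf.
Qed.

(** Combinations of products of [flat] functions, encoded by lists of coefficients and exponents: a
    class stable under differentiation, so that its members are smooth by induction on the order. *)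
Definition flat_comb (s : seq (R * (nat * nat))) a b t :=
  \sum_(i <- s) i.1 * (flat i.2.1 (t - a) * flat i.2.2 (b - t)).

Definition flat_comb_deriv (s : seq (R * (nat * nat))) : seq (R * (nat * nat)) :=
  flatten [seq [:: (i.1, (i.2.1.+2, i.2.2)); (- (i.2.1%:R * i.1), (i.2.1.+1, i.2.2));
                   (- i.1, (i.2.1, i.2.2.+2)); (i.2.2%:R * i.1, (i.2.1, i.2.2.+1))] | i <- s].

Lemma is_derive_flat_comb s a b : antideriv (flat_comb s a b) (flat_comb (flat_comb_deriv s) a b).
Proof.
move=> t; rewrite {2}/flat_comb /flat_comb_deriv big_flatten /= big_map.
apply: is_derive_bigsum => -[c [m k]] _; rewrite !big_cons big_nil /=.
have d1 := is_derive_comp (G := fun y => y - a) (is_derive_flat m (t - a)) (is_derive_sub (is_derive_id t (1 : R)) (is_derive_const a t)).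
have d2 := is_derive_comp (G := fun y => b - y) (is_derive_flat k (b - t)) (is_derive_sub (is_derive_const b t) (is_derive_id t (1 : R))).
apply: is_derive_eq (is_derive_scale c (is_derive_mul d1 d2)) _; ring.
Qed.

Lemma smooth_flat_comb s a b : smooth (flat_comb s a b).
Proof.
suff H n : exists s', derive1n n (flat_comb s a b) = flat_comb s' a b.
  move=> n x; have [s' ->] := H n; apply: ex_derive; exact: is_derive_flat_comb.
elim: n => [|n [s' ih]]; first by exists s.
exists (flat_comb_deriv s'); rewrite derive1nS ih; apply/funext => x.
exact: is_derive_derive1 (is_derive_flat_comb s' a b x).
Qed.

Definition bump a b t := flat 0 (t - a) * flat 0 (b - t).

Lemma bumpE a b : bump a b = flat_comb [:: (1, (0%N, 0%N))] a b.
Proof. by apply/funext => t; rewrite /flat_comb big_cons big_nil addr0 mul1r. Qed.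

Lemma smooth_bump a b : smooth (bump a b).
Proof. by rewrite bumpE; exact: smooth_flat_comb. Qed.

Lemma continuous_bump a b : continuous (bump a b).
Proof. by have H := smooth_continuous (n := 0) (@smooth_bump a b); rewrite derive1n0 in H. Qed.

Lemma bump_ge0 a b t : 0 <= bump a b t.
Proof. by rewrite mulr_ge0 ?flat_ge0. Qed.

Lemma bump_gt0 a b t : a < t < b -> 0 < bump a b t.
Proof.
move=> /andP[ta tb]; have ta' : 0 < t - a by lra.
have tb' : 0 < b - t by lra.
by rewrite /bump /flat ta' tb' !expr0 !mul1r mulr_gt0 ?expR_gt0.
Qed.

Lemma bump_out a b t : t <= a \/ b <= t -> bump a b t = 0.
Proof.
move=> [h|h].
  have ha : t - a <= 0 by lra.
  by rewrite /bump /flat ltNge ha mul0r.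
have ha : b - t <= 0 by lra.
by rewrite /bump /(flat 0 (b - t)) ltNge ha mulr0.
Qed.

Lemma oint_eq0 f a b : continuous f -> a <= b -> (forall x, a <= x <= b -> f x = 0) -> oint f a b = 0.
Proof.
move=> cf ab h; apply/eqP; rewrite -normr_le0 -(mul0r (b - a)); apply: oint_bound => // x hx.
by rewrite h // normr0.
Qed.

(** The two bumps are translates of each other and have equal mass, so this primitive is zero again
    to the right of both: it is a compactly supported test function. *)
Definition bump_diff (s1 s2 e L t : R) :=
  oint (fun x => bump s1 (s1 + e) x - bump s2 (s2 + e) x) (- L) t.

Section bump_diff.
Variables (s1 s2 e L : R).
Hypothesis e0 : 0 < e.
Hypothesis L1 : `|s1| + e <= L.
Hypothesis L2 : `|s2| + e <= L.
Let rho t := bump s1 (s1 + e) t - bump s2 (s2 + e) t.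

Let crho : continuous rho.
Proof. by apply: continuous_sub; exact: continuous_bump. Qed.

Lemma is_derive_bump_diff : antideriv (bump_diff s1 s2 e L) rho.
Proof.
move=> t; have d := is_derive_sub (is_derive_prim t crho) (is_derive_const (prim rho (- L)) t).
by apply: is_derive_eq d _; rewrite subr0.
Qed.

Lemma smooth_bump_diff : smooth (bump_diff s1 s2 e L).
Proof.
have D1 : derive1 (bump_diff s1 s2 e L) = rho.
  by apply/funext => t; exact: is_derive_derive1 (is_derive_bump_diff t).
case=> [|n] x; first by rewrite derive1n0; apply: ex_derive; exact: is_derive_bump_diff.
rewrite derive1Sn D1.
have E : rho = (fun x => flat_comb [:: (1, (0%N, 0%N))] s1 (s1 + e) x - flat_comb [:: (1, (0%N, 0%N))] s2 (s2 + e) x).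
  by rewrite /rho !bumpE.
suff H : derive1n n rho = (fun x => derive1n n (bump s1 (s1 + e)) x - derive1n n (bump s2 (s2 + e)) x).
  rewrite H; apply: ex_derive; apply: is_derive_sub; apply: smooth_derive; exact: smooth_bump.
elim: n => [//|n ih]; rewrite derive1nS ih; apply/funext => y; apply: is_derive_derive1.
by apply: is_derive_sub; apply: smooth_derive; exact: smooth_bump.
Qed.

Let mass (t : R) : L <= t -> oint (bump s1 (s1 + e)) (- L) t = oint (bump s2 (s2 + e)) (- L) t.
Proof.
have he := e0.
have h (s : R) : `|s| + e <= L -> L <= t -> oint (bump s (s + e)) (- L) t = oint (bump 0 e) 0 e.
  move=> hs tL; move: (hs); rewrite -lerBrDr ler_norml => /andP[n1 n2].
  rewrite -(oint_cat _ _ s) -(oint_cat _ s (s + e)).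
  have z1 : oint (bump s (s + e)) (- L) s = 0.
    apply: oint_eq0; [exact: continuous_bump|lra|].
    by move=> x /andP[_ hx]; apply: bump_out; left.
  have z2 : oint (bump s (s + e)) (s + e) t = 0.
    apply: oint_eq0; [exact: continuous_bump|lra|].
    by move=> x /andP[hx _]; apply: bump_out; right.
  rewrite z1 z2.
  rewrite add0r addr0.
  have D : antideriv (fun y => oint (bump s (s + e)) s (y + s) - oint (bump 0 e) 0 y) (fun=> 0).
    move=> y.
    have d1 := is_derive_comp (G := fun y => y + s) (is_derive_prim (y + s) (@continuous_bump s (s + e)))
      (is_derive_add (is_derive_id y (1 : R)) (is_derive_const s y)).
    have d2 := is_derive_prim y (@continuous_bump 0 e).
    have d3 := is_derive_sub (is_derive_sub d1 (is_derive_const (prim (bump s (s + e)) s) y))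
      (is_derive_sub d2 (is_derive_const (prim (bump 0 e) 0) y)).
    apply: is_derive_eq d3 _; rewrite addr0 !subr0 mulr1 /bump.
    by rewrite addrK subr0 (_ : s + e - (y + s) = e - y) ?subrr //; ring.
  have cancel0 (X Y Z W : R) : X - Y = Z - W -> Z = 0 -> W = 0 -> X = Y.
    by move=> E z0 w0; move: E; rewrite z0 w0 subrr => /eqP; rewrite subr_eq0 => /eqP.
  rewrite [X in oint _ _ X = _](addrC s e); apply: (cancel0 _ _ _ _ (derive0_const D e 0)).
    by rewrite add0r /oint subrr.
  by rewrite /oint subrr.
by move=> tL; rewrite !h.
Qed.

Lemma bump_diff_out t : L <= `|t| -> bump_diff s1 s2 e L t = 0.
Proof.
have he := e0.
move: (L1); rewrite -lerBrDr ler_norml => /andP[n1 n2].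
move: (L2); rewrite -lerBrDr ler_norml => /andP[m1 m2].
move=> tL; rewrite /bump_diff; case: (leP 0 t) => t0.
  rewrite ger0_norm // in tL; rewrite ointB; [|exact: continuous_bump..].
  by rewrite mass // subrr.
rewrite ltr0_norm // in tL.
rewrite (_ : oint _ _ _ = - oint rho t (- L)); last by rewrite /oint; ring.
rewrite oint_eq0 ?oppr0 //; first lra.
move=> x /andP[_ hx].
by rewrite /rho (@bump_out s1) ?(@bump_out s2) ?subrr //; left; lra.
Qed.

End bump_diff.

Lemma midpoint_lt (a b z : R) : `|z - a| < (a - b) / 2 -> 0 < z - (a + b) / 2.
Proof. rewrite ltr_norml; lra. Qed.

Lemma midpoint_gt (a b z : R) : `|z - b| < (a - b) / 2 -> 0 < (a + b) / 2 - z.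
Proof. rewrite ltr_norml; lra. Qed.

Lemma right_ball (s t e r : R) : e < r -> s < t < s + e -> `|t - s| < r.
Proof. by move=> er /andP[st te]; rewrite gtr0_norm; lra. Qed.

(* The only test functions needed are primitives of a difference of two translated bumps. *)
Lemma weak_derivative_time (A B : R -> R) : continuous A -> continuous B ->
  (forall chi M, smooth chi -> 0 < M -> (forall t, M <= `|t| -> chi t = 0) ->
     oint (fun t => derive1 chi t * A t + chi t * B t) (- M) M = 0) -> antideriv A B.
Proof.
move=> cA cB hyp; pose d t := A t - prim B t.
have cP : continuous (prim B) by apply: is_derive_continuous => x; exact: is_derive_prim.
have cd : continuous d by exact: continuous_sub.
(* It is to be shown that d is constant. Testing with the primitive of b1 - b2, bumps just after s1
   and s2, and integrating by parts gives that the integral of (b1 - b2) d is zero, which d s1 > d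
   s2 contradicts. *)
have key s1 s2 : d s1 <= d s2.
  rewrite leNgt; apply/negP => lt12.
  have [r1 r10 h1] := continuous_at_eps (cd s1) (e := (d s1 - d s2) / 2) ltac:(lra).
  have [r2 r20 h2] := continuous_at_eps (cd s2) (e := (d s1 - d s2) / 2) ltac:(lra).
  pose e : R := Num.min r1 r2 / 2.
  have e0 : 0 < e by rewrite divr_gt0 // lt_min r10.
  have er1 : e < r1.
    by apply: le_lt_trans (_ : r1 / 2 < _); [rewrite ler_pM2r ?invr_gt0 // ge_min lexx|lra].
  have er2 : e < r2.
    by apply: le_lt_trans (_ : r2 / 2 < _); [rewrite ler_pM2r ?invr_gt0 // ge_min lexx orbT|lra].
  pose L : R := `|s1| + `|s2| + e.
  have [a1 a2] : 0 <= `|s1| /\ 0 <= `|s2| by rewrite !normr_ge0.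
  have L1 : `|s1| + e <= L by rewrite /L; lra.
  have L2 : `|s2| + e <= L by rewrite /L; lra.
  have L0 : 0 < L by lra.
  pose chi := bump_diff s1 s2 e L.
  pose b1 := bump s1 (s1 + e); pose b2 := bump s2 (s2 + e).
  have cb1 : continuous b1 by exact: continuous_bump.
  have cb2 : continuous b2 by exact: continuous_bump.
  have Dchi : antideriv chi (fun t => b1 t - b2 t) := @is_derive_bump_diff s1 s2 e L.
  have dchi : derive1 chi = (fun t => b1 t - b2 t).
    by apply/funext => t; exact: is_derive_derive1 (Dchi t).
  have cchi : continuous chi by exact: is_derive_continuous Dchi.
  have cchi' : continuous (fun t => b1 t - b2 t) by exact: continuous_sub.
  have out t : L <= `|t| -> chi t = 0 by exact: bump_diff_out.
  have cL : chi L = 0 by rewrite out // ler_norm.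
  have cNL : chi (- L) = 0 by rewrite out // normrN ler_norm.
  have := hyp chi L (@smooth_bump_diff s1 s2 e L) L0 out; rewrite dchi.
  rewrite ointD; [|exact: continuous_mul|exact: continuous_mul].
  rewrite (oint_parts (G := prim B) _ _ cchi' cB Dchi (fun t => is_derive_prim t cB)).
  rewrite cL cNL !mul0r subrr sub0r -ointB; [|exact: continuous_mul..].
  (* As b1 - b2 has integral zero, d may be shifted by this midpoint; then d - c is positive on the
     support of b1 and negative on that of b2. *)
  pose c := (d s1 + d s2) / 2.
  have cc1 : continuous (fun t => b1 t * (d t - c)).
    by apply: continuous_mul => //; apply: continuous_sub => //; exact: continuous_const.
  have cc2 : continuous (fun t => b2 t * (c - d t)).
    by apply: continuous_mul => //; apply: continuous_sub => //; exact: continuous_const.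
  have -> : (fun t => (b1 t - b2 t) * A t - (b1 t - b2 t) * prim B t) =
    (fun t => (b1 t * (d t - c) + b2 t * (c - d t)) + c * (b1 t - b2 t)).
    by apply/funext => t; rewrite /d; ring.
  rewrite ointD; [|exact: continuous_add|exact: continuous_scale].
  rewrite ointZ // (oint_FTC _ _ _ Dchi) // cL cNL subrr mulr0 addr0 ointD //.
  move: (L1); rewrite -lerBrDr ler_norml => /andP[n1 n2].
  move: (L2); rewrite -lerBrDr ler_norml => /andP[m1 m2].
  have p1 t : s1 < t < s1 + e -> 0 < d t - c.
    by move=> ht; exact: midpoint_lt (h1 t (right_ball er1 ht)).
  have p2 t : s2 < t < s2 + e -> 0 < c - d t.
    by move=> ht; exact: midpoint_gt (h2 t (right_ball er2 ht)).
  have q1 t : 0 <= b1 t * (d t - c).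
    case: (boolP (s1 < t < s1 + e)) => ht; first by rewrite mulr_ge0 ?bump_ge0 // ltW // p1.
    rewrite /b1 bump_out ?mul0r //; move: ht; rewrite negb_and -!leNgt => /orP[]; by [left|right].
  have q2 t : 0 <= b2 t * (c - d t).
    case: (boolP (s2 < t < s2 + e)) => ht; first by rewrite mulr_ge0 ?bump_ge0 // ltW // p2.
    rewrite /b2 bump_out ?mul0r //; move: ht; rewrite negb_and -!leNgt => /orP[]; by [left|right].
  have g1 : 0 < oint (fun t => b1 t * (d t - c)) (- L) L.
    apply: (@oint_gt0 _ _ _ _ (s1 + e / 2)) => //; first lra.
      by apply/andP; split; lra.
    have hm : s1 < s1 + e / 2 < s1 + e by rewrite ltrDl divr_gt0 //= ltrD2l ltr_pdivrMr // ltr_pMr ?ltr1n.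
    exact: mulr_gt0 (bump_gt0 hm) (p1 _ hm).
  have g2 : 0 <= oint (fun t => b2 t * (c - d t)) (- L) L by apply: oint_ge0 => //; lra.
  lra.
move=> t; have dE s : d s = d 0 by apply/eqP; rewrite eq_le !key.
have -> : A = (fun s => prim B s + d 0) by apply/funext => s; rewrite -(dE s) /d; ring.
by apply: is_derive_eq (is_derive_add (is_derive_prim t cB) (is_derive_const (d 0) t)) _; rewrite addr0.
Qed.

End SmoothBump.

(** * Families of periodic functions, differentiable in time uniformly in space *)

Section TimeFamilies.
Set Implicit Arguments.
Unset Strict Implicit.
Unset Printing Implicit Defensive.
Variable R : realType.
Implicit Types (y z : R -> R -> R) (f g : R -> R) (a b t x : R).

(** Compactness of the segment, for properties that persist when r shrinks. It is used with r a
    modulus of continuity and with r the inverse of an upper bound. *)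
Lemma segment_uniform (Q : R -> R -> Prop) a b :
  (forall s r r', 0 < r' -> r' <= r -> Q s r -> Q s r') ->
  (forall s, a <= s <= b -> exists2 r : R, 0 < r & forall s', `|s' - s| < r -> Q s' r) ->
  exists2 r : R, 0 < r & forall s, a <= s <= b -> Q s r.
Proof.
move=> mono loc.
have cov := (compact_near_coveringP _).1 (@segment_compact R a b).
have H := cov R (0:R)^'+ (fun r s => Q s r) _ _.
have : \forall r \near (0:R)^'+, `[a, b] `<=` (fun s => Q s r).
  apply: H => s; rewrite /= in_itv /= => /loc[r r0 hr].
  exists ([set s' | `|s' - s| < r], [set r' | 0 < r' <= r]) => /=.
    split; first by apply/nbhs_ballP; exists r => //= s'; rewrite /ball /= distrC.
    near=> r'; apply/andP; split; first by near: r'; exact: nbhs_right_gt.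
    by apply: ltW; near: r'; exact: nbhs_right_lt.
  move=> [s' r'] [/= h1 /andP[h2 h3]].
  by apply: (mono _ r) => //; exact: hr.
move=> K; near (0:R)^'+ => r.
have r0 : 0 < r by near: r; exact: nbhs_right_gt.
exists r => // s hs.
have Kr : `[a, b] `<=` (fun s => Q s r) by near: r.
by apply: Kr; rewrite /= in_itv.
Unshelve. all: by end_near. Qed.

Definition circle_family y := forall t, on_circle (y t) /\ continuous (y t).

Definition time_continuous y := forall s (e : R), 0 < e -> exists2 r : R, 0 < r &
  forall t, `|t - s| < r -> forall x, `|y t x - y s x| <= e.

(** The derivative for the sup norm in x: r does not depend on x, so the estimate passes under
    integrals in x and through [helmholtz]. *)
Definition time_derivative y z := forall t (e : R), 0 < e -> exists2 r : R, 0 < r &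
  forall h, `|h| < r -> forall x, `|y (t + h) x - y t x - h * z t x| <= e * `|h|.

Lemma family_bounded y t : circle_family y -> exists2 M : R, 0 <= M & forall x, `|y t x| <= M.
Proof. by move=> hy; have [p c] := hy t; exact: circle_bounded. Qed.

Lemma circle_family_lin (c d : R) y z : circle_family y -> circle_family z ->
  circle_family (fun t x => c * y t x + d * z t x).
Proof.
move=> hy hz t; have [p1 c1] := hy t; have [p2 c2] := hz t; split.
  by move=> x; rewrite p1 p2.
by apply: continuous_add; exact: continuous_scale.
Qed.

Lemma circle_family_mul y z : circle_family y -> circle_family z ->
  circle_family (fun t x => y t x * z t x).
Proof.
move=> hy hz t; have [p1 c1] := hy t; have [p2 c2] := hz t; split.
  by move=> x; rewrite p1 p2.
exact: continuous_mul.
Qed.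

Lemma time_derivative_at y z t x : time_derivative y z -> is_derive t 1 (y ^~ x) (z t x).
Proof.
move=> d; apply: is_derive_epsP => e e0; have [r r0 h] := d t e e0.
by exists r => // k kr; exact: h.
Qed.

Lemma time_derivative_continuous y z : circle_family z -> time_derivative y z -> time_continuous y.
Proof.
move=> hz d s e e0; have [M M0 hM] := family_bounded s hz.
have [r r0 hr] := d s 1 ltr01.
have q0 : 0 < Num.min r (e / (1 + M)) by rewrite lt_min r0 divr_gt0 //; lra.
exists (Num.min r (e / (1 + M))) => // t; rewrite lt_min => /andP[t1 t2] x.
have := hr _ t1 x; rewrite (addrC s) subrK mul1r => h1.
have h2 : `|(t - s) * z s x| <= `|t - s| * M by rewrite normrM ler_wpM2l.
rewrite ltr_pdivlMr in t2; last lra.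
have := ler_normD (y t x - y s x - (t - s) * z s x) ((t - s) * z s x); rewrite subrK; lra.
Qed.

Lemma time_derivative_lin (c d : R) y y' z z' : time_derivative y y' -> time_derivative z z' ->
  time_derivative (fun t x => c * y t x + d * z t x) (fun t x => c * y' t x + d * z' t x).
Proof.
move=> d1 d2 t e e0; set K := `|c| + `|d| + 1.
have c0 : 0 <= `|c| by []. have dd0 : 0 <= `|d| by [].
have K0 : 0 < K by rewrite /K; lra.
have e1 : 0 < e / K by rewrite divr_gt0.
have [r1 r10 h1] := d1 t _ e1; have [r2 r20 h2] := d2 t _ e1.
exists (Num.min r1 r2); first by rewrite lt_min r10.
move=> h; rewrite lt_min => /andP[hr1 hr2] x.
have k1 := h1 h hr1 x; have k2 := h2 h hr2 x.
rewrite (_ : _ - _ - _ = c * (y (t + h) x - y t x - h * y' t x) + d * (z (t + h) x - z t x - h * z' t x)); last by ring.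
apply: le_trans (ler_normD _ _) _; rewrite !normrM.
apply: le_trans (lerD (ler_wpM2l c0 k1) (ler_wpM2l dd0 k2)) _.
rewrite (_ : _ + _ = (`|c| + `|d|) * (e / K) * `|h|); last by ring.
rewrite ler_wpM2r // mulrA ler_pdivrMr // mulrC ler_pM2l // /K; lra.
Qed.

Lemma time_derivative_mul y y' z z' :
  circle_family y -> circle_family y' -> circle_family z -> circle_family z' ->
  time_derivative y y' -> time_derivative z z' ->
  time_derivative (fun t x => y t x * z t x) (fun t x => y' t x * z t x + y t x * z' t x).
Proof.
move=> hy hy' hz hz' d1 d2 t e e0.
have [A A0 hA] := family_bounded t hy; have [A' A'0 hA'] := family_bounded t hy'.
have [B B0 hB] := family_bounded t hz; have [B' B'0 hB'] := family_bounded t hz'.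
pose K := A + B + A' + 1; have K0 : 0 < K by rewrite /K; lra.
have e1 : 0 < e / (2 * K) by rewrite divr_gt0 // mulr_gt0.
have [r1 r10 h1] := d1 t _ e1; have [r2 r20 h2] := d2 t _ e1.
have [r3 r30 h3] := d1 t 1 ltr01.
have [r4 r40 h4] := time_derivative_continuous hz' d2 t e1.
exists (Num.min (Num.min r1 r2) (Num.min r3 r4)); first by rewrite !lt_min r10 r20 r30.
move=> h; rewrite !lt_min => /andP[/andP[hr1 hr2] /andP[hr3 hr4]] x.
have k1 := h1 h hr1 x; have k2 := h2 h hr2 x; have k3 := h3 h hr3 x.
have := h4 (t + h); rewrite addrAC subrr add0r => /(_ hr4 x) k4.
set dy := y (t + h) x - y t x in k1 k3; set dz := z (t + h) x - z t x in k2 k4.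
rewrite (_ : _ - _ - _ = (dy - h * y' t x) * z t x + y t x * (dz - h * z' t x) + dy * dz); last by rewrite /dy /dz; ring.
have n0 : 0 <= `|h| by [].
have m1 : `|(dy - h * y' t x) * z t x| <= e / (2 * K) * `|h| * B.
  by rewrite normrM; apply: ler_pM.
have m2 : `|y t x * (dz - h * z' t x)| <= A * (e / (2 * K) * `|h|).
  by rewrite normrM; apply: ler_pM.
have ndy : `|dy| <= (1 + A') * `|h|.
  have h5 : `|h * y' t x| <= `|h| * A' by rewrite normrM ler_wpM2l.
  have := ler_normD (dy - h * y' t x) (h * y' t x); rewrite subrK; lra.
have m3 : `|dy * dz| <= (1 + A') * `|h| * (e / (2 * K)).
  by rewrite normrM; apply: ler_pM.
have s1 := ler_normD ((dy - h * y' t x) * z t x + y t x * (dz - h * z' t x)) (dy * dz).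
have s2 := ler_normD ((dy - h * y' t x) * z t x) (y t x * (dz - h * z' t x)).
have E : e / (2 * K) * `|h| * K = e / 2 * `|h| by field; rewrite gt_eqF.
have : e / (2 * K) * `|h| * B + A * (e / (2 * K) * `|h|) + (1 + A') * `|h| * (e / (2 * K)) = e / 2 * `|h|.
  by rewrite -E /K; ring.
have : 0 <= e * `|h| by rewrite mulr_ge0 // ltW.
lra.
Qed.

Lemma time_derivative_oint y z a b t : a <= b -> (forall t, continuous (y t)) -> (forall t, continuous (z t)) ->
  time_derivative y z -> is_derive t 1 (fun t => oint (y t) a b) (oint (z t) a b).
Proof.
move=> ab cy cz d; apply: is_derive_epsP => e e0.
have e1 : 0 < e / (b - a + 1) by rewrite divr_gt0 //; lra.
have [r r0 hr] := d t _ e1; exists r => // h hh.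
rewrite -ointB // -ointZ // -ointB; [|exact: continuous_sub|exact: continuous_scale].
apply: le_trans (@oint_bound _ _ _ _ (e / (b - a + 1) * `|h|) _ _ _) _ => //.
- by apply: continuous_sub; [exact: continuous_sub|exact: continuous_scale].
- by move=> x _; exact: hr.
rewrite mulrAC ler_wpM2r // mulrAC ler_pdivrMr; last lra.
by rewrite ler_pM2l //; lra.
Qed.

Lemma time_continuous_oint y a b : a <= b -> (forall t, continuous (y t)) ->
  time_continuous y -> continuous (fun t => oint (y t) a b).
Proof.
move=> ab cy d; apply: continuous_epsP => t e e0.
have e1 : 0 < e / (b - a + 1) by rewrite divr_gt0 //; lra.
have [r r0 hr] := d t _ e1; exists r => // h hh.
rewrite -ointB //.
apply: le_trans (@oint_bound _ _ _ _ (e / (b - a + 1)) _ _ _) _ => //.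
- exact: continuous_sub.
- by move=> x _; exact: hr.
rewrite mulrAC ler_pdivrMr; last lra.
by rewrite ler_pM2l //; lra.
Qed.

Section operator.
Variable L : (R -> R) -> R -> R.
Hypothesis L_lin : forall (a b : R) f g, on_circle f -> continuous f -> on_circle g -> continuous g ->
  L (fun x => a * f x + b * g x) = (fun x => a * L f x + b * L g x).
Hypothesis L_bound : forall f, on_circle f -> continuous f -> forall M, (forall x, `|f x| <= M) ->
  forall x, `|L f x| <= M.

(** A linear operator of sup norm at most 1 preserves the bound on the first-order remainder, with
    the same r. *)
Lemma time_derivative_operator y z : circle_family y -> circle_family z ->
  time_derivative y z -> time_derivative (fun t => L (y t)) (fun t => L (z t)).
Proof.
move=> hy hz d t e e0; have [r r0 hr] := d t e e0; exists r => // h hh x.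
have [p1 c1] := hy (t + h); have [p2 c2] := hy t; have [p3 c3] := hz t.
pose f1 x := 1 * y (t + h) x + (-1) * y t x.
have pf1 : on_circle f1 by move=> v; rewrite /f1 p1 p2.
have cf1 : continuous f1 by apply: continuous_add; exact: continuous_scale.
have E : L (fun x => 1 * f1 x + (- h) * z t x) x = L (y (t + h)) x - L (y t) x - h * L (z t) x.
  by rewrite (L_lin 1 (- h) pf1 cf1 p3 c3) (L_lin 1 (-1) p1 c1 p2 c2); ring.
rewrite -E; apply: L_bound.
- by move=> v; rewrite pf1 p3.
- by apply: continuous_add; exact: continuous_scale.
move=> v; rewrite (_ : 1 * f1 v + - h * z t v = y (t + h) v - y t v - h * z t v); last by rewrite /f1; ring.
exact: hr.
Qed.

End operator.

Lemma time_derivative_helmholtz y z : circle_family y -> circle_family z ->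
  time_derivative y z -> time_derivative (fun t => helmholtz (y t)) (fun t => helmholtz (z t)).
Proof.
apply: time_derivative_operator; first exact: helmholtz_lin.
by move=> f pf cf M hM x; exact: helmholtz_bound.
Qed.

Lemma time_derivative_dhelmholtz y z : circle_family y -> circle_family z ->
  time_derivative y z -> time_derivative (fun t => dhelmholtz (y t)) (fun t => dhelmholtz (z t)).
Proof.
apply: time_derivative_operator; first exact: dhelmholtz_lin.
by move=> f pf cf M hM x; exact: dhelmholtz_bound.
Qed.

Lemma circle_family_dhelmholtz y : circle_family y -> circle_family (fun t => dhelmholtz (y t)).
Proof. by move=> hy t; have [p c] := hy t; split; [exact: circle_dhelmholtz|exact: continuous_dhelmholtz]. Qed.

Lemma time_continuous_at y x : time_continuous y -> continuous (y ^~ x).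
Proof.
move=> hy; apply: continuous_epsP => t e e0; have [r r0 h] := hy t e e0.
by exists r => // s hs; exact: h.
Qed.

Section time_integral.
Variable y : R -> R -> R.
Hypotheses (hy : circle_family y) (cy : time_continuous y).

Definition time_integral t x := prim (y ^~ x) t.

(** The continuity of y(s) at x extends to nearby times by uniform continuity in time, then to the
    whole segment by compactness. *)
Lemma equicontinuous_in_space a b x (e : R) : 0 < e -> exists2 r : R, 0 < r &
  forall t, a <= t <= b -> forall x', `|x' - x| < r -> `|y t x' - y t x| <= e.
Proof.
move=> e0.
apply: (@segment_uniform (fun t r => forall x', `|x' - x| < r -> `|y t x' - y t x| <= e)).
  by move=> s r r' _ rr h x' hx; apply: h; exact: lt_le_trans rr.
move=> s _; have [_ c] := hy s.
have [r1 r10 h1] := continuous_at_eps (c x) (e := e / 3) ltac:(lra).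
have [r2 r20 h2] := cy s (e := e / 3) ltac:(lra).
exists (Num.min r1 r2); first by rewrite lt_min r10.
move=> s'; rewrite lt_min => /andP[_ hs] x'; rewrite lt_min => /andP[hx _].
have k1 := h1 x' hx; have k2 := h2 s' hs x; have k3 := h2 s' hs x'.
rewrite (_ : _ - _ = (y s' x' - y s x') + (y s x' - y s x) - (y s' x - y s x)); last by ring.
apply: le_trans (ler_normB _ _) _.
have := ler_normD (y s' x' - y s x') (y s x' - y s x); lra.
Qed.

Lemma circle_family_time_integral : circle_family time_integral.
Proof.
move=> t; split.
  move=> x; rewrite /time_integral; congr (prim _ t); apply/funext => s.
  by have [p _] := hy s; rewrite p.
apply: continuous_epsP => x e e0.
have t1 : 0 < `|t| + 1 by rewrite ltr_wpDl.
have [r r0 h] := equicontinuous_in_space (- `|t|) `|t| x (e := e / (`|t| + 1)) ltac:(by rewrite divr_gt0).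
exists r => // x' hx; rewrite /time_integral.
pose F s := prim (y ^~ x') s - prim (y ^~ x) s.
have F0 : F 0 = 0 by rewrite /F !prim0 subrr.
rewrite -/(F t) -[F t]subr0 -F0.
apply: le_trans (@mean_value_bound _ F (fun s => y s x' - y s x) 0 t (e / (`|t| + 1)) _) _.
  move=> s hs; split.
    by apply: is_derive_sub; apply: is_derive_prim; exact: time_continuous_at.
  apply: h => //; move: hs; rewrite -ler_norml; case: (leP 0 t) => t0.
    by move=> /andP[s0 st]; rewrite (ger0_norm t0) ger0_norm.
  by move=> /andP[s0 st]; rewrite (ltr0_norm t0) ler0_norm // lerN2.
rewrite subr0 mulrAC ler_pdivrMr // ler_pM2l //; lra.
Qed.

Lemma time_derivative_time_integral : time_derivative time_integral y.
Proof.
move=> t e e0; have [r r0 hr] := cy t e0; exists r => // h hh x.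
pose F s := prim (y ^~ x) s - s * y t x.
rewrite (_ : _ - _ - _ = F (t + h) - F t); last by rewrite /F /time_integral; ring.
have -> : `|h| = `|t + h - t| by congr (`|_|); ring.
apply: (@mean_value_bound _ F (fun s => y s x - y t x)) => s hs; split.
  apply: is_derive_sub; first by apply: is_derive_prim; exact: time_continuous_at.
  by apply: is_derive_eq (is_derive_mul (is_derive_id s (1 : R)) (is_derive_const (y t x) s)) _; ring.
apply: hr; apply: le_lt_trans hh; move: hs; case: (leP t (t + h)) => th.
  by rewrite (ger0_norm (x := h)) => [/andP[a b]|]; [rewrite ger0_norm; lra|lra].
by rewrite (ltr0_norm (x := h)) => [/andP[a b]|]; [rewrite ler0_norm; lra|lra].
Qed.

End time_integral.

End TimeFamilies.

(** * From the distributional equation to equations for the coefficients *)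

Section Equation.
Set Implicit Arguments.
Unset Strict Implicit.
Unset Printing Implicit Defensive.
Variable R : realType.
Implicit Types (u : R -> R -> R) (f g : R -> R) (a b t x : R).
Notation mu := (@lebesgue_measure R).

Definition flux u t x : R := u t x + u t x ^+ 2 / 2.

Lemma H1_circle_family u : continuous_in_H1 u -> circle_family u.
Proof. by move=> [h _] t; have [p c _] := h t. Qed.

Lemma H1_time_continuous u : continuous_in_H1 u -> time_continuous u.
Proof.
move=> [h1 h2] s e e0.
(* The 3 is the constant of [sobolev]. *)
have /cvgrPdist_lt /(_ (e / 3) ltac:(lra)) /nbhs_ballP[r r0 hr] := h2 s.
exists r => // t ht x.
have hn : H1_norm (fun x => u t x - u s x) <= e / 3.
  have := hr t; rewrite /ball /= distrC => /(_ ht); rewrite sub0r normrN => k.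
  by apply: ltW; apply: le_lt_trans k; exact: ler_norm.
have := @sobolev R (fun x => u t x - u s x) (e / 3) x (circle_H1_sub (h1 t) (h1 s)) ltac:(lra) hn.
by rewrite mulrCA mulfV ?mulr1.
Qed.

Lemma circle_family_flux u : circle_family u -> circle_family (flux u).
Proof.
move=> h t; have [p c] := h t; split; first by move=> x; rewrite /flux p.
apply: continuous_add => //; apply: continuous_mul; last exact: continuous_const.
exact: continuous_sqr.
Qed.

Lemma time_continuous_flux u : circle_family u -> time_continuous u -> time_continuous (flux u).
Proof.
move=> hu cu s e e0; have [M M0 hM] := family_bounded s hu.
have e1 : 0 < e / (2 + M) by rewrite divr_gt0 //; lra.
have m0 : 0 < Num.min 1 (e / (2 + M)) by rewrite lt_min ltr01.
have [r r0 hr] := cu s _ m0; exists r => // t ht x.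
have := hr t ht x; rewrite le_min => /andP[k1 k2].
rewrite (_ : _ - _ = (u t x - u s x) * (1 + u s x + (u t x - u s x) / 2)); last by rewrite /flux; field.
rewrite normrM; apply: le_trans (_ : e / (2 + M) * (2 + M) <= _); last first.
  by rewrite divfK // gt_eqF //; lra.
apply: ler_pM => //; have := hM x; have := ler_normD (1 + u s x) ((u t x - u s x) / 2).
have := ler_normD 1 (u s x); rewrite normr1 normrM (gtr0_norm (x := 2^-1)) ?invr_gt0 //; lra.
Qed.

Lemma continuousM2 (f g : R -> R) : continuous f -> continuous g ->
  continuous (fun p : R * R => f p.1 * g p.2).
Proof.
move=> cf cg p; apply: cvgM.
  by apply: (@continuous_comp _ _ _ fst f); [exact: cvg_fst|exact: cf].
by apply: (@continuous_comp _ _ _ snd g); [exact: cvg_snd|exact: cg].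
Qed.

Lemma iter_partial_mul (c e : R -> R) s : smooth c -> smooth e ->
  exists i j : nat, iter_partial s (fun t x => c t * e x) = (fun t x => derive1n i c t * derive1n j e x).
Proof.
move=> sc se; elim: s => [|b s [i [j ih]]]; first by exists 0%N, 0%N; rewrite !derive1n0.
rewrite /= -/(iter_partial s _) ih; case: b.
  exists i.+1, j; apply/funext => t; apply/funext => x; apply: is_derive_derive1.
  apply: is_derive_eq (is_derive_mul (@smooth_derive R _ i sc t) (is_derive_const (derive1n j e x) t)) _.
  by ring.
exists i, j.+1; apply/funext => t; apply/funext => x; apply: is_derive_derive1.
exact: is_derive_scale (@smooth_derive R _ j se x).
Qed.

Lemma smooth2_mul (c e : R -> R) : smooth c -> smooth e -> smooth2 (fun t x => c t * e x).
Proof.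
move=> sc se s; have [i [j ->]] := iter_partial_mul s sc se => /=; split.
- by apply: continuousM2; exact: smooth_continuous.
- move=> t x; apply: ex_derive; exact: (is_derive_mul (@smooth_derive R _ i sc t) (is_derive_const (derive1n j e x) t)).
- move=> t x; apply: ex_derive; exact: (is_derive_scale _ (@smooth_derive R _ j se x)).
Qed.

Lemma Rintegral_support f (M : R) : continuous f -> 0 < M -> (forall t, M <= `|t| -> f t = 0) ->
  \int[mu]_t f t = oint f (- M) M.
Proof.
move=> cf M0 h; rewrite -Rintegral_oint //; last lra.
rewrite [RHS]Rintegral_mkcond; apply: eq_Rintegral => t _; rewrite patchE.
case: ifPn => //; rewrite notin_setE /= in_itv /= => /negP ht; apply: h.
by rewrite leNgt; apply/negP => k; move: ht; rewrite -ler_norml (ltW k).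
Qed.

(** Test with chi(t) (p cos kx + q sin kx): the operator 1 - d_x^2 acts as 1 + k^2, and what remains
    is the weak form in time handled by [weak_derivative_time]. The parameters p and q treat cosine
    and sine together. *)
Lemma coef_ode u (p q : R) (k : nat) : circle_family u -> time_continuous u ->
  distributional_solution u ->
  antideriv (fun t => (1 + k%:R ^+ 2) * (p * cos_coef (u t) k%:R + q * sin_coef (u t) k%:R))
    (fun t => k%:R * (q * cos_coef (flux u t) k%:R - p * sin_coef (flux u t) k%:R)).
Proof.
move=> hu cu sol; have hf := circle_family_flux hu; have cf := time_continuous_flux hu cu.
have pp : - pi <= (pi : R) by have := pi_ge0 R; lra.
have bdc (y : R -> R -> R) (h : R -> R) : circle_family y -> time_continuous y -> continuous h -> (forall x, `|h x| <= 1) ->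
   continuous (fun t => oint (fun x => y t x * h x) (- pi) pi).
  move=> hy cy ch h1; apply: (@time_continuous_oint _ (fun t x => y t x * h x)) => //.
    by move=> t; apply: continuous_mul => //; exact: (hy t).2.
  move=> s e e0; have [r r0 hr] := cy s e e0; exists r => // t ht x.
  by rewrite -mulrBl normrM -[e]mulr1; apply: ler_pM => //; exact: hr.
have cC y : circle_family y -> time_continuous y -> continuous (fun t => cos_coef (y t) k%:R).
  by move=> hy cy; apply: bdc => //; [exact: continuous_cosM|move=> x; exact: cos_max].
have cS y : circle_family y -> time_continuous y -> continuous (fun t => sin_coef (y t) k%:R).
  by move=> hy cy; apply: bdc => //; [exact: continuous_sinM|move=> x; exact: sin_max].
set A := fun t => _ * (p * _ + _); set B := fun t => _ * (q * _ - _).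
have cA : continuous A.
  by apply: continuous_scale; apply: continuous_add; apply: continuous_scale; [exact: cC|exact: cS].
have cB : continuous B.
  by apply: continuous_scale; apply: continuous_sub; apply: continuous_scale; [exact: cC|exact: cS].
apply: weak_derivative_time => // chi M sc M0 out.
pose e (x : R) := p * cos (k%:R * x) + q * sin (k%:R * x).
pose e1 (x : R) := k%:R * (q * cos (k%:R * x) - p * sin (k%:R * x)).
have de : antideriv e e1.
  move=> x; apply: is_derive_eq (is_derive_add (is_derive_scale p (is_derive_cosM k%:R x))
   (is_derive_scale q (is_derive_sinM k%:R x))) _; rewrite /e1; ring.
have de1 : antideriv e1 (fun x => - k%:R ^+ 2 * e x).
  move=> x; apply: is_derive_eq (is_derive_scale k%:R (is_derive_sub (is_derive_scale q (is_derive_cosM k%:R x))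
   (is_derive_scale p (is_derive_sinM k%:R x)))) _; rewrite /e; ring.
have [pe se] := circle_test_trig k p q.
have dchi : antideriv chi (derive1 chi) := @smooth_derive R _ 0 sc.
have cchi' : continuous (derive1 chi) := @smooth_continuous R _ 1 sc.
have cchi : continuous chi := is_derive_continuous dchi.
pose phi t x := chi t * e x.
have tphi : cylinder_test phi.
  split; [exact: smooth2_mul|by move=> t x; rewrite /phi /e pe|].
  by exists M => t x tM; rewrite /phi out ?mul0r // ltW.
have E1 : dx phi = fun t x => chi t * e1 x.
  apply/funext => t; apply/funext => x; apply: is_derive_derive1; exact: is_derive_scale (de x).
have E2 : dx (fun t x => chi t * e1 x) = fun t x => - k%:R ^+ 2 * phi t x.
  apply/funext => t; apply/funext => x; apply: is_derive_derive1.
  by apply: is_derive_eq (is_derive_scale (chi t) (de1 x)) _; rewrite /phi; ring.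
have dph t x : is_derive t 1 (phi ^~ x) (derive1 chi t * e x).
  by apply: is_derive_eq (is_derive_mul (dchi t) (is_derive_const (e x) t)) _; ring.
have E3 : dt phi = fun t x => derive1 chi t * e x.
  apply/funext => t; apply/funext => x; exact: is_derive_derive1 (dph t x).
have E4 : dt (fun t x => - k%:R ^+ 2 * phi t x) = fun t x => - k%:R ^+ 2 * (derive1 chi t * e x).
  apply/funext => t; apply/funext => x; apply: is_derive_derive1; exact: is_derive_scale (dph t x).
have := sol _ tphi; rewrite E1 E2 E3 E4.
have -> : (fun t => circle_int (fun x => u t x * (derive1 chi t * e x - - k%:R ^+ 2 * (derive1 chi t * e x)) +
     (u t x + u t x ^+ 2 / 2) * (chi t * e1 x))) = (fun t => derive1 chi t * A t + chi t * B t).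
  apply/funext => t; have [pu cut] := hu t; have [pf cft] := hf t.
  have uc := continuous_mulcos (w := k%:R) cut; have us := continuous_mulsin (w := k%:R) cut.
  have fc := continuous_mulcos (w := k%:R) cft; have fs := continuous_mulsin (w := k%:R) cft.
  rewrite (_ : (fun x => _) = (fun x => (derive1 chi t * (1 + k%:R ^+ 2)) * (p * (u t x * cos (k%:R * x)) + q * (u t x * sin (k%:R * x)))
     + (chi t * k%:R) * (q * (flux u t x * cos (k%:R * x)) - p * (flux u t x * sin (k%:R * x))))); last first.
    apply/funext => x; rewrite /flux /e /e1.
    ring.
  have c1 : continuous (fun x => p * (u t x * cos (k%:R * x)) + q * (u t x * sin (k%:R * x))).
    by apply: continuous_add; exact: continuous_scale.
  have c2 : continuous (fun x => q * (flux u t x * cos (k%:R * x)) - p * (flux u t x * sin (k%:R * x))).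
    by apply: continuous_sub; exact: continuous_scale.
  rewrite circle_int_oint; last by apply: continuous_add; exact: continuous_scale.
  rewrite ointD; [|exact: continuous_scale..].
  rewrite ointZ // ointZ // ointD; [|exact: continuous_scale..].
  rewrite ointB; [|exact: continuous_scale..].
  by rewrite !ointZ // /A /B /cos_coef /sin_coef; ring.
rewrite (@Rintegral_support _ M) //.
  by apply: continuous_add; exact: continuous_mul.
move=> t tM; rewrite out // mul0r addr0.
(* The case |t| = M is included: chi vanishes on the outward side of t, so increments h pointing
   outward already force the derivative to be zero. *)
suff -> : derive1 chi t = 0 by rewrite mul0r.
apply/eqP/negPn/negP => d0; set d := derive1 chi t in d0.
have nd : 0 < `|d| by rewrite normr_gt0.
have [r r0 hr] := is_derive_eps (dchi t) (e := `|d| / 2) ltac:(lra).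
pose h : R := if 0 <= t then r / 2 else - (r / 2).
have nh : `|h| = r / 2 by rewrite /h; case: ifP => _; rewrite ?normrN gtr0_norm //; lra.
have oh : chi (t + h) = 0.
  apply: out; rewrite /h; case: (leP 0 t) tM => t0.
    by rewrite (ger0_norm t0) => tM; rewrite ger0_norm; lra.
  by rewrite (ltr0_norm t0) => tM; rewrite ltr0_norm; lra.
have := hr h; rewrite nh => /(_ ltac:(lra)); rewrite oh (out _ tM) subrr sub0r normrN normrM nh.
by have : 0 < r * `|d| by [rewrite mulr_gt0]; rewrite -/d; lra.
Qed.

End Equation.

(** * The equation in the sup norm, and the rate of change of truncated energies *)

Section Energy.
Set Implicit Arguments.
Unset Strict Implicit.
Unset Printing Implicit Defensive.
Variable R : realType.
Implicit Types (u : R -> R -> R) (f g v : R -> R) (t x : R).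

Let pp : - pi <= (pi : R).
Proof. by have := pi_ge0 R; lra. Qed.

Lemma time_derivative_coef y z (k : nat) : circle_family y -> circle_family z -> time_derivative y z ->
  antideriv (fun t => cos_coef (y t) k%:R) (fun t => cos_coef (z t) k%:R) /\
  antideriv (fun t => sin_coef (y t) k%:R) (fun t => sin_coef (z t) k%:R).
Proof.
move=> hy hz d.
have dh (h : R -> R) : continuous h -> (forall x, `|h x| <= 1) ->
   antideriv (fun t => oint (fun x => y t x * h x) (- pi) pi) (fun t => oint (fun x => z t x * h x) (- pi) pi).
  move=> ch h1 t; apply: (@time_derivative_oint _ (fun t x => y t x * h x) (fun t x => z t x * h x)) => //.
  - by move=> s; apply: continuous_mul => //; exact: (hy s).2.
  - by move=> s; apply: continuous_mul => //; exact: (hz s).2.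
  move=> s e e0; have [r r0 hr] := d s e e0; exists r => // k1 hk x.
  rewrite (_ : _ - _ - _ = (y (s + k1) x - y s x - k1 * z s x) * h x); last by ring.
  by rewrite normrM -[leRHS]mulr1; apply: ler_pM => //; exact: hr.
split; apply: dh; [exact: continuous_cosM|by move=> x; exact: cos_max|exact: continuous_sinM|by move=> x; exact: sin_max].
Qed.

Section solution.
Variable u : R -> R -> R.
Hypotheses (u_H1 : continuous_in_H1 u) (u_sol : distributional_solution u).

Let hu := H1_circle_family u_H1.
Let cu := H1_time_continuous u_H1.
Let hf := circle_family_flux hu.
Let cf := time_continuous_flux hu cu.

Lemma cos_coef_ode (k : nat) : antideriv (fun t => (1 + k%:R ^+ 2) * cos_coef (u t) k%:R)
  (fun t => - (k%:R * sin_coef (flux u t) k%:R)).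
Proof.
move=> t; have D := @coef_ode R u 1 0 k hu cu u_sol t.
rewrite (_ : (fun t => _) = (fun t => (1 + k%:R ^+ 2) * (1 * cos_coef (u t) k%:R + 0 * sin_coef (u t) k%:R))).
  by apply: is_derive_eq D _; ring.
by apply/funext => s; ring.
Qed.

Lemma sin_coef_ode (k : nat) : antideriv (fun t => (1 + k%:R ^+ 2) * sin_coef (u t) k%:R)
  (fun t => k%:R * cos_coef (flux u t) k%:R).
Proof.
move=> t; have D := @coef_ode R u 0 1 k hu cu u_sol t.
rewrite (_ : (fun t => _) = (fun t => (1 + k%:R ^+ 2) * (0 * cos_coef (u t) k%:R + 1 * sin_coef (u t) k%:R))).
  by apply: is_derive_eq D _; ring.
by apply/funext => s; ring.
Qed.

(** By the coefficient equations, (1 + k^2) times a coefficient of u plus or minus k times the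
    conjugate one of the time integral of the flux is constant in time. So both sides have equal
    Fourier coefficients, and [fourier_unique] concludes. The integrated form precedes the
    differential one because only continuity in time of u is known so far. *)
Lemma solution_integral_form t x :
  u t x = u 0 x - dhelmholtz (time_integral (flux u) t) x.
Proof.
set Phi := time_integral (flux u).
have hP : circle_family Phi := circle_family_time_integral hf cf.
have dP : time_derivative Phi (flux u) := time_derivative_time_integral cf.
have [p1 c1] := hu t; have [p0 c0] := hu 0; have [pP cP] := hP t.
have pA := circle_dhelmholtz pP cP; have cA := continuous_dhelmholtz cP.
have P0 : Phi 0 = fun=> 0 by apply/funext => z; exact: prim0.
apply/eqP; rewrite -subr_eq0; apply/eqP; move: x.
apply: (@fourier_unique _ (fun x => u t x - (u 0 x - dhelmholtz (Phi t) x))).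
- by move=> x; rewrite p1 p0 pA.
- by apply: continuous_sub => //; exact: continuous_sub.
move=> k; have [d1 d2] := time_derivative_coef k hP hf dP.
have q0 : (1 + k%:R ^+ 2 : R) != 0 by rewrite gt_eqF // ltr_wpDr // sqr_ge0.
have aux1 (q X Y Z K : R) : q != 0 -> q * X + K * (q * Z) = q * Y -> X - (Y - K * Z) = 0.
  move=> qn E; apply: (mulfI qn); rewrite mulr0.
  by have -> : q * (X - (Y - K * Z)) = q * X + K * (q * Z) - q * Y by [ring]; rewrite E subrr.
have aux2 (q X Y Z K : R) : q != 0 -> q * X - K * (q * Z) = q * Y -> X - (Y - - (K * Z)) = 0.
  move=> qn E; apply: (mulfI qn); rewrite mulr0.
  by have -> : q * (X - (Y - - (K * Z))) = q * X - K * (q * Z) - q * Y by [ring]; rewrite E subrr.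
have [e1 e2] := dhelmholtz_coef k pP cP; have [e3 e4] := helmholtz_coef k pP cP.
have cc g : continuous g -> continuous (fun x => g x * cos (k%:R * x)) := @continuous_mulcos R g k%:R.
have cs g : continuous g -> continuous (fun x => g x * sin (k%:R * x)) := @continuous_mulsin R g k%:R.
have z1 : sin_coef (Phi 0) k%:R = 0 by rewrite P0 /sin_coef; under eq_fun do rewrite mul0r; rewrite oint_cst mul0r.
have z2 : cos_coef (Phi 0) k%:R = 0 by rewrite P0 /cos_coef; under eq_fun do rewrite mul0r; rewrite oint_cst mul0r.
split.
  have -> : cos_coef (fun x => u t x - (u 0 x - dhelmholtz (Phi t) x)) k%:R =
     cos_coef (u t) k%:R - (cos_coef (u 0) k%:R - cos_coef (dhelmholtz (Phi t)) k%:R).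
    rewrite /cos_coef -ointB; [|exact: cc..]; rewrite -ointB; [|exact: cc|by apply: continuous_sub; exact: cc].
    by congr oint; apply/funext => x; ring.
  have D : antideriv (fun t => (1 + k%:R ^+ 2) * cos_coef (u t) k%:R + k%:R * sin_coef (Phi t) k%:R) (fun=> 0).
    by move=> s; apply: is_derive_eq (is_derive_add (cos_coef_ode k s) (is_derive_scale k%:R (d2 s))) _; ring.
  have := derive0_const D t 0; rewrite z1 mulr0 addr0 -e4 e1 => E.
  exact: (aux1 _ _ _ _ _ q0 E).
have -> : sin_coef (fun x => u t x - (u 0 x - dhelmholtz (Phi t) x)) k%:R =
   sin_coef (u t) k%:R - (sin_coef (u 0) k%:R - sin_coef (dhelmholtz (Phi t)) k%:R).
  rewrite /sin_coef -ointB; [|exact: cs..]; rewrite -ointB; [|exact: cs|by apply: continuous_sub; exact: cs].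
  by congr oint; apply/funext => x; ring.
have D : antideriv (fun t => (1 + k%:R ^+ 2) * sin_coef (u t) k%:R - k%:R * cos_coef (Phi t) k%:R) (fun=> 0).
  by move=> s; apply: is_derive_eq (is_derive_sub (sin_coef_ode k s) (is_derive_scale k%:R (d1 s))) _; ring.
have := derive0_const D t 0; rewrite z2 mulr0 subr0 -e3 e2 => E.
exact: (aux2 _ _ _ _ _ q0 E).
Qed.

Lemma solution_time_derivative : time_derivative u (fun t x => - dhelmholtz (flux u t) x).
Proof.
have hP := circle_family_time_integral hf cf.
have dA := time_derivative_dhelmholtz hP hf (time_derivative_time_integral cf).
move=> t e e0; have [r r0 hr] := dA t e e0; exists r => // h hh x.
have key (a b c d : R) : `|a - b - (a - c) - h * - d| = `|b - c - h * d|.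
  by rewrite -normrN; congr (`|_|); ring.
by rewrite (solution_integral_form (t + h)) (solution_integral_form t) key; exact: hr.
Qed.

(** The factor 1 + k^2 of the energy cancels the one in the coefficient equations, leaving a single
    k. The rate is a function of the profile v alone, so that it can be bounded uniformly over
    profiles. *)
Definition energy_rate v N : R := \sum_(1 <= k < N.+1) 2 * k%:R *
  (sin_coef v k%:R * cos_coef (fun x => v x + v x ^+ 2 / 2) k%:R
   - cos_coef v k%:R * sin_coef (fun x => v x + v x ^+ 2 / 2) k%:R).

Lemma is_derive_energy N : antideriv (fun t => energy (u t) N) (fun t => energy_rate (u t) N).
Proof.
move=> t; apply: is_derive_bigsum => k _.
have q0 : (1 + k%:R ^+ 2 : R) != 0 by rewrite gt_eqF // ltr_wpDr // sqr_ge0.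
have dc := is_derive_scale (1 + k%:R ^+ 2)^-1 (cos_coef_ode k t).
have ds := is_derive_scale (1 + k%:R ^+ 2)^-1 (sin_coef_ode k t).
have dc' : is_derive t 1 (fun t => cos_coef (u t) k%:R) ((1 + k%:R ^+ 2)^-1 * - (k%:R * sin_coef (flux u t) k%:R)).
  by apply: is_derive_eq (_ : is_derive t 1 _ _) (erefl _); move: dc; under eq_fun do rewrite mulKf //.
have ds' : is_derive t 1 (fun t => sin_coef (u t) k%:R) ((1 + k%:R ^+ 2)^-1 * (k%:R * cos_coef (flux u t) k%:R)).
  by apply: is_derive_eq (_ : is_derive t 1 _ _) (erefl _); move: ds; under eq_fun do rewrite mulKf //.
apply: is_derive_eq (is_derive_scale (1 + k%:R ^+ 2) (is_derive_add (is_derive_exp 2 dc') (is_derive_exp 2 ds'))) _.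
by rewrite /flux /= !expr1; field.
Qed.

End solution.

(* The rate vanishes on trigonometric polynomials [S], since [(S + S^2/2) S'] is an
   exact derivative; so only the flux of the Fourier tail contributes. *)
Lemma energy_rate_bound v N (E G eta : R) : on_circle v -> continuous v -> 0 < eta ->
  (forall n, energy v n <= E) ->
  (forall x, `|(v x + v x ^+ 2 / 2) - (fourier_sum v N x + fourier_sum v N x ^+ 2 / 2)| <= G) ->
  `|energy_rate v N| <= eta * E + eta^-1 * (pi * (G ^+ 2 * (pi *+ 2))).
Proof.
move=> pv cv eta0 hE hG; have p0 := pi_gt0 R.
set F := fun x => v x + v x ^+ 2 / 2; set S := fourier_sum v N.
pose FS x := S x + S x ^+ 2 / 2; pose g x := F x - FS x.
have cS : continuous S by exact: continuous_trig_sum.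
have pS : on_circle S by exact: circle_fourier_sum.
have cfl (h : R -> R) : continuous h -> continuous (fun x => h x + h x ^+ 2 / 2).
  move=> ch; apply: continuous_add => //; apply: continuous_mul; last exact: continuous_const.
  exact: continuous_sqr.
have cF := cfl _ cv; have cFS := cfl _ cS.
have cg : continuous g by exact: continuous_sub.
have pg : on_circle g by move=> x; rewrite /g /F /FS pv pS.
pose dS := dtrig_sum (fun k => cos_coef v k%:R / pi) (fun k => sin_coef v k%:R / pi) N.
have cdS : continuous dS by exact: continuous_dtrig_sum.
have DS : antideriv S dS by exact: is_derive_trig_sum.
have z : oint (fun x => FS x * dS x) (- pi) pi = 0.
  have D x : is_derive x 1 (fun y => S y ^+ 2 / 2 + S y ^+ 3 / 6) (FS x * dS x).
    apply: is_derive_eq (is_derive_add (is_derive_mul (is_derive_exp 2 (DS x)) (is_derive_const 2^-1 x))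
      (is_derive_mul (is_derive_exp 3 (DS x)) (is_derive_const 6^-1 x))) _.
    by rewrite /FS /= expr1; field.
  by rewrite (oint_FTC _ _ (continuous_mul cFS cdS) D) (circle_end pS) subrr.
have E1 h : continuous h -> \sum_(1 <= k < N.+1) 2 * k%:R *
   (sin_coef v k%:R * cos_coef h k%:R - cos_coef v k%:R * sin_coef h k%:R) = 2 * pi * oint (fun x => h x * dS x) (- pi) pi.
  move=> ch; rewrite oint_mul_dtrig_sum // mulr_sumr; apply: eq_bigr => k _.
  have pK (y : R) : pi * (y / pi) = y by rewrite mulrC divfK // gt_eqF.
  transitivity (2 * k%:R * ((pi * (sin_coef v k%:R / pi)) * cos_coef h k%:R - (pi * (cos_coef v k%:R / pi)) * sin_coef h k%:R)).
    by rewrite !pK.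
  have rr (a b c d P K : R) : 2 * K * (P * a * c - P * b * d) = 2 * P * (K * (a * c - b * d)) by ring.
  exact: rr.
have -> : energy_rate v N = \sum_(1 <= k < N.+1) 2 * k%:R *
   (sin_coef v k%:R * cos_coef g k%:R - cos_coef v k%:R * sin_coef g k%:R).
  rewrite /energy_rate !E1 //; congr (_ * _).
  rewrite (_ : (fun x => g x * dS x) = (fun x => F x * dS x - FS x * dS x)); last by apply/funext => x; rewrite /g; ring.
  by rewrite ointB ?z ?subr0 //; exact: continuous_mul.
apply: le_trans (ler_norm_sum _ _ _) _.
apply: le_trans (_ : \sum_(1 <= k < N.+1) (eta * ((1 + k%:R ^+ 2) * (cos_coef v k%:R ^+ 2 + sin_coef v k%:R ^+ 2))
   + eta^-1 * (cos_coef g k%:R ^+ 2 + sin_coef g k%:R ^+ 2)) <= _).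
  suff young (a b A B K : R) : `|2 * K * (b * A - a * B)| <=
     eta * ((1 + K ^+ 2) * (a ^+ 2 + b ^+ 2)) + eta^-1 * (A ^+ 2 + B ^+ 2).
    by apply: ler_sum => k _; exact: young.
  (* The factor k is attached to the coefficients of v, where the 1 + k^2 of the energy absorbs it;
     the coefficients of g are then summed by Bessel. *)
  have am (y z1 : R) : 2 * `|y * z1| <= eta * y ^+ 2 + eta^-1 * z1 ^+ 2.
    rewrite -(@ler_pM2l _ eta) // mulrDr (mulrA eta eta^-1) mulfV ?gt_eqF // mul1r normrM.
    have := sqr_ge0 (eta * `|y| - `|z1|); rewrite -(real_normK (num_real y)) -(real_normK (num_real z1)); nra.
  have a1 := am (K * b) A; have a2 := am (K * a) B.
  have h1 : `|2 * K * (b * A - a * B)| <= 2 * `|K * b * A| + 2 * `|K * a * B|.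
    rewrite (_ : 2 * K * _ = 2 * (K * b * A) - 2 * (K * a * B)); last by ring.
    by apply: le_trans (ler_normB _ _) _; rewrite !(normrM 2) (@ger0_norm _ 2).
  have h2 : 0 <= eta * (a ^+ 2 + b ^+ 2) by rewrite mulr_ge0 ?addr_ge0 ?sqr_ge0 // ltW.
  apply: le_trans h1 _; move: a1 a2 h2; rewrite !exprMn; lra.
rewrite big_split /= -!mulr_sumr; apply: lerD; first by rewrite ler_pM2l //; exact: hE.
rewrite ler_pM2l ?invr_gt0 //; apply: le_trans (bessel_continuous N pg cg) _.
rewrite ler_pM2l // circle_int_oint; last exact: continuous_sqr.
apply: le_trans (ler_norm _) _; rewrite (_ : pi *+ 2 = pi - - pi); last by rewrite opprK mulr2n.
apply: oint_bound => //; first exact: continuous_sqr.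
by move=> x _; rewrite normrX lerXn2r ?nnegrE //; [exact: le_trans (hG x)|exact: hG].
Qed.

(** The index N0 depends on v only through the bounds E and U, so one truncation level serves a
    whole interval of times. *)
Lemma energy_rate_small (E U e : R) : 0 <= E -> 0 <= U -> 0 < e -> exists N0 : nat, forall N, (N0 <= N)%N ->
  forall v, on_circle v -> continuous v -> (forall n, energy v n <= E) -> (forall x, `|v x| <= U) ->
  `|energy_rate v N| <= e.
Proof.
move=> E0 U0 e0; have p0 := pi_gt0 R.
(* This eta makes the energy term at most e/2. The remaining term is K tau^2 with tau the accuracy
   of the Fourier sum, and tau <= 1 gives tau^2 <= tau <= e/(2 K). *)
pose eta := e / (2 * (E + 1)); have eta0 : 0 < eta by rewrite divr_gt0 //; lra.
pose K : R := eta^-1 * (pi * (pi *+ 2)) * (2 + U) ^+ 2.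
have u2 : 0 < 2 + U by lra.
have pi2 : 0 < (pi : R) *+ 2 by rewrite mulrn_wgt0.
have K0 : 0 < K by rewrite /K; apply: mulr_gt0; [apply: mulr_gt0; [rewrite invr_gt0|apply: mulr_gt0]|exact: exprn_gt0].
pose tau := Num.min 1 (e / (2 * K)).
have tau0 : 0 < tau by rewrite lt_min ltr01 divr_gt0 // mulr_gt0.
have tau1 : tau <= 1 by rewrite ge_min lexx.
have tau2 : tau <= e / (2 * K) by rewrite ge_min lexx orbT.
have [h h0 [N0 hN]] := tail_small E0 tau0.
exists N0 => N NN v pv cv hE hU.
have hG x : `|(v x + v x ^+ 2 / 2) - (fourier_sum v N x + fourier_sum v N x ^+ 2 / 2)| <= tau * (2 + U).
  have k1 := le_trans (fourier_approx N x pv cv hE h0) (hN N NN).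
  set S := fourier_sum v N x in k1 *.
  rewrite (_ : _ - _ = (v x - S) * (1 + v x - (v x - S) / 2)); last by field.
  rewrite normrM; apply: ler_pM => //.
  have := ler_normB (1 + v x) ((v x - S) / 2); have := ler_normD 1 (v x); have := hU x.
  rewrite normr1 (normrM (v x - S)) (gtr0_norm (x := 2^-1)) ?invr_gt0 //; lra.
apply: le_trans (energy_rate_bound pv cv eta0 hE hG) _.
have -> : eta^-1 * (pi * ((tau * (2 + U)) ^+ 2 * (pi *+ 2))) = K * tau ^+ 2.
  by rewrite /K; move: (pi *+ 2) => P2; ring.
have t2 : K * tau ^+ 2 <= e / 2.
  apply: le_trans (_ : K * tau <= _).
    by rewrite ler_pM2l // expr2 ler_piMr // ltW.
  by rewrite -ler_pdivlMl // mulrC -mulrA -invfM.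
have t1 : eta * E <= e / 2.
  by rewrite /eta mulrAC ler_pdivrMr ?mulr_gt0 //; nra.
lra.
Qed.

End Energy.

(** * Bounds uniform in time from the conservation of energy *)

Section GlobalBounds.
Set Implicit Arguments.
Unset Strict Implicit.
Unset Printing Implicit Defensive.
Variable R : realType.
Implicit Types (f g v : R -> R) (t x : R).

Lemma energy_split f g n : continuous f -> continuous g ->
  energy f n <= 2 * energy g n + 2 * energy (fun x => f x - g x) n.
Proof.
move=> cf cg; rewrite /energy !mulr_sumr -big_split /=; apply: ler_sum => k _.
have -> : cos_coef (fun x => f x - g x) k%:R = cos_coef f k%:R - cos_coef g k%:R.
  rewrite /cos_coef -ointB; [|exact: continuous_mulcos..].
  by congr oint; apply/funext => x; ring.
have -> : sin_coef (fun x => f x - g x) k%:R = sin_coef f k%:R - sin_coef g k%:R.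
  rewrite /sin_coef -ointB; [|exact: continuous_mulsin..].
  by congr oint; apply/funext => x; ring.
rewrite 2!(mulrCA 2) -mulrDr; apply: ler_wpM2l; first by rewrite addr_ge0 ?sqr_ge0.
have sq (a b c d : R) : a ^+ 2 + c ^+ 2 <= 2 * (b ^+ 2 + d ^+ 2) + 2 * ((a - b) ^+ 2 + (c - d) ^+ 2).
  by have := sqr_ge0 (a - 2 * b); have := sqr_ge0 (c - 2 * d); nra.
exact: sq.
Qed.

Section solution.
Variable u : R -> R -> R.
Hypotheses (u_H1 : continuous_in_H1 u) (u_sol : distributional_solution u).

(** A bound depending on L, from the continuity in H^1 and compactness. In [energy_global] it fixes
    a truncation level, but does not enter the final bound. *)
Lemma local_energy_bound (L : R) : exists2 E : R, 0 <= E &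
  forall t, - L <= t <= L -> forall n, energy (u t) n <= E.
Proof.
have p0 := pi_gt0 R; have [hH hc] := u_H1.
have [||r r0 hr] := @segment_uniform R (fun t r => forall n, energy (u t) n <= r^-1) (- L) L.
- move=> s r r' r'0 rr h n; apply: le_trans (h n) _.
  by rewrite lef_pV2 // posrE (lt_le_trans r'0).
(* This K is the bound of [energy_split] at times t with u(t) at H^1 distance at most 1 from
   u(s). *)
- move=> s _; pose K := 2 * (pi * H1_norm (u s) ^+ 2) + 2 * pi.
  have h1 : 0 <= pi * H1_norm (u s) ^+ 2 by rewrite mulr_ge0 ?sqr_ge0 // ltW.
  have K0 : 0 < K by rewrite /K; lra.
  have /cvgrPdist_lt /(_ 1 ltr01) /nbhs_ballP[d d0 hd] := hc s.
  exists (Num.min d K^-1); first by rewrite lt_min d0 invr_gt0.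
  move=> t; rewrite lt_min => /andP[td _] n; have [_ ct _] := hH t; have [_ cs _] := hH s.
  have m0 : 0 < Num.min d K^-1 by rewrite lt_min d0 invr_gt0.
  apply: le_trans (_ : K <= _); last first.
    by rewrite -[leLHS]invrK lef_pV2 ?posrE ?invr_gt0 // ge_min lexx orbT.
  have n1 : H1_norm (fun x => u t x - u s x) <= 1.
    have := hd t; rewrite /ball /= distrC => /(_ td); rewrite sub0r normrN => k.
    by apply: ltW; apply: le_lt_trans k; exact: ler_norm.
  apply: le_trans (energy_split n ct cs) _.
  apply: lerD; rewrite ler_pM2l //; first exact: energy_le_H1_norm.
  apply: le_trans (energy_le_H1_norm n (circle_H1_sub (hH t) (hH s))) _.
  by rewrite -[leRHS]mulr1 ler_pM2l // exprn_ile1 // H1_norm_ge0.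
by exists r^-1; [rewrite invr_ge0 ltW|].
Qed.

Lemma local_sup_bound (L : R) : exists2 U : R, 0 <= U &
  forall t, - L <= t <= L -> forall x, `|u t x| <= U.
Proof.
have hu := H1_circle_family u_H1; have cu := H1_time_continuous u_H1.
have [||r r0 hr] := @segment_uniform R (fun t r => forall x, `|u t x| <= r^-1) (- L) L.
- move=> s r r' r'0 rr h x; apply: le_trans (h x) _.
  by rewrite lef_pV2 // posrE (lt_le_trans r'0).
- move=> s _; have [M M0 hM] := family_bounded s hu.
  have [d d0 hd] := cu s 1 ltr01.
  have K0 : 0 < M + 1 by lra.
  have m0 : 0 < Num.min d (M + 1)^-1 by rewrite lt_min d0 invr_gt0.
  exists (Num.min d (M + 1)^-1) => // t; rewrite lt_min => /andP[td _] x.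
  apply: le_trans (_ : M + 1 <= _); last first.
    by rewrite -[leLHS]invrK lef_pV2 ?posrE ?invr_gt0 // ge_min lexx orbT.
  have := ler_normD (u s x) (u t x - u s x); rewrite addrC subrK.
  have := hd t td x; have := hM x; lra.
by exists r^-1; [rewrite invr_ge0 ltW|].
Qed.

(** For fixed t and e, at a high enough truncation level the rate is at most e/(|t| + 1) between
    times 0 and t, so the energy grows by at most e; then let e tend to zero. Truncated energies
    increase with the level, which carries the bound down to every n. *)
Lemma energy_global : exists2 E : R, 0 <= E & forall t n, energy (u t) n <= E.
Proof.
have hu := H1_circle_family u_H1; have [hH _] := u_H1.
exists (pi * H1_norm (u 0) ^+ 2); first by rewrite mulr_ge0 ?sqr_ge0 // pi_ge0.
move=> t n; apply/ler_addgt0Pr => e e0.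
have [E E0 hE] := local_energy_bound `|t|; have [U U0 hU] := local_sup_bound `|t|.
have t1 : 0 < `|t| + 1 by rewrite ltr_wpDl.
have [N0 hN] := energy_rate_small E0 U0 (e := e / (`|t| + 1)) ltac:(by rewrite divr_gt0).
pose N := maxn n N0.
apply: le_trans (energy_mono (u t) (leq_maxl n N0)) _.
rewrite -lerBlDl; apply: le_trans (_ : energy (u t) N - energy (u 0) N <= _).
  by rewrite lerD2l lerN2; exact: energy_le_H1_norm.
apply: le_trans (ler_norm _) _.
apply: le_trans (@mean_value_bound _ (fun t => energy (u t) N) (fun t => energy_rate (u t) N) 0 t (e / (`|t| + 1)) _) _.
  move=> s hs; split; first exact: is_derive_energy.
  have hs' : - `|t| <= s <= `|t|.
    move: hs; rewrite -ler_norml; case: (leP 0 t) => t0.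
      by move=> /andP[s0 st]; rewrite (ger0_norm t0) ger0_norm.
    by move=> /andP[s0 st]; rewrite (ltr0_norm t0) ler0_norm // lerN2.
  by apply: hN; [exact: leq_maxr|exact: (hu s).1|exact: (hu s).2|exact: hE|exact: hU].
rewrite subr0 mulrAC ler_pdivrMr // ler_pM2l //; lra.
Qed.

(** The mean is constant in time by the equation at frequency 0, and the energy bounds the rest
    through [fourier_approx] with N = 0. *)
Lemma sup_global : exists2 U : R, 0 <= U & forall t x, `|u t x| <= U.
Proof.
have hu := H1_circle_family u_H1; have [E E0 hE] := energy_global; have p0 := pi_gt0 R.
have a0 t : cos_coef (u t) 0 = cos_coef (u 0) 0.
  have D : antideriv (fun t => cos_coef (u t) 0) (fun=> 0).
    move=> s; have := cos_coef_ode u_H1 u_sol 0 s.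
    by under eq_fun do rewrite expr0n addr0 mul1r; rewrite mul0r oppr0.
  exact: derive0_const D t 0.
pose T : R := (1 * E / 2 + 2 / (1 * 1%:R)) / pi.
have T0 : 0 <= T by apply: divr_ge0; [rewrite !mul1r; lra|exact: ltW].
exists (`|cos_coef (u 0) 0 / (pi *+ 2)| + T); first by rewrite addr_ge0.
move=> t x; have := @fourier_approx R (u t) E 1 0 x (hu t).1 (hu t).2 (hE t) ltr01.
rewrite /fourier_sum /trig_sum big_geq // addr0 a0 -/T => k.
have := ler_normD (cos_coef (u 0) 0 / (pi *+ 2)) (u t x - cos_coef (u 0) 0 / (pi *+ 2)).
by rewrite addrC subrK; lra.
Qed.

(** One N makes the Fourier sums accurate to e/3 at all times, and these sums are Lipschitz in x
    with a constant independent of time. *)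
Lemma equicontinuous_global (e : R) : 0 < e -> exists2 r : R, 0 < r &
  forall t x y, `|x - y| < r -> `|u t x - u t y| <= e.
Proof.
move=> e0; have hu := H1_circle_family u_H1; have [E E0 hE] := energy_global.
have [U U0 hU] := sup_global; have p0 := pi_gt0 R.
have [h h0 [N hN]] := tail_small E0 (e := e / 3) ltac:(lra).
(* Each normalised coefficient is at most 2 U, since the period is 2 pi; every frequency has two of
   them. *)
pose K : R := \sum_(1 <= k < N.+1) k%:R * (4 * U).
have K0 : 0 <= K by apply: sumr_ge0 => k _; rewrite mulr_ge0 // mulr_ge0.
exists (e / 3 / (K + 1)); first by rewrite !divr_gt0 //; lra.
move=> t x y xy; have [p c] := hu t.
pose S := fourier_sum (u t) N.
have k1 := le_trans (fourier_approx N x p c (hE t) h0) (hN N (leqnn _)).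
have k2 := le_trans (fourier_approx N y p c (hE t) h0) (hN N (leqnn _)).
have coefb (ph : R -> R) : continuous ph -> (forall z, `|ph z| <= 1) ->
   `|oint (fun z => u t z * ph z) (- pi) pi / pi| <= 2 * U.
  move=> cp hp; rewrite normrM (gtr0_norm (x := pi^-1)) ?invr_gt0 // ler_pdivrMr //.
  rewrite (_ : 2 * U * pi = U * (pi - - pi)); last by rewrite opprK; ring.
  apply: oint_bound; [exact: continuous_mul|lra|move=> z _].
  by rewrite normrM -[leRHS]mulr1; apply: ler_pM.
have k3 : `|S x - S y| <= K * `|x - y|.
  apply: (@mean_value_bound _ S) => z _; split; first exact: is_derive_trig_sum.
  apply: le_trans (ler_norm_sum _ _ _) _; apply: ler_sum => k _.
  rewrite normrM (ger0_norm (x := k%:R)) // ler_wpM2l //.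
  have a1 : `|sin_coef (u t) k%:R / pi * cos (k%:R * z)| <= 2 * U.
    rewrite normrM -[leRHS]mulr1; apply: ler_pM => //; last exact: cos_max.
    by apply: coefb; [exact: continuous_sinM|move=> s; exact: sin_max].
  have a2 : `|cos_coef (u t) k%:R / pi * sin (k%:R * z)| <= 2 * U.
    rewrite normrM -[leRHS]mulr1; apply: ler_pM => //; last exact: sin_max.
    by apply: coefb; [exact: continuous_cosM|move=> s; exact: cos_max].
  by apply: le_trans (ler_normB _ _) _; apply: le_trans (lerD a1 a2) _; lra.
have k4 : K * `|x - y| <= e / 3.
  have : (K + 1) * `|x - y| <= e / 3 by rewrite mulrC -ler_pdivlMr ?ltW //; lra.
  have := normr_ge0 (x - y); lra.
rewrite (_ : u t x - u t y = (u t x - S x) + (S x - S y) - (u t y - S y)); last by ring.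
apply: le_trans (ler_normB _ _) _.
have := ler_normD (u t x - S x) (S x - S y); rewrite /S in k3 *; lra.
Qed.

End solution.
End GlobalBounds.

(** * Analyticity in time and continuation of zeros *)

Section Analyticity.
Set Implicit Arguments.
Unset Strict Implicit.
Unset Printing Implicit Defensive.
Variable R : realType.

Section chain.
Variables (l : nat -> R -> R) (M K : R).
Hypothesis M0 : 0 <= M.
Hypothesis K0 : 0 < K.
Hypothesis dl : forall n, antideriv (l n) (fun t => n.+1%:R * l n.+1 t).
Hypothesis bl : forall n t, `|l n t| <= M * K ^+ n.

(** As [l n] is the n-th derivative of [l 0] divided by n!, this is vanishing to infinite order. *)
Let flat_at t := forall n, l n t = 0.

Lemma is_derive_locally0 (F : R -> R) (t d r : R) : 0 < r -> (forall s, `|s - t| < r -> F s = 0) ->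
  is_derive t 1 F d -> d = 0.
Proof.
move=> r0 hF dF; apply/eqP/negPn/negP => d0.
have nd : 0 < `|d| by rewrite normr_gt0.
have [p p0 hp] := is_derive_eps dF (e := `|d| / 2) ltac:(lra).
pose h := Num.min (r / 2) (p / 2).
have h0 : 0 < h by rewrite lt_min !divr_gt0.
have hr : h <= r / 2 by rewrite ge_min lexx.
have hp' : h <= p / 2 by rewrite ge_min lexx orbT.
have := hp h; rewrite (gtr0_norm h0) => /(_ ltac:(lra)).
rewrite !hF; [|by rewrite subrr normr0|by rewrite addrC addKr gtr0_norm //; lra].
rewrite subrr sub0r normrN normrM (gtr0_norm h0).
have : 0 < h * `|d| by rewrite mulr_gt0.
lra.
Qed.

Lemma chain_flat t r : 0 < r -> (forall s, `|s - t| < r -> l 0 s = 0) ->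
  forall s, `|s - t| < r -> flat_at s.
Proof.
move=> r0 h s hs n; elim: n s hs => [|n ih] s hs; first exact: h.
have e0 : 0 < r - `|s - t| by rewrite subr_gt0.
have := @is_derive_locally0 (l n) s _ _ e0 _ (dl n s) => H.
have /eqP : n.+1%:R * l n.+1 s = 0.
  apply: H => s' hs'; apply: ih.
  have := ler_normD (s' - s) (s - t); rewrite addrA subrK; lra.
by rewrite mulf_eq0 pnatr_eq0 /= => /eqP.
Qed.

Let taylor (s : R) m (t : R) := \sum_(0 <= n < m) l n t * (s - t) ^+ n.

(* Differentiating the Taylor polynomial in its base point telescopes. *)
Lemma is_derive_taylor s m : antideriv (taylor s m) (fun t => m%:R * l m t * (s - t) ^+ m.-1).
Proof.
move=> t; elim: m => [|m ih].
  rewrite !mul0r (_ : taylor s 0 = fun=> 0); first exact: is_derive_const.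
  by apply/funext => r; rewrite /taylor big_geq.
rewrite (_ : taylor s m.+1 = fun t => taylor s m t + l m t * (s - t) ^+ m); last first.
  by apply/funext => r; rewrite /taylor big_nat_recr.
have dx := is_derive_exp m (is_derive_sub (is_derive_const s t) (is_derive_id t (1 : R))).
apply: is_derive_eq (is_derive_add ih (is_derive_mul (dl m t) dx)) _; rewrite /=; ring.
Qed.

(** The Taylor polynomial in s is [l 0 s] at base point s and zero at base point t, so the mean
    value bound for it gives |l 0 s| <= (n + 1) M 4^(-(n + 1)). The radius 1/(4 K) is chosen so that
    (n + 1)^2 <= 4^(n + 1) finishes: |l 0 s| (n + 1) <= M for all n. *)
Lemma chain_step t s : flat_at t -> `|s - t| <= (4 * K)^-1 -> l 0 s = 0.
Proof.
move=> ft st; apply/eqP; rewrite -normr_eq0; apply/negPn/negP => n0.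
have L0 : 0 < `|l 0 s| by rewrite lt_def n0 normr_ge0.
have K4 : 0 < 4 * K by rewrite mulr_gt0.
have key n : `|l 0 s| * n.+1%:R <= M.
  have E : l 0 s = taylor s n.+1 s - taylor s n.+1 t.
    rewrite /taylor [X in _ - X]big1 ?subr0; last by move=> i _; rewrite ft mul0r.
    rewrite big_nat_recl // expr0 mulr1 big1 ?addr0 // => i _.
    by rewrite subrr expr0n /= mulr0.
  have n1 : 0 < n.+1%:R :> R by rewrite ltr0n.
  have B : `|l 0 s| <= (n.+1%:R * (M * K ^+ n.+1) * ((4 * K)^-1) ^+ n) * `|s - t|.
    rewrite E; apply: (@mean_value_bound _ _ (fun t => n.+1%:R * l n.+1 t * (s - t) ^+ n.+1.-1)) => r hr.
    split; first exact: is_derive_taylor.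
    rewrite /= !normrM (ger0_norm (ltW n1)); apply: ler_pM => //.
      by rewrite ler_pM2l //; exact: bl.
    rewrite normrX lerXn2r ?nnegrE ?invr_ge0 ?(ltW K4) //.
    apply: le_trans st; move: hr; case: (leP t s) => ts /andP[r1 r2].
      by rewrite !ger0_norm; lra.
    by rewrite !ler0_norm; lra.
  have B2 : `|l 0 s| <= n.+1%:R * M * 4^-1 ^+ n.+1.
    apply: le_trans B _; apply: le_trans (_ : n.+1%:R * (M * K ^+ n.+1) * (4 * K)^-1 ^+ n * (4 * K)^-1 <= _).
      by rewrite ler_wpM2l // !mulr_ge0 ?exprn_ge0 ?invr_ge0 // ltW.
    rewrite -mulrA -exprSr invfM exprMn (mulrC (4^-1 ^+ _)).
    rewrite -!mulrA (mulrA (K ^+ _)) -exprMn mulfV ?gt_eqF // expr1n mul1r.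
    by [].
  have two : n.+1%:R <= 2 ^+ n.+1 :> R.
    by rewrite -natrX ler_nat ltnW // ltn_expl.
  apply: le_trans (ler_wpM2r (ltW n1) B2) _.
  rewrite (_ : n.+1%:R * M * 4^-1 ^+ n.+1 * n.+1%:R = M * (n.+1%:R * n.+1%:R * 4^-1 ^+ n.+1)); last by ring.
  rewrite -[leRHS]mulr1 ler_wpM2l // exprVn ler_pdivrMr ?exprn_gt0 // mul1r.
  rewrite (_ : 4 ^+ n.+1 = 2 ^+ n.+1 * 2 ^+ n.+1 :> R); last by rewrite -exprMn -natrM.
  by apply: ler_pM.
have := key (Num.truncn (M / `|l 0 s|)); apply/negP; rewrite -ltNge mulrC -ltr_pdivrMr //.
exact: truncnS_gt.
Qed.

(** The radius of [chain_step] is the same at all times, so any t is reached from the midpoint of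
    (a, b) in finitely many equal steps shorter than it. *)
Lemma chain_zero (a b : R) : a < b -> (forall t, a < t < b -> l 0 t = 0) -> forall t, l 0 t = 0.
Proof.
move=> ab h t; pose r : R := (4 * K)^-1; have r0 : 0 < r by rewrite invr_gt0 mulr_gt0.
pose c := (a + b) / 2.
have fc : flat_at c.
  apply: (@chain_flat c ((b - a) / 2)); rewrite ?subrr ?normr0; [lra| |lra].
  move=> s; rewrite ltr_norml /c => /andP[s1 s2]; apply: h; apply/andP; split; lra.
have step s s' : flat_at s -> `|s' - s| < r -> flat_at s'.
  move=> fs; apply: (@chain_flat s r) => // s'' hs; apply: chain_step fs _; exact: ltW.
pose n := (Num.truncn (`|t - c| / r)).+1.
have n0 : 0 < n%:R :> R by rewrite ltr0n.
pose h1 := (t - c) / n%:R.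
have hh : `|h1| < r.
  rewrite /h1 normrM (gtr0_norm (x := n%:R^-1)) ?invr_gt0 // ltr_pdivrMr // mulrC -ltr_pdivrMr //.
  exact: truncnS_gt.
have walk k : flat_at (c + k%:R * h1).
  elim: k => [|k ih]; first by rewrite mul0r addr0.
  apply: step ih _; rewrite -natr1 (_ : _ - _ = h1) //; ring.
have := walk n 0%N; rewrite /h1 (mulrC n%:R) divfK ?gt_eqF //.
by rewrite addrC subrK.
Qed.

End chain.

Lemma circle_family_sum (I : Type) (s : seq I) (P : pred I) (y : I -> R -> R -> R) :
  (forall i, P i -> circle_family (y i)) -> circle_family (fun t x => \sum_(i <- s | P i) y i t x).
Proof.
move=> h t; elim: s => [|i s [p c]].
  by split; [move=> x; rewrite !big_nil|under eq_fun do rewrite big_nil; exact: continuous_const].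
case Pi : (P i); last by split; [move=> x; rewrite !big_cons Pi p|under eq_fun do rewrite big_cons Pi].
have [pi_ ci] := h i Pi t.
split; first by move=> x; rewrite !big_cons Pi p pi_.
by under eq_fun do rewrite big_cons Pi; exact: (continuous_add ci c).
Qed.

Lemma time_derivative_const (c : R) : time_derivative (fun _ _ => c) (fun _ _ => 0).
Proof.
move=> t e e0; exists 1 => // h _ x.
by rewrite subrr mulr0 subrr normr0 mulr_ge0 // ltW.
Qed.

Lemma time_derivative_add (y y' z z' : R -> R -> R) : time_derivative y y' -> time_derivative z z' ->
  time_derivative (fun t x => y t x + z t x) (fun t x => y' t x + z' t x).
Proof.
move=> d1 d2; have := time_derivative_lin 1 1 d1 d2.
rewrite (_ : (fun t x => 1 * y t x + 1 * z t x) = (fun t x => y t x + z t x)); last first.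
  by apply/funext => t; apply/funext => x; rewrite !mul1r.
rewrite (_ : (fun t x => 1 * y' t x + 1 * z' t x) = (fun t x => y' t x + z' t x)) //.
by apply/funext => t; apply/funext => x; rewrite !mul1r.
Qed.

Lemma time_derivative_scale (c : R) (y y' : R -> R -> R) : time_derivative y y' ->
  time_derivative (fun t x => c * y t x) (fun t x => c * y' t x).
Proof.
move=> d1; have := time_derivative_lin c 0 d1 d1.
rewrite (_ : (fun t x => c * y t x + 0 * y t x) = (fun t x => c * y t x)); last first.
  by apply/funext => t; apply/funext => x; rewrite mul0r addr0.
rewrite (_ : (fun t x => c * y' t x + 0 * y' t x) = (fun t x => c * y' t x)) //.
by apply/funext => t; apply/funext => x; rewrite mul0r addr0.
Qed.

Lemma time_derivative_sum n (y y' : nat -> R -> R -> R) :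
  (forall i, (i < n)%N -> time_derivative (y i) (y' i)) ->
  time_derivative (fun t x => \sum_(i < n) y i t x) (fun t x => \sum_(i < n) y' i t x).
Proof.
elim: n => [|n ih] h.
  rewrite (_ : (fun t x => _) = fun _ _ => 0); last by apply/funext => t; apply/funext => x; rewrite big_ord0.
  rewrite (_ : (fun t x => \sum_(i < 0) y' i t x) = fun _ _ => 0); last by apply/funext => t; apply/funext => x; rewrite big_ord0.
  exact: time_derivative_const.
have d1 := ih (fun i hi => h i (ltnW hi)); have d2 := h n (ltnSn n).
have := time_derivative_add d1 d2.
rewrite (_ : (fun t x => \sum_(i < n) y i t x + y n t x) = (fun t x => \sum_(i < n.+1) y i t x)); last first.
  by apply/funext => t; apply/funext => x; rewrite big_ord_recr.
rewrite (_ : (fun t x => \sum_(i < n) y' i t x + y' n t x) = (fun t x => \sum_(i < n.+1) y' i t x)) //.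
by apply/funext => t; apply/funext => x; rewrite big_ord_recr.
Qed.

Section taylor_coefficients.
Variables (w : R -> R -> R) (c M : R).
Hypothesis hw : circle_family w.
Hypothesis dw : time_derivative w (fun t x => - dhelmholtz (fun x => c * w t x + w t x ^+ 2 / 2) x).
Hypothesis M0 : 0 <= M.
Hypothesis bw : forall t x, `|w t x| <= M.

(* With [w = \sum_n a_n (s - t)^n] in time, these are the coefficients of
   [c w + w^2/2], by the Cauchy product. *)
Definition quad_conv (a : nat -> R -> R -> R) (n : nat) (t x : R) : R :=
  c * a n t x + 2^-1 * \sum_(k < n.+1) a k t x * a (n - k)%N t x.

(** Each coefficient involves all earlier ones, hence the recursion carries their list; [w] is the
    default value of [nth]. *)
Fixpoint taylor_list (n : nat) : seq (R -> R -> R) :=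
  if n is m.+1 then
    rcons (taylor_list m) (fun t x => - (m.+1%:R^-1) *
      dhelmholtz (quad_conv (fun k => nth w (taylor_list m) k) m t) x)
  else [:: w].

Definition taylor_coef n := nth w (taylor_list n) n.

Lemma size_taylor_list n : size (taylor_list n) = n.+1.
Proof. by elim: n => //= n ih; rewrite size_rcons ih. Qed.

Lemma nth_taylor_list n k : (k <= n)%N -> nth w (taylor_list n) k = taylor_coef k.
Proof.
elim: n => [|n ih]; first by rewrite leqn0 => /eqP ->.
rewrite leq_eqVlt => /orP[/eqP ->//|kn]; rewrite /= nth_rcons size_taylor_list kn.
exact: ih.
Qed.

Definition taylor_recurrence (a : nat -> R -> R -> R) := a 0%N = w /\ forall n, a n.+1 =
  (fun t x => - (n.+1%:R^-1) * dhelmholtz (quad_conv a n t) x).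

Lemma taylor_recurrence_exists : exists a, taylor_recurrence a.
Proof.
exists taylor_coef; split => // n; rewrite /taylor_coef /= nth_rcons size_taylor_list ltnn eqxx.
apply/funext => t; apply/funext => x; congr (_ * dhelmholtz _ x).
apply/funext => y; rewrite /quad_conv nth_taylor_list //; congr (_ + _ * _).
apply: eq_bigr => k _; rewrite !nth_taylor_list ?leq_subr //.
by rewrite -ltnS.
Qed.

Lemma circle_family_scale (d : R) y : circle_family y -> circle_family (fun t x => d * y t x).
Proof.
by move=> hy t; have [p cy] := hy t; split; [move=> x; rewrite p|exact: continuous_scale].
Qed.

Lemma circle_family_quad_conv a n : (forall k, (k <= n)%N -> circle_family (a k)) ->
  circle_family (quad_conv a n).
Proof.
move=> h; apply: circle_family_lin; first exact: h.
apply: circle_family_sum => k _; apply: circle_family_mul; apply: h; last exact: leq_subr.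
by rewrite -ltnS.
Qed.

Section recurrence.
Variable a : nat -> R -> R -> R.
Hypothesis a_rec : taylor_recurrence a.

Let a0 : a 0%N = w := a_rec.1.
Let aS := a_rec.2.

Lemma circle_family_taylor_coef n : circle_family (a n).
Proof.
elim/ltn_ind: n => -[|n] ih; first by rewrite a0; exact: hw.
rewrite aS; apply: circle_family_scale; apply: circle_family_dhelmholtz.
by apply: circle_family_quad_conv => k kn; exact: ih.
Qed.

Let ha := circle_family_taylor_coef.

(** Leibniz rule for the Cauchy product: differentiating the factors brings weights k and n + 1 - k,
    which add up to n + 1. *)
Lemma quad_conv_derivative n :
  (forall k, (k <= n)%N -> time_derivative (a k) (fun t x => k.+1%:R * a k.+1 t x)) ->
  time_derivative (quad_conv a n) (fun t x => n.+1%:R * quad_conv a n.+1 t x).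
Proof.
move=> h.
have hs k : circle_family (fun t x => k.+1%:R * a k.+1 t x) := circle_family_scale _ (ha k.+1).
have d2 := @time_derivative_sum n.+1 (fun k t x => a k t x * a (n - k)%N t x)
  (fun k t x => k.+1%:R * a k.+1 t x * a (n - k)%N t x + a k t x * ((n - k).+1%:R * a (n - k).+1 t x)).
have d3 := time_derivative_lin c 2^-1 (h n (leqnn n)) (d2 _).
rewrite (_ : (fun t x => n.+1%:R * quad_conv a n.+1 t x) = (fun t x =>
   c * (n.+1%:R * a n.+1 t x) + 2^-1 * \sum_(k < n.+1) (k.+1%:R * a k.+1 t x * a (n - k)%N t x + a k t x * ((n - k).+1%:R * a (n - k).+1 t x)))).
  apply: d3 => k kn; apply: time_derivative_mul => //.
  - exact: (h k kn).
  - by apply: h; exact: leq_subr.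
apply/funext => t; apply/funext => x; rewrite /quad_conv big_split /=.
(* Each of the two sums is extended to n + 2 terms by a term of weight zero, so that they can be
   added termwise. *)
have s1 : \sum_(k < n.+1) k.+1%:R * a k.+1 t x * a (n - k)%N t x =
   \sum_(k < n.+2) k%:R * (a k t x * a (n.+1 - k)%N t x).
  rewrite [RHS]big_ord_recl mul0r add0r; apply: eq_bigr => k _.
  by rewrite /= /fintype.bump /= add1n subSS mulrA.
have s2 : \sum_(k < n.+1) a k t x * ((n - k).+1%:R * a (n - k).+1 t x) =
   \sum_(k < n.+2) (n.+1 - k)%:R * (a k t x * a (n.+1 - k)%N t x).
  rewrite [RHS]big_ord_recr /= subnn mul0r addr0; apply: eq_bigr => k _.
  have E : (n.+1 - k = (n - k).+1)%N by rewrite subSn // -ltnS.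
  by rewrite E; exact: mulrCA.
rewrite s1 s2 -big_split /= mulrDr mulrCA; congr (_ + _).
rewrite mulrCA; congr (_ * _); rewrite mulr_sumr; apply: eq_bigr => k _.
by rewrite -mulrDl -natrD subnKC // -ltnS.
Qed.

(** For n = 0 this is the equation. Then the recurrence is differentiated in time: the n + 1
    produced by [quad_conv_derivative] cancels the denominator, and the recurrence at the next index
    is recognised. *)
Lemma taylor_coef_derivative n : time_derivative (a n) (fun t x => n.+1%:R * a n.+1 t x).
Proof.
elim/ltn_ind: n => -[|n] ih.
  rewrite (_ : (fun t x => _) = (fun t x => - dhelmholtz (fun x => c * w t x + w t x ^+ 2 / 2) x)); first by rewrite a0; exact: dw.
  apply/funext => t; apply/funext => x; rewrite aS invr1 !mul1r mulN1r.
  congr (- dhelmholtz _ x); apply/funext => y; rewrite /quad_conv big_ord_recl big_ord0 addr0 subn0 a0.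
  by rewrite expr2 mulrC [in RHS]mulrC; congr (_ + _); rewrite mulrC.
have dq := quad_conv_derivative (fun k kn => ih k kn).
have hq k := circle_family_quad_conv (a := a) (n := k) (fun k _ => ha k).
have dd := time_derivative_scale (- (n.+1%:R^-1)) (time_derivative_dhelmholtz (hq n) (circle_family_scale n.+1%:R (hq n.+1)) dq).
rewrite aS (_ : (fun t x => n.+2%:R * a n.+2 t x) =
  (fun t x => - n.+1%:R^-1 * dhelmholtz (fun x => n.+1%:R * quad_conv a n.+1 t x) x)) //.
apply/funext => t; apply/funext => x; rewrite aS.
have [p cq] := hq n.+1 t.
have -> : (fun x => n.+1%:R * quad_conv a n.+1 t x) = (fun x => n.+1%:R * quad_conv a n.+1 t x + 0 * quad_conv a n.+1 t x).
  by apply/funext => y; rewrite mul0r addr0.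
rewrite dhelmholtz_lin // mul0r addr0 mulrA mulrN mulfV ?pnatr_eq0 //.
by rewrite [RHS]mulNr mulKf ?pnatr_eq0 // mulN1r.
Qed.

(** Chosen so that multiplying by K covers both the linear factor |c| and the M of the quadratic
    term. The factor n + 1 in [quad_conv_bound] cancels against the denominator of the recurrence,
    and [dhelmholtz] has norm at most 1, so the bounds stay geometric. *)
Let K := `|c| + M + 1.
Let K0 : 0 < K. Proof. by rewrite /K ltr_wpDl // addr_ge0. Qed.

Lemma quad_conv_bound n : (forall k, (k <= n)%N -> forall t x, `|a k t x| <= M * K ^+ k) ->
  forall t x, `|quad_conv a n t x| <= n.+1%:R * (M * K ^+ n.+1).
Proof.
move=> h t x; rewrite /quad_conv.
have s : `|\sum_(k < n.+1) a k t x * a (n - k)%N t x| <= n.+1%:R * (M * M * K ^+ n).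
  apply: le_trans (ler_norm_sum _ _ _) _.
  rewrite (_ : n.+1%:R * _ = \sum_(k < n.+1) M * M * K ^+ n); last first.
    by rewrite sumr_const card_ord mulr_natl.
  apply: ler_sum => k _; have kn : (k <= n)%N by rewrite -ltnS.
  rewrite (_ : M * M * K ^+ n = (M * K ^+ k) * (M * K ^+ (n - k))); last first.
    by rewrite mulrACA -exprD subnKC.
  by rewrite normrM; apply: ler_pM => //; apply: h => //; exact: leq_subr.
have h1 := h n (leqnn n) t x.
have q0 : 0 <= M * K ^+ n by rewrite mulr_ge0 // exprn_ge0 // ltW.
have h2 : `|c * a n t x| <= n.+1%:R * (`|c| * (M * K ^+ n)).
  rewrite normrM; apply: le_trans (ler_wpM2l (normr_ge0 c) h1) _.
  by apply: ler_peMl; [rewrite mulr_ge0|rewrite ler1n].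
apply: le_trans (ler_normD _ _) _; rewrite (normrM 2^-1) (gtr0_norm (x := 2^-1)) ?invr_gt0 //.
rewrite (_ : n.+1%:R * (M * K ^+ n.+1) = n.+1%:R * (`|c| * (M * K ^+ n)) + n.+1%:R * (M * M * K ^+ n) + n.+1%:R * (M * K ^+ n)); last first.
  by rewrite exprS {1}/K; ring.
have : 0 <= n.+1%:R * (M * K ^+ n) by rewrite mulr_ge0.
have : 0 <= n.+1%:R * (M * M * K ^+ n) by rewrite mulr_ge0 // -mulrA mulr_ge0.
lra.
Qed.

Lemma taylor_coef_bound n t x : `|a n t x| <= M * K ^+ n.
Proof.
elim/ltn_ind: n t x => -[|n] ih t x; first by rewrite expr0 mulr1 a0; exact: bw.
have [p cq] := circle_family_quad_conv (a := a) (n := n) (fun k _ => ha k) t.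
have b := quad_conv_bound (fun k kn => ih k kn) t.
rewrite aS normrM normrN (gtr0_norm (x := n.+1%:R^-1)) ?invr_gt0 //.
by rewrite mulrC ler_pdivrMr // (mulrC _ n.+1%:R); exact: dhelmholtz_bound.
Qed.

End recurrence.

Let K := `|c| + M + 1.
Let K0 : 0 < K. Proof. by rewrite /K ltr_wpDl // addr_ge0. Qed.

Lemma solution_zero_everywhere x0 (b1 b2 : R) : b1 < b2 -> (forall t, b1 < t < b2 -> w t x0 = 0) ->
  forall t, w t x0 = 0.
Proof.
move=> b12 h; have [a ra] := taylor_recurrence_exists; have a0 := ra.1.
move=> t; rewrite -a0; move: t; rewrite -a0 in h; apply: (@chain_zero (fun n t => a n t x0) M K M0 K0 _ _ b1 b2 b12 h).
- by move=> n t; exact: (time_derivative_at t x0 (@taylor_coef_derivative a ra n)).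
- by move=> n t; exact: taylor_coef_bound.
Qed.

Lemma helmholtz_zero_everywhere x0 (b1 b2 : R) : b1 < b2 ->
  let phi t := helmholtz (fun x => c * w t x + w t x ^+ 2 / 2) in
  (forall t, b1 < t < b2 -> phi t x0 = 0) -> forall t, phi t x0 = 0.
Proof.
move=> b12 phi h; have [a ra] := taylor_recurrence_exists; have a0 := ra.1.
have ha := circle_family_taylor_coef ra.
have hq k := circle_family_quad_conv (a := a) (n := k) (fun k _ => ha k).
pose l n t := helmholtz (quad_conv a n t) x0.
have l0 t : l 0%N t = phi t x0.
  rewrite /l /phi; congr helmholtz; apply/funext => y.
  by rewrite /quad_conv big_ord_recl big_ord0 addr0 subn0 a0 expr2 (mulrC 2^-1).
have MK : 0 <= M * K by rewrite mulr_ge0 // ltW.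
(* The coefficients of phi are bounded by (n + 1) M K^(n + 1); since n + 1 <= 2^n, doubling the
   ratio absorbs the linear factor. *)
have H := @chain_zero l (M * K) (2 * K) MK ltac:(by rewrite mulr_gt0) _ _ b1 b2 b12 _.
move=> t; rewrite -l0; apply: H => [n s|n s|s hs]; last by rewrite l0; exact: h.
  have d := time_derivative_at s x0 (time_derivative_helmholtz (hq n) (circle_family_scale n.+1%:R (hq n.+1))
     (@quad_conv_derivative a ra n (fun k _ => @taylor_coef_derivative a ra k))).
  apply: is_derive_eq d _.
  have [p cq] := hq n.+1 s.
  have -> : (fun x => n.+1%:R * quad_conv a n.+1 s x) = (fun x => n.+1%:R * quad_conv a n.+1 s x + 0 * quad_conv a n.+1 s x).
    by apply/funext => y; rewrite mul0r addr0.
  by rewrite helmholtz_lin // mul0r addr0.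
have [p cq] := hq n s.
have b := quad_conv_bound (a := a) (n := n) (fun k (_ : (k <= n)%N) => @taylor_coef_bound a ra k) s.
apply: le_trans (helmholtz_bound p cq b x0) _.
rewrite exprMn exprS (_ : n.+1%:R * (M * (K * K ^+ n)) = n.+1%:R * (M * K * K ^+ n)); last by ring.
rewrite (_ : M * K * (2 ^+ n * K ^+ n) = 2 ^+ n * (M * K * K ^+ n)); last by ring.
apply: ler_wpM2r; first by rewrite mulr_ge0 // exprn_ge0 // ltW.
by rewrite -natrX ler_nat ltn_expl.
Qed.

End taylor_coefficients.
End Analyticity.

(** * The functional D, its dissipation Q, and the vanishing of w *)

Section Lyapunov.
Set Implicit Arguments.
Unset Strict Implicit.
Unset Printing Implicit Defensive.
Variable R : realType.

(** A version for weights that are not periodic, such as e^(2x): boundedness on the segment of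
    integration suffices. *)
Lemma time_derivative_oint_weight (g : R -> R) (y z : R -> R -> R) (a b t : R) : a <= b -> continuous g ->
  (forall t, continuous (y t)) -> (forall t, continuous (z t)) -> time_derivative y z ->
  is_derive t 1 (fun t => oint (fun x => g x * y t x) a b) (oint (fun x => g x * z t x) a b).
Proof.
move=> ab cg cy cz d; apply: is_derive_epsP => e e0.
have [G G0 hG] := continuous_bounded a b cg.
have K0 : 0 < (G + 1) * (b - a + 1) by rewrite mulr_gt0 //; lra.
have [r r0 hr] := d t (e / ((G + 1) * (b - a + 1))) ltac:(by rewrite divr_gt0).
exists r => // h hh.
have cgy s := continuous_mul cg (cy s); have cgz s := continuous_mul cg (cz s).
rewrite -ointB // -ointZ // -ointB; [|exact: continuous_sub|exact: continuous_scale].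
apply: le_trans (@oint_bound _ _ _ _ (G * (e / ((G + 1) * (b - a + 1)) * `|h|)) _ _ _) _ => //.
- by apply: continuous_sub; [exact: continuous_sub|exact: continuous_scale].
- move=> x hx; rewrite (_ : _ - _ - _ = g x * (y (t + h) x - y t x - h * z t x)); last by ring.
  by rewrite normrM; apply: ler_pM => //; [exact: hG|exact: hr].
rewrite (_ : G * _ * (b - a) = e / ((G + 1) * (b - a + 1)) * (G * (b - a)) * `|h|); last by ring.
rewrite ler_wpM2r // mulrAC ler_pdivrMr // ler_pM2l //.
by apply: ler_pM => //; lra.
Qed.

Section estimates.
Variables (c M x0 : R) (w : R -> R -> R).
Hypothesis M0 : 0 < M.
Hypothesis hw : circle_family w.
Hypothesis bw : forall t x, `|w t x| <= M.
Hypothesis ew : forall e, 0 < e -> exists2 r : R, 0 < r & forall t x y, `|x - y| < r -> `|w t x - w t y| <= e.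
Hypothesis w0 : forall t, w t x0 = 0.

(** The F of the overview, with c = 1 + C. *)
Definition reaction t x := c * w t x + w t x ^+ 2 / 2.

Hypothesis dw : time_derivative w (fun t x => - dhelmholtz (reaction t) x).
Hypothesis phi0 : forall t, helmholtz (reaction t) x0 = 0.

(** This is phi + phi_x, the quantity whose weighted square is dissipated. *)
Let al t := growing_sol (reaction t).
Let B := `|c| * M + M ^+ 2 / 2.

Lemma circle_family_reaction : circle_family reaction.
Proof.
move=> t; have [p cw] := hw t; split; first by move=> x; rewrite /reaction p.
apply: continuous_add; first exact: continuous_scale.
by apply: continuous_mul; [exact: continuous_sqr|exact: continuous_const].
Qed.
Let hF := circle_family_reaction.

Lemma reaction_bound t x : `|reaction t x| <= B.
Proof.
apply: le_trans (ler_normD _ _) _; apply: lerD; rewrite normrM.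
  by rewrite ler_wpM2l.
rewrite (gtr0_norm (x := 2^-1)) ?invr_gt0 // ler_pM2r ?invr_gt0 // normrX lerXn2r ?nnegrE //.
exact: ltW.
Qed.

Lemma B_gt0 : 0 < B.
Proof. by have := M0; rewrite /B => h; rewrite ltr_wpDl ?divr_gt0 ?exprn_gt0 // mulr_ge0 // ltW. Qed.

(** The function w is zero at x0 at all times, hence so is its time derivative - phi_x. *)
Lemma dphi0 t : dhelmholtz (reaction t) x0 = 0.
Proof.
have d := time_derivative_at t x0 dw.
have e : (fun t => w t x0) = fun=> 0 by apply/funext.
apply/eqP; rewrite -oppr_eq0; apply/eqP.
rewrite -(@derive_val _ _ _ _ _ _ _ d) e; exact: derive_cst.
Qed.

Lemma al0 t : al t x0 = 0.
Proof.
have -> : al t x0 = helmholtz (reaction t) x0 + dhelmholtz (reaction t) x0.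
  by rewrite /helmholtz /dhelmholtz /al; field.
by rewrite phi0 dphi0 addr0.
Qed.

Let Q t := oint (fun x => expR (2 * x) * al t x ^+ 2) x0 (x0 + pi *+ 2).

Let cexp : continuous (fun x : R => expR (2 * x)).
Proof.
apply: (@is_derive_continuous _ _ (fun x => expR (2 * x) * (2 * 1))) => x.
exact: is_derive_comp (is_derive_expR (2 * x)) (is_derive_scale 2 (is_derive_id x (1 : R))).
Qed.

Let cal t : continuous (al t).
Proof. exact: is_derive_continuous (is_derive_growing (hF t).2). Qed.

Let cQ (t : R) : continuous (fun x : R => expR (2 * x) * al t x ^+ 2).
Proof. by apply: continuous_mul => //; exact: continuous_sqr. Qed.

Let x0pi : x0 <= x0 + pi *+ 2.
Proof. by rewrite lerDl mulrn_wge0 // pi_ge0. Qed.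

Lemma Q_ge0 t : 0 <= Q t.
Proof. by rewrite /Q; apply: (oint_ge0 (@cQ t) x0pi) => x _; rewrite mulr_ge0 ?expR_ge0 ?sqr_ge0. Qed.

(* al vanishes at x0, so integrating (al^3)' = 3 al^2 al' controls the sup norm by Q. *)
Lemma al_bound t x : `|al t x| ^+ 3 <= 6 * B * expR (- (2 * x0)) * Q t.
Proof.
have [p cF] := hF t; have b := B_gt0.
have pal : on_circle (al t) := circle_growing p cF.
have dal := is_derive_growing cF : antideriv (al t) (fun x => al t x - reaction t x).
have [y hy ey] : exists2 y, x0 <= y <= x0 + pi *+ 2 & al t x = al t y.
  have [z hz ez] := circle_representative (x - x0 - pi).
  exists (z + x0 + pi); first by move: hz; rewrite mulr2n; lra.
  have := ez (fun s => al t (s + x0 + pi)); rewrite (_ : x - x0 - pi + x0 + pi = x); last by ring.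
  apply => s.
  by rewrite -(pal (s + x0 + pi)); congr al; ring.
rewrite ey -normrX; have -> : al t y ^+ 3 = oint (fun s => 3 * al t s ^+ 2 * (al t s - reaction t s)) x0 y.
  have D (s : R) : is_derive s 1 (fun s => al t s ^+ 3) (3 * al t s ^+ 2 * (al t s - reaction t s)) := is_derive_exp 3 (dal s).
  rewrite (oint_FTC _ _ _ D) ?al0 ?expr0n ?subr0 //.
  apply: continuous_mul; first by apply: continuous_scale; exact: continuous_sqr.
  exact: continuous_sub.
have cA : continuous (fun s : R => 3 * al t s ^+ 2 * (al t s - reaction t s)).
  apply: continuous_mul; first by apply: continuous_scale; exact: continuous_sqr.
  exact: continuous_sub.
(* The 3 comes from the cube and 2 B bounds the derivative of [al t]; the exponential compensates
   the weight, since s >= x0. *)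
pose k := 6 * B * expR (- (2 * x0)).
have k0 : 0 <= k by rewrite /k mulr_ge0 ?expR_ge0 // mulr_ge0 // ltW.
have cK : continuous (fun s : R => k * (expR (2 * s) * al t s ^+ 2)) by apply: continuous_scale.
have pt s : x0 <= s -> `|3 * al t s ^+ 2 * (al t s - reaction t s)| <= k * (expR (2 * s) * al t s ^+ 2).
  move=> s0; have q0 : 0 <= 3 * al t s ^+ 2 := mulr_ge0 (ler0n _ 3) (sqr_ge0 _).
  rewrite normrM (ger0_norm q0).
  have h1 : `|al t s - reaction t s| <= 2 * B.
    have := growing_sol_bound p cF (fun x => reaction_bound t x) s; have := reaction_bound t s.
    have := ler_normB (al t s) (reaction t s); rewrite /al; lra.
  have h2 : 1 <= expR (- (2 * x0)) * expR (2 * s).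
    by rewrite -expRD; apply: le_trans (expR_ge1Dx _); lra.
  apply: le_trans (_ : 3 * al t s ^+ 2 * (2 * B) <= _).
    exact: ler_wpM2l.
  rewrite /k (_ : 6 * B * _ * _ = 3 * al t s ^+ 2 * (2 * B) * (expR (- (2 * x0)) * expR (2 * s))); last by ring.
  by apply: ler_peMr h2; apply: mulr_ge0 => //; rewrite mulr_ge0 // ltW.
have [y1 y2] : x0 <= y /\ y <= x0 + pi *+ 2 by apply/andP.
apply: le_trans (_ : oint (fun s => k * (expR (2 * s) * al t s ^+ 2)) x0 y <= _).
  rewrite ler_norml; apply/andP; split.
    rewrite -mulN1r -ointZ //; apply: oint_le => //; first exact: continuous_scale.
    move=> s /andP[s0 _]; have := pt s s0; rewrite ler_norml => /andP[h _]; lra.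
  by apply: oint_le => // s /andP[s0 _]; have := pt s s0; rewrite ler_norml => /andP[_ h].
rewrite ointZ // -/k; apply: ler_wpM2l => //; rewrite /Q -(oint_cat _ x0 y (x0 + pi *+ 2)) lerDl; apply: (oint_ge0 (@cQ t) y2) => s _.
by rewrite mulr_ge0 ?expR_ge0 ?sqr_ge0.
Qed.

(* [w] vanishes at [x0] and cannot cross the level [k], where
   [|c w + w^2/2| >= k^2/2]. *)
Lemma small_reaction_small t k : 0 < k -> (c = 0 \/ k <= `|c|) ->
  (forall x, `|reaction t x| < k ^+ 2 / 2) -> forall x, `|w t x| <= k.
Proof.
move=> k0 kc hF' x; rewrite leNgt; apply/negP => kx.
have [_ cw] := hw t.
have cn : continuous (fun x => `|w t x|) by move=> z; apply: cvg_norm; exact: cw.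
have [z hz] : exists z, `|w t z| = k.
  wlog : / True by apply.
  move=> _; case: (leP x0 x) => xx.
    have [|z _ hz] := @IVT R (fun x => `|w t x|) x0 x k xx (continuous_subspaceT cn).
      by rewrite w0 normr0 min_l ?max_r //; apply/andP; split; exact: ltW.
    by exists z.
  have [|z _ hz] := @IVT R (fun x => `|w t x|) x x0 k (ltW xx) (continuous_subspaceT cn).
    by rewrite w0 normr0 min_r ?max_l //; apply/andP; split; exact: ltW.
  by exists z.
have := hF' z; rewrite ltNge => /negP; apply.
have -> : reaction t z = w t z * (c + w t z / 2) by rewrite /reaction; field.
rewrite normrM hz expr2 -mulrA ler_pM2l //.
have n2 : `|w t z / 2| = k / 2 by rewrite normrM hz (gtr0_norm (x := 2^-1)) ?invr_gt0.
(* Where |w| = k, |c + w/2| >= k/2: this is an equality if c = 0, and otherwise |c| >= k leaves at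
   least |c| - k/2. *)
case: kc => [->|kc]; first by rewrite add0r n2.
have := ler_normB (c + w t z / 2) (w t z / 2); rewrite addrK n2; lra.
Qed.

Lemma norm_add3_le (a b d e1 e2 e3 : R) : `|a| <= e1 -> `|b| <= e2 -> `|d| <= e3 ->
  `|a - b + d| <= e1 + e2 + e3.
Proof.
move=> h1 h2 h3; apply: le_trans (ler_normD _ _) (lerD _ h3).
by apply: le_trans (ler_normB _ _) (lerD h1 h2).
Qed.

(** By [al_bound], a small Q makes phi + phi_x uniformly small. As its derivative is itself minus F,
    the mean value theorem on [x, x + h] makes F small at some point z, and the equicontinuity of w
    brings this back to x. *)
Lemma small_Q_small k : 0 < k -> (c = 0 \/ k <= `|c|) ->
  exists2 d : R, 0 < d & forall t, Q t <= d -> forall x, `|w t x| <= k.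
Proof.
move=> k0 kc; have b := B_gt0; have m0 := M0.
(* The bound e is used twice, at z and for the passage from z to x, and 2 e stays below the
   threshold k^2/2. *)
pose e := k ^+ 2 / 8; have e0 : 0 < e by rewrite divr_gt0 // exprn_gt0.
pose Lp := `|c| + M; have L0 : 0 < Lp by rewrite /Lp ltr_wpDl.
have [r r0 hr] := ew (e := e / Lp) ltac:(by rewrite divr_gt0).
pose h := Num.min 1 (r / 2).
have h0 : 0 < h by rewrite lt_min ltr01 divr_gt0.
have h1 : h <= 1 by rewrite ge_min lexx.
have h2 : h <= r / 2 by rewrite ge_min lexx orbT.
(* Three terms, each of size at most eta, bound h F(z), so that |F(z)| <= 3 eta/h = e. *)
pose eta := e * h / 3; have eta0 : 0 < eta by rewrite divr_gt0 // mulr_gt0.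
pose K := 6 * B * expR (- (2 * x0)).
have K0 : 0 < K by rewrite /K mulr_gt0 ?expR_gt0 // mulr_gt0.
exists (eta ^+ 3 / K); first by rewrite divr_gt0 // exprn_gt0.
move=> t hQ.
have ha x : `|al t x| <= eta.
  rewrite -(@ler_pXn2r _ 3) ?nnegrE ?normr_ge0 ?(ltW eta0) //.
  apply: le_trans (al_bound t x) _; rewrite -/K.
  by rewrite mulrC -ler_pdivlMr.
apply: small_reaction_small => // x.
have [p cF] := hF t.
have [z /andP[z1 z2] E] := @mean_value R (al t) (fun x => al t x - reaction t x) x (x + h) ltac:(lra)
  (fun s _ => is_derive_growing cF s).
have Fz : `|reaction t z| <= 3 * e / 4 * 4 / 3.
  have E2 : h * reaction t z = h * al t z - al t (x + h) + al t x.
    have rr (A0 A1 Az F : R) : A1 - A0 = (Az - F) * (x + h - x) -> h * F = h * Az - A1 + A0 by lra.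
    exact: rr E.
  have : `|h * reaction t z| <= 3 * eta.
    rewrite E2; have a1 := ha z; have a2 := ha (x + h); have a3 := ha x.
    have a4 : `|h * al t z| <= eta.
      rewrite normrM (gtr0_norm h0); apply: le_trans (_ : 1 * `|al t z| <= _); last by rewrite mul1r.
      by rewrite ler_wpM2r.
    by rewrite (_ : 3 * eta = eta + eta + eta) ?(norm_add3_le a4 a2 a3) //; ring.
  rewrite normrM (gtr0_norm h0) /eta mulrC -ler_pdivlMr // => q; apply: le_trans q _.
  by rewrite ler_pdivrMr //; lra.
have Fx : `|reaction t x - reaction t z| <= e.
  have -> : reaction t x - reaction t z = (w t x - w t z) * (c + (w t x + w t z) / 2).
    by rewrite /reaction; field.
  have q1 : `|w t x - w t z| <= e / Lp.
    apply: hr; rewrite distrC ger0_norm ?subr_ge0 //; apply: le_lt_trans (_ : h < r).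
      by rewrite lerBlDl.
    by apply: le_lt_trans h2 _; rewrite ltr_pdivrMr // ltr_pMr ?ltr1n.
  have q2 : `|c + (w t x + w t z) / 2| <= Lp.
    have := ler_normD c ((w t x + w t z) / 2); have := ler_normD (w t x) (w t z).
    have := bw t x; have := bw t z; rewrite (normrM (_ + _)) (gtr0_norm (x := 2^-1)) ?invr_gt0 // /Lp; lra.
  rewrite normrM; apply: le_trans (ler_pM (normr_ge0 _) (normr_ge0 _) q1 q2) _.
  by rewrite divfK // gt_eqF.
have := ler_normD (reaction t x - reaction t z) (reaction t z); rewrite subrK.
have k2 : 0 < k ^+ 2 by rewrite exprn_gt0.
move: Fx Fz; rewrite /e; lra.
Qed.

(** The polynomial in w is the antiderivative of c w + w^2/2, so D' is the weighted integral of F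
    w_t = - F phi_x. *)
Let D t := oint (fun x => expR (2 * x) * (c / 2 * w t x ^+ 2 + 6^-1 * w t x ^+ 3)) x0 (x0 + pi *+ 2).

Let hP : circle_family (fun t x => c / 2 * w t x ^+ 2 + 6^-1 * w t x ^+ 3).
Proof.
move=> t; have [p cw] := hw t; split; first by move=> x; rewrite p.
apply: continuous_add; apply: continuous_scale; first exact: continuous_sqr.
by under eq_fun do rewrite exprS; apply: continuous_mul => //; exact: continuous_sqr.
Qed.

(* For [phi'' = phi - F], [(e^(2x) (phi^2 + phi'^2)/2)' =
   - e^(2x) F phi' + e^(2x) (phi + phi')^2]; the boundary terms vanish at [x0]. *)
Lemma is_derive_D : antideriv D (fun t => - Q t).
Proof.
move=> t.
pose w' t x := - dhelmholtz (reaction t) x.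
have hw' : circle_family w'.
  move=> s; have [p cd] := circle_family_dhelmholtz hF s; split; first by move=> x; rewrite /w' p.
  by move=> x; apply: cvgN; exact: cd.
have d2 := time_derivative_mul hw hw' hw hw' dw dw.
have hw2 := circle_family_mul hw hw.
have hw2' : circle_family (fun t x => w' t x * w t x + w t x * w' t x).
  have := circle_family_lin 1 1 (circle_family_mul hw' hw) (circle_family_mul hw hw').
  rewrite (_ : (fun t x => _) = (fun t x => w' t x * w t x + w t x * w' t x)) //.
  by apply/funext => s; apply/funext => x; rewrite !mul1r.
have d3 := time_derivative_mul hw hw' hw2 hw2' dw d2.
have dP := time_derivative_lin (c / 2) 6^-1 d2 d3.
have dP' : time_derivative (fun t x => c / 2 * w t x ^+ 2 + 6^-1 * w t x ^+ 3)
    (fun t x => reaction t x * w' t x).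
  rewrite (_ : (fun t x => c / 2 * w t x ^+ 2 + 6^-1 * w t x ^+ 3) =
    (fun t x => c / 2 * (w t x * w t x) + 6^-1 * (w t x * (w t x * w t x)))); last first.
    by apply/funext => s; apply/funext => x; ring.
  rewrite (_ : (fun t x => reaction t x * w' t x) = (fun t x =>
     c / 2 * (w' t x * w t x + w t x * w' t x) + 6^-1 * (w' t x * (w t x * w t x) + w t x * (w' t x * w t x + w t x * w' t x)))) //.
  apply/funext => s; apply/funext => x; rewrite /reaction; move: (w s x) (w' s x) => a b; by field.
have hFw := circle_family_mul hF hw'.
apply: is_derive_eq (time_derivative_oint_weight t x0pi cexp (fun s => (hP s).2) (fun s => (hFw s).2) dP') _.
have [p cF] := hF t.
have dH := is_derive_helmholtz cF; have dA := is_derive_dhelmholtz cF.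
pose ph := helmholtz (reaction t); pose dph := dhelmholtz (reaction t).
have pH : on_circle ph := circle_helmholtz p cF; have pA : on_circle dph := circle_dhelmholtz p cF.
have alE x : al t x = ph x + dph x by rewrite /ph /dph /helmholtz /dhelmholtz /al; field.
have de x := is_derive_comp (is_derive_expR (2 * x)) (is_derive_scale 2 (is_derive_id x (1 : R))).
have Dx (x : R) : is_derive x 1 (fun y => expR (2 * y) * (2^-1 * (ph y ^+ 2 + dph y ^+ 2)))
   (expR (2 * x) * (reaction t x * w' t x) + expR (2 * x) * al t x ^+ 2).
  apply: is_derive_eq (is_derive_mul (de x) (is_derive_scale 2^-1
    (is_derive_add (is_derive_exp 2 (dH x)) (is_derive_exp 2 (dA x))))) _.
  rewrite alE /w' -/ph -/dph /= !expr1; move: (ph x) (dph x) (expR _) (reaction t x) => a b E F; by field.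
have c1 : continuous (fun x : R => expR (2 * x) * (reaction t x * w' t x)).
  by apply: continuous_mul => //; exact: (hFw t).2.
have := oint_FTC x0 (x0 + pi *+ 2) (continuous_add c1 (@cQ t)) Dx.
rewrite ointD // pH pA /ph /dph phi0 dphi0 expr0n /= addr0 !mulr0 subrr -/(Q t) => h.
by apply/eqP; rewrite -subr_eq0 opprK h.
Qed.

Lemma D_small k t : 0 < k -> k <= 1 -> (forall x, `|w t x| <= k) ->
  `|D t| <= k * (expR (2 * (x0 + pi *+ 2)) * (`|c| + 1) * (pi *+ 2)).
Proof.
move=> k0 k1 hk; have [p cP] := hP t.
apply: le_trans (@oint_bound _ _ _ _ (expR (2 * (x0 + pi *+ 2)) * (k * (`|c| + 1))) _ x0pi _) _.
- exact: continuous_mul.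
- move=> x /andP[_ hx]; rewrite normrM (ger0_norm (expR_ge0 _)); apply: ler_pM => //.
    by rewrite ler_expR ler_pM2l.
  have a1 : `|w t x| ^+ 2 <= k.
    by rewrite expr2; apply: le_trans (ler_pM (normr_ge0 _) (normr_ge0 _) (hk x) (hk x)) _; rewrite ler_piMr // ltW.
  have a2 : `|w t x| ^+ 3 <= k.
    by rewrite exprS; apply: le_trans (ler_pM (normr_ge0 _) (exprn_ge0 _ (normr_ge0 _)) (hk x) a1) _; rewrite ler_piMr // ltW.
  apply: le_trans (ler_normD _ _) _; rewrite (normrM (c / 2)) (normrM c) (normrM 6^-1) !normrX !(ger0_norm (x := _^-1)) ?invr_ge0 //.
  have a3 : `|c| * `|w t x| ^+ 2 <= `|c| * k by rewrite ler_wpM2l.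
  have a4 : 0 <= `|c| * k by rewrite mulr_ge0 // ltW.
  have a5 : 0 <= `|c| * `|w t x| ^+ 2 by rewrite mulr_ge0 // exprn_ge0.
  lra.
rewrite (_ : x0 + pi *+ 2 - x0 = pi *+ 2); last by ring.
by rewrite le_eqVlt; apply/orP; left; apply/eqP; move: (pi *+ 2) (expR _) `|c| => a b d; ring.
Qed.

Lemma D_bounded : exists2 DM : R, 0 < DM & forall t, `|D t| <= DM.
Proof.
pose Pm := `|c| / 2 * M ^+ 2 + 6^-1 * M ^+ 3; have m0 := M0.
have Pm0 : 0 < Pm by rewrite /Pm ltr_wpDl ?mulr_gt0 ?exprn_gt0 ?invr_gt0 // !mulr_ge0 ?exprn_ge0 // ltW.
have p2 : 0 < (pi : R) *+ 2 by rewrite mulrn_wgt0 // pi_gt0.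
exists (expR (2 * (x0 + pi *+ 2)) * Pm * (x0 + pi *+ 2 - x0)).
  by rewrite (_ : x0 + pi *+ 2 - x0 = pi *+ 2); [rewrite !mulr_gt0 ?expR_gt0|ring].
move=> t; have [p cP] := hP t; apply: oint_bound => //; first exact: continuous_mul.
move=> x /andP[_ hx]; rewrite normrM (ger0_norm (expR_ge0 _)); apply: ler_pM => //.
  by rewrite ler_expR ler_pM2l.
apply: le_trans (ler_normD _ _) _; rewrite (normrM (c / 2)) (normrM c) (normrM 6^-1) !normrX !(ger0_norm (x := _^-1)) ?invr_ge0 //.
by apply: lerD; rewrite ler_wpM2l ?divr_ge0 ?invr_ge0 // lerXn2r ?nnegrE // ltW.
Qed.

(* [D] is nonincreasing and bounded, so [Q = - D'] is small somewhere in every long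
   time interval; there [w], hence [D], is small. *)
Lemma D_eq0 t : D t = 0.
Proof.
have p2 : 0 < (pi : R) *+ 2 by rewrite mulrn_wgt0 // pi_gt0.
have [DM DM0 hD] := D_bounded.
pose W := expR (2 * (x0 + pi *+ 2)) * (`|c| + 1) * (pi *+ 2).
have W0 : 0 < W by rewrite /W !mulr_gt0 ?expR_gt0 // ltr_wpDl.
have mono s s' : s <= s' -> D s' <= D s.
  move=> ss; apply: (@mean_value_le _ D (fun t => - Q t)) => // r _; split; first exact: is_derive_D.
  by rewrite oppr_le0 Q_ge0.
have key e s : 0 < e -> (exists2 r, r <= s & `|D r| <= e) /\ (exists2 r, s <= r & `|D r| <= e).
  move=> e0.
  (* The first two bounds turn [D_small] into |D| <= e; the third is the condition of
     [small_Q_small] relating k to c. *)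
  pose k := Num.min (Num.min 1 (e / W)) (if c == 0 then 1 else `|c|).
  have k0 : 0 < k.
    rewrite !lt_min ltr01 divr_gt0 //=; case: eqP => [//|/eqP cn]; by rewrite normr_gt0.
  have k1 : k <= 1 by rewrite !ge_min lexx.
  have k2 : k <= e / W by rewrite !ge_min lexx orbT.
  have kc : c = 0 \/ k <= `|c|.
    case: (eqVneq c 0) => cn; [by left|right]; by rewrite /k (negbTE cn) !ge_min lexx !orbT.
  have [d d0 hd] := small_Q_small k0 kc.
  have fin r : Q r <= d -> `|D r| <= e.
    move=> qr; apply: le_trans (D_small k0 k1 (hd r qr)) _.
    by rewrite -/W -ler_pdivlMr.
  (* Over a time interval of this length D varies by at most 2 DM, so Q <= 2 DM/L = d at some time
     in it. *)
  pose L := 2 * DM / d; have L0 : 0 < L by rewrite divr_gt0 // mulr_gt0.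
  have find s1 : exists2 r, s1 <= r <= s1 + L & `|D r| <= e.
    have [r hr E] := @mean_value _ D (fun t => - Q t) s1 (s1 + L) ltac:(lra) (fun r _ => is_derive_D r).
    exists r => //; apply: fin; rewrite -(ler_pM2r L0); have -> : d * L = 2 * DM by rewrite /L mulrC divfK // gt_eqF.
    have := hD s1; have := hD (s1 + L); rewrite !ler_norml.
    by move: E; rewrite (_ : s1 + L - s1 = L); [lra|ring].
  split.
    by have [r /andP[_ r2] hr] := find (s - L); exists r => //; rewrite subrK in r2.
  by have [r /andP[r1 _] hr] := find s; exists r.
(* As D is nonincreasing, an earlier time where D is small bounds D t from above and a later one
   bounds it from below. *)
apply/eqP; rewrite eq_le; apply/andP; split.
  apply/ler_addgt0Pr => e e0; rewrite add0r; have [[r rt hr] _] := key e t e0.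
  by apply: le_trans (mono r t rt) _; apply: le_trans hr; exact: ler_norm.
rewrite -oppr_le0; apply/ler_addgt0Pr => e e0; rewrite add0r; have [_ [r rt hr]] := key e t e0.
rewrite lerNl; apply: le_trans (mono t r rt); rewrite lerNl; apply: le_trans hr; rewrite -normrN; exact: ler_norm.
Qed.

(** With D identically zero, Q = - D' is zero, hence below every threshold of [small_Q_small], and
    |w| is below every positive k allowed there. *)
Lemma perturbation_eq0 t x : w t x = 0.
Proof.
have Q0 : Q t = 0.
  have e : D = fun=> 0 by apply/funext => s; exact: D_eq0.
  apply/eqP; rewrite -oppr_eq0; apply/eqP.
  by rewrite -(@derive_val _ _ _ _ _ _ _ (is_derive_D t)) e; exact: derive_cst.
apply/eqP; rewrite -normr_le0; apply/ler_addgt0Pr => e e0; rewrite add0r.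
pose k := Num.min e (if c == 0 then 1 else `|c|).
have k0 : 0 < k by rewrite lt_min e0 /=; case: eqP => [//|/eqP cn]; rewrite normr_gt0.
have kc : c = 0 \/ k <= `|c|.
  case: (eqVneq c 0) => cn; [by left|right]; by rewrite /k (negbTE cn) ge_min lexx orbT.
have [d d0 hd] := small_Q_small k0 kc.
have := hd t _ x; rewrite Q0 => /(_ (ltW d0)) h; apply: le_trans h _.
by rewrite ge_min lexx.
Qed.

End estimates.
End Lyapunov.

(** * Constants, and the passage from u to w = u - C *)

Section Constants.
Set Implicit Arguments.
Unset Strict Implicit.
Unset Printing Implicit Defensive.
Variable R : realType.

Lemma growing_sol1 : growing_sol (fun=> 1 : R) = fun=> 1.
Proof.
apply: growing_solE => // x; [exact: continuous_const|].
by rewrite subrr; exact: is_derive_const.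
Qed.

Lemma helmholtz1 : helmholtz (fun=> 1 : R) = fun=> 1.
Proof. by apply/funext => x; rewrite /helmholtz /decaying_sol growing_sol1; lra. Qed.

Lemma dhelmholtz1 : dhelmholtz (fun=> 1 : R) = fun=> 0.
Proof. by apply/funext => x; rewrite /dhelmholtz /decaying_sol growing_sol1 subrr mul0r. Qed.

(** Since [helmholtz] fixes constants, this gives psi = phi + C + C^2/2, so the condition on psi at
    x0 says that phi vanishes there. The factors 1 fit the shape of [helmholtz_lin]. *)
Lemma flux_shift (u : R -> R -> R) C t :
  flux u t = fun x => 1 * reaction (1 + C) (fun t x => u t x - C) t x + (C + C ^+ 2 / 2) * 1.
Proof. by apply/funext => x; rewrite /flux /reaction; field. Qed.

End Constants.

Theorem theorem1p2 (R : realType) (u psi : R -> R -> R) (x0 C T : R)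
  (u_H1 : continuous_in_H1 u)
  (u_sol : distributional_solution u)
  (psi_def : forall t, inv_helmholtz (fun x => u t x + u t x ^+ 2 / 2) (psi t))
  (T_gt0 : 0 < T)
  (u_x0 : forall t, 0 < t < T -> u t x0 = C)
  (psi_x0 : forall t, 0 < t < T -> psi t x0 = C + C ^+ 2 / 2) :
  forall t x, u t x = C.
Proof.
have hu := H1_circle_family u_H1.
have hf := circle_family_flux hu.
pose w t x := u t x - C.
have hw : circle_family w.
  move=> t; have [p cu] := hu t; split; first by move=> x; rewrite /w p.
  by apply: continuous_sub => //; exact: continuous_const.
have hr := circle_family_reaction (1 + C) hw.
have [p1 c1] : on_circle (fun _ : R => 1 : R) /\ continuous (fun _ : R => 1 : R).
  by split=> //; exact: continuous_const.
have Hf t : helmholtz (flux u t) x0 = helmholtz (reaction (1 + C) w t) x0 + (C + C ^+ 2 / 2).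
  have [p c] := hr t.
  by rewrite (flux_shift u C t) (helmholtz_lin 1 (C + C ^+ 2 / 2) p c p1 c1) helmholtz1 mul1r mulr1.
have Df t x : dhelmholtz (flux u t) x = dhelmholtz (reaction (1 + C) w t) x.
  have [p c] := hr t.
  by rewrite (flux_shift u C t) (dhelmholtz_lin 1 (C + C ^+ 2 / 2) p c p1 c1) dhelmholtz1 mul1r mulr0 addr0.
have dw : time_derivative w (fun t x => - dhelmholtz (reaction (1 + C) w t) x).
  move=> t e e0; have [r r0 h] := solution_time_derivative u_H1 u_sol t e0.
  exists r => // k kr x; rewrite -Df (_ : w (t + k) x - w t x = u (t + k) x - u t x); last by rewrite /w; ring.
  exact: h.
have [U U0 hU] := sup_global u_H1 u_sol.
pose M := U + `|C| + 1; have M0 : 0 < M by rewrite /M ltr_wpDl // addr_ge0.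
have bw t x : `|w t x| <= M.
  by apply: le_trans (ler_normB _ _) _; have := hU t x; rewrite /M; lra.
have ew e : 0 < e -> exists2 r : R, 0 < r & forall t x y, `|x - y| < r -> `|w t x - w t y| <= e.
  move=> e0; have [r r0 h] := equicontinuous_global u_H1 u_sol e0; exists r => // t x y xy.
  by rewrite (_ : w t x - w t y = u t x - u t y); [exact: h|rewrite /w; ring].
have w0 : forall t, w t x0 = 0.
  apply: (solution_zero_everywhere hw dw (ltW M0) bw T_gt0) => t tT.
  by rewrite /w u_x0 // subrr.
have phi0 : forall t, helmholtz (reaction (1 + C) w t) x0 = 0.
  (* On (0, T) the hypothesis on psi is used through [inv_helmholtzE], which identifies psi with the
     explicit solution for the flux of u. *)
  apply: (helmholtz_zero_everywhere hw dw (ltW M0) bw T_gt0) => t tT.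
  have [p c] := hf t.
  have := inv_helmholtzE p c (psi_def t) => E.
  by apply: (addIr (C + C ^+ 2 / 2)); rewrite add0r -[RHS](psi_x0 t tT) E Hf.
move=> t x; apply/eqP; rewrite -subr_eq0; apply/eqP.
exact: (perturbation_eq0 M0 hw bw ew w0 dw phi0).
Qed.
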